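(* Let $N\ge 1$, let $k\in\mathbb C$, and let $L$ be an invertible complex symmetric $N\times N$ matrix. Then the center $Z(\mathbb D_{k,L})$ of $\mathbb D_{k,L}$ is the image of the center $\mathfrak Z(\mathfrak g)$ of $\mathfrak U(\mathfrak g)$ under the projection $\mathfrak U(\mathfrak g)^{\mathfrak k}\to\mathbb D_{k,L}$, and it is the one-variable polynomial algebra $\mathbb C[\Omega_N+(\mathcal I_{k,L})^{\mathfrak k}]$ generated by the class of the Casimir element $\Omega_N$.
   Context: All vector spaces are complex. $\mathfrak g=\mathfrak g^J_N$ (the complexified Lie algebra of the real Jacobi group of degree $1$ and rank $N$) is the Lie algebra with basis $E,F,H$; $e_r,f_r$ ($1\le r\le N$); $Z_{rs}$ ($1\le r\le s\le N$), with $Z_{sr}:=Z_{rs}$, and brackets: $[H,E]=2E$, $[H,F]=-2F$, $[E,F]=H$ (so $E,F,H$ span $\mathfrak{sl}_2$); $[H,e_r]=e_r$, $[H,f_r]=-f_r$, $[E,e_r]=0$, $[E,f_r]=-e_r$, $[F,e_r]=-f_r$, $[F,f_r]=0$; $[e_r,f_s]=-2Z_{rs}$, $[e_r,e_s]=[f_r,f_s]=0$; all $Z_{rs}$ central. Put $\tilde H:=i(F-E)$ and $\tilde Z_{rs}:=\tfrac12 iZ_{rs}$, and $\mathfrak k:=\mathfrak k^J_N:=\mathrm{Span}\{\tilde H,\tilde Z_{rs}\}$. $\mathfrak U(\mathfrak g)$ is the universal enveloping algebra, $\mathfrak U(\mathfrak g)^{\mathfrak k}$ is the commutant of $\mathfrak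 k$ in it. For $k\in\mathbb C$ and $L$ a complex symmetric $N\times N$ matrix, $\mathcal I_{k,L}$ is the left ideal of $\mathfrak U(\mathfrak g)$ generated by $\tilde H-k$ and all $\tilde Z_{rs}+\pi L_{rs}$; $(\mathcal I_{k,L})^{\mathfrak k}:=\mathcal I_{k,L}\cap\mathfrak U(\mathfrak g)^{\mathfrak k}$ is a two-sided ideal of $\mathfrak U(\mathfrak g)^{\mathfrak k}$, and $\mathbb D_{k,L}:=\mathfrak U(\mathfrak g)^{\mathfrak k}/(\mathcal I_{k,L})^{\mathfrak k}$. (This is the standard algebraic description of the algebra of differential operators invariant under the scalar slash action $|_{k,L}$ of the Jacobi group, with which it is identified.) Let $Z$ be the symmetric matrix $(Z_{rs})$ and $e,f$ the column vectors of the $e_r$, $f_r$. In the localization $\mathfrak U(\mathfrak g)[\det(Z)^{-1}]$ set $\nu(H):=H-\tfrac14(f^TZ^{-1}e+e^TZ^{-1}f)$, $\nu(E):=E-\tfrac14e^TZ^{-1}e$, $\nu(F):=F+\tfrac14f^TZ^{-1}f$; this defines an algebra homomorphism $\nu:\mathfrak U(\mathfrak{sl}_2)\to\mathfrak U(\mathfrak g)[\det(Z)^{-1}]$. With $\Omega_{\mathfrak{sl}_2}:=H^2+2H+4FE$, the Casimir element of $\mathfrak U(\mathfrak g)$ is $\Omega_N:=\det(Z)\bigl(\nu(\Omega_{\mathfrak{sl}_2})-\tfrac14N(N+4)\bigr)$, which lies in $\mathfrak U(\mathfrak g)$. *)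

(* Defs.v *)
From HB Require Import structures.
From mathcomp Require Import all_boot all_order all_algebra.
From mathcomp Require Import generic_quotient ring_quotient.
From mathcomp Require Import boolp classical_sets reals trigo complex.

Set Implicit Arguments.
Unset Strict Implicit.
Unset Printing Implicit Defensive.

Import Order.TTheory GRing.Theory Num.Theory.
Local Open Scope ring_scope.
Local Open Scope classical_set_scope.
Local Open Scope quotient_scope.

(* Unital associative algebras in the sense of a ring with a central ring
   homomorphism from the scalars. [algType] is not used because it forces
   [1 != 0], which for a quotient such as D_{k,L} is not known beforehand. *)
HB.mixin Record PzRing_isPzAlgebra (K : pzRingType) A of GRing.PzRing A := {
  scal : K -> A;
  scal1 : scal 1 = 1;
  scalD : forall c d, scal (c + d) = scal c + scal d;
  scalM : forall c d, scal (c * d) = scal c * scal d;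
  scalC : forall c x, scal c * x = x * scal c
}.
#[short(type="pzAlgType")]
HB.structure Definition PzAlgebra (K : pzRingType) :=
  {A of GRing.PzRing A & PzRing_isPzAlgebra K A}.

HB.mixin Record Lmodule_isLieAlgebra (K : pzRingType) V
    of GRing.Lmodule K V := {
  lie : V -> V -> V;
  lieDl : forall x y z, lie (x + y) z = lie x z + lie y z;
  lieZl : forall (c : K) x y, lie (c *: x) y = c *: lie x y;
  lieDr : forall x y z, lie x (y + z) = lie x y + lie x z;
  lieZr : forall (c : K) x y, lie x (c *: y) = c *: lie x y;
  liexx : forall x, lie x x = 0;
  lieJ : forall x y z, lie x (lie y z) + lie y (lie z x) + lie z (lie x y) = 0
}.
#[short(type="lieAlgType")]
HB.structure Definition LieAlgebra (K : pzRingType) :=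
  {V of GRing.Lmodule K V & Lmodule_isLieAlgebra K V}.

Section Presented.
Variables (K : comPzRingType) (X : Type).

Inductive term : Type :=
| Gen of X | Cst of K | Add of term & term | Mul of term & term.

HB.instance Definition _ := gen_eqMixin term.
HB.instance Definition _ := gen_choiceMixin term.

Variable rel : term -> term -> Prop.

Inductive pres_eq : term -> term -> Prop :=
| pres_rel x y : rel x y -> pres_eq x y
| pres_refl x : pres_eq x x
| pres_sym x y : pres_eq x y -> pres_eq y x
| pres_trans y x z : pres_eq x y -> pres_eq y z -> pres_eq x z
| pres_Add x x' y y' :
    pres_eq x x' -> pres_eq y y' -> pres_eq (Add x y) (Add x' y')
| pres_Mul x x' y y' :
    pres_eq x x' -> pres_eq y y' -> pres_eq (Mul x y) (Mul x' y')
| pres_addA x y z : pres_eq (Add x (Add y z)) (Add (Add x y) z)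
| pres_addC x y : pres_eq (Add x y) (Add y x)
| pres_add0 x : pres_eq (Add (Cst 0) x) x
| pres_addN x : pres_eq (Add (Mul (Cst (-1)) x) x) (Cst 0)
| pres_mulA x y z : pres_eq (Mul x (Mul y z)) (Mul (Mul x y) z)
| pres_mul1l x : pres_eq (Mul (Cst 1) x) x
| pres_mul1r x : pres_eq (Mul x (Cst 1)) x
| pres_mulDl x y z : pres_eq (Mul (Add x y) z) (Add (Mul x z) (Mul y z))
| pres_mulDr x y z : pres_eq (Mul x (Add y z)) (Add (Mul x y) (Mul x z))
| pres_CstD c d : pres_eq (Cst (c + d)) (Add (Cst c) (Cst d))
| pres_CstM c d : pres_eq (Cst (c * d)) (Mul (Cst c) (Cst d))
| pres_CstC c x : pres_eq (Mul (Cst c) x) (Mul x (Cst c)).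

Definition pres_eqb (x y : term) : bool := `[< pres_eq x y >].

Fact pres_eqb_equiv : equiv_class_of pres_eqb.
Proof.
split=> [x|x y|y x z]; first by apply/asboolP; exact: pres_refl.
- by apply/asboolP/asboolP; exact: pres_sym.
- by move=> /asboolP xy /asboolP yz; apply/asboolP; apply: pres_trans xy yz.
Qed.

Canonical pres_eqb_equivRel := EquivRelPack pres_eqb_equiv.
Canonical pres_eqb_encModRel := defaultEncModRel pres_eqb.

(* The associative unital K-algebra with generators X and relations rel. *)
Definition pres_alg := {eq_quot pres_eqb}.

HB.instance Definition _ := Choice.on pres_alg.
HB.instance Definition _ : EqQuotient _ pres_eqb pres_alg :=
  EqQuotient.on pres_alg.

Definition pres_class (x : term) : pres_alg := \pi_pres_alg x.
Definition pres_gen (x : X) : pres_alg := pres_class (Gen x).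

Definition pres_add (x y : pres_alg) := pres_class (Add (repr x) (repr y)).
Definition pres_mul (x y : pres_alg) := pres_class (Mul (repr x) (repr y)).
Definition pres_opp (x : pres_alg) := pres_class (Mul (Cst (-1)) (repr x)).

Lemma pres_classP x y : pres_class x = pres_class y <-> pres_eq x y.
Proof.
by split=> [/eqmodP/asboolP//|xy]; apply/eqmodP/asboolP.
Qed.

Lemma pres_classK x : pres_class (repr x) = x. Proof. exact: reprK. Qed.

Lemma pres_repr x : pres_eq (repr (pres_class x)) x.
Proof. by apply/pres_classP; rewrite pres_classK. Qed.

Lemma pres_classD x y : pres_class (Add x y) = pres_add (pres_class x) (pres_class y).
Proof. by apply/pres_classP/pres_sym/pres_Add; exact: pres_repr. Qed.

Lemma pres_classM x y : pres_class (Mul x y) = pres_mul (pres_class x) (pres_class y).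
Proof. by apply/pres_classP/pres_sym/pres_Mul; exact: pres_repr. Qed.

Fact pres_algA : associative pres_add.
Proof.
move=> x y z; rewrite -[x]pres_classK -[y]pres_classK -[z]pres_classK.
by rewrite -!pres_classD; apply/pres_classP/pres_addA.
Qed.
Fact pres_algC : commutative pres_add.
Proof.
move=> x y; rewrite -[x]pres_classK -[y]pres_classK.
by rewrite -!pres_classD; apply/pres_classP/pres_addC.
Qed.
Fact pres_alg0 : left_id (pres_class (Cst 0)) pres_add.
Proof.
move=> x; rewrite -[x]pres_classK -pres_classD.
by apply/pres_classP/pres_add0.
Qed.
Fact pres_algN : left_inverse (pres_class (Cst 0)) pres_opp pres_add.
Proof.
move=> x; rewrite -[x]pres_classK /pres_opp pres_classM pres_classK -pres_classM.
by rewrite -pres_classD; apply/pres_classP/pres_addN.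
Qed.
HB.instance Definition _ :=
  GRing.isZmodule.Build pres_alg pres_algA pres_algC pres_alg0 pres_algN.

Fact pres_algMA : associative pres_mul.
Proof.
move=> x y z; rewrite -[x]pres_classK -[y]pres_classK -[z]pres_classK.
by rewrite -!pres_classM; apply/pres_classP/pres_mulA.
Qed.
Fact pres_alg1l : left_id (pres_class (Cst 1)) pres_mul.
Proof.
move=> x; rewrite -[x]pres_classK -pres_classM.
by apply/pres_classP/pres_mul1l.
Qed.
Fact pres_alg1r : right_id (pres_class (Cst 1)) pres_mul.
Proof.
move=> x; rewrite -[x]pres_classK -pres_classM.
by apply/pres_classP/pres_mul1r.
Qed.
Fact pres_algDl : left_distributive pres_mul pres_add.
Proof.
move=> x y z; rewrite -[x]pres_classK -[y]pres_classK -[z]pres_classK.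
by rewrite -!(pres_classM, pres_classD); apply/pres_classP/pres_mulDl.
Qed.
Fact pres_algDr : right_distributive pres_mul pres_add.
Proof.
move=> x y z; rewrite -[x]pres_classK -[y]pres_classK -[z]pres_classK.
by rewrite -!(pres_classM, pres_classD); apply/pres_classP/pres_mulDr.
Qed.
HB.instance Definition _ := GRing.Zmodule_isPzRing.Build pres_alg
  pres_algMA pres_alg1l pres_alg1r pres_algDl pres_algDr.

Definition pres_scal (c : K) : pres_alg := pres_class (Cst c).

Fact pres_scal1 : pres_scal 1 = 1. Proof. by []. Qed.
Fact pres_scalD c d : pres_scal (c + d) = pres_scal c + pres_scal d.
Proof. by rewrite -[RHS]pres_classD; apply/pres_classP/pres_CstD. Qed.
Fact pres_scalM c d : pres_scal (c * d) = pres_scal c * pres_scal d.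
Proof. by rewrite -[RHS]pres_classM; apply/pres_classP/pres_CstM. Qed.
Fact pres_scalC c (x : pres_alg) : pres_scal c * x = x * pres_scal c.
Proof.
rewrite -[x]pres_classK -[LHS]pres_classM -[RHS]pres_classM.
exact/pres_classP/pres_CstC.
Qed.
HB.instance Definition _ := PzRing_isPzAlgebra.Build K pres_alg
  pres_scal1 pres_scalD pres_scalM pres_scalC.

Lemma pres_central (a : pres_alg) :
  (forall x, pres_gen x * a = a * pres_gen x) -> forall y, y * a = a * y.
Proof.
move=> gena y; rewrite -[y]pres_classK; elim: (repr y) => [x|c|s IHs t IHt|s IHs t IHt].
- exact: gena.
- exact: pres_scalC.
- rewrite (_ : pres_class _ = pres_class s + pres_class t) ?pres_classD//.
  by rewrite mulrDl mulrDr IHs IHt.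
- rewrite (_ : pres_class _ = pres_class s * pres_class t) ?pres_classM//.
  by rewrite -mulrA IHt mulrA IHs mulrA.
Qed.

End Presented.

Section UniversalEnvelopingAlgebra.
Variables (K : comPzRingType) (g : lieAlgType K).

Inductive uea_rel : term K g -> term K g -> Prop :=
| uea_relD x y : uea_rel (Gen K (x + y)) (Add (Gen K x) (Gen K y))
| uea_relZ c x : uea_rel (Gen K (c *: x)) (Mul (Cst g c) (Gen K x))
| uea_relB x y : uea_rel (Add (Gen K (lie x y)) (Mul (Gen K y) (Gen K x)))
                         (Mul (Gen K x) (Gen K y)).

Definition uea := pres_alg uea_rel.
HB.instance Definition _ := PzAlgebra.on uea.

Definition uea_in (x : g) : uea := pres_gen uea_rel x.

Lemma uea_inD x y : uea_in (x + y) = uea_in x + uea_in y.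
Proof.
by rewrite -[RHS]pres_classD; apply/pres_classP/pres_rel/uea_relD.
Qed.

Lemma uea_inZ c x : uea_in (c *: x) = scal c * uea_in x.
Proof.
by rewrite -[RHS]pres_classM; apply/pres_classP/pres_rel/uea_relZ.
Qed.

Lemma uea_in0 : uea_in 0 = 0.
Proof. by apply: (addIr (uea_in 0)); rewrite -uea_inD !add0r. Qed.

Lemma uea_in_lie x y :
  uea_in (lie x y) = uea_in x * uea_in y - uea_in y * uea_in x.
Proof.
apply/(addIr (uea_in y * uea_in x)); rewrite subrK.
have /pres_classP := pres_rel (uea_relB x y).
by rewrite pres_classD !pres_classM.
Qed.

End UniversalEnvelopingAlgebra.

Definition center (A : pzRingType) : set A := [set z | forall x, x * z = z * x].
Arguments center : clear implicits.

(* A[d^-1]; this is the usual localization when d is central. The generator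
   None is the inverse of d. *)
Section Localization.
Variables (K : comPzRingType) (A : pzAlgType K) (d : A).

Local Notation elt x := (Gen K (Some x)).
Local Notation inv := (Gen K None).

Inductive loc_rel : term K (option A) -> term K (option A) -> Prop :=
| loc_relD x y : loc_rel (elt (x + y)) (Add (elt x) (elt y))
| loc_relM x y : loc_rel (elt (x * y)) (Mul (elt x) (elt y))
| loc_relC c : loc_rel (elt (scal c)) (Cst _ c)
| loc_relVl : loc_rel (Mul inv (elt d)) (Cst _ 1)
| loc_relVr : loc_rel (Mul (elt d) inv) (Cst _ 1).

Definition loc := pres_alg loc_rel.
HB.instance Definition _ := PzAlgebra.on loc.

Definition loc_in (x : A) : loc := pres_gen loc_rel (Some x).
Definition loc_inv : loc := pres_gen loc_rel None.

Lemma loc_inD x y : loc_in (x + y) = loc_in x + loc_in y.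
Proof.
by rewrite -[RHS]pres_classD; apply/pres_classP/pres_rel/loc_relD.
Qed.

Lemma loc_inM x y : loc_in (x * y) = loc_in x * loc_in y.
Proof.
by rewrite -[RHS]pres_classM; apply/pres_classP/pres_rel/loc_relM.
Qed.

Lemma loc_in_scal c : loc_in (scal c) = scal c.
Proof. by apply/pres_classP/pres_rel/loc_relC. Qed.

Fact loc_in_zmod : zmod_morphism loc_in.
Proof.
move=> x y; apply: (addIr (loc_in y)).
by rewrite subrK -loc_inD subrK.
Qed.
HB.instance Definition _ := GRing.isZmodMorphism.Build A loc loc_in loc_in_zmod.

Fact loc_in_monoid : monoid_morphism loc_in.
Proof.
split; last exact: loc_inM.
by rewrite -scal1 loc_in_scal scal1.
Qed.
HB.instance Definition _ := GRing.isMonoidMorphism.Build A loc loc_in loc_in_monoid.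

Lemma loc_mulV : loc_inv * loc_in d = 1.
Proof. by rewrite -[LHS]pres_classM; apply/pres_classP/pres_rel/loc_relVl. Qed.

Lemma loc_mulVr : loc_in d * loc_inv = 1.
Proof. by rewrite -[LHS]pres_classM; apply/pres_classP/pres_rel/loc_relVr. Qed.

Lemma loc_central z : center A z -> center loc (loc_in z).
Proof.
move=> zC; apply: pres_central => -[x|].
  by have := congr1 loc_in (zC x); rewrite !loc_inM.
have zd : loc_in z * loc_in d = loc_in d * loc_in z by rewrite -!loc_inM zC.
change (loc_inv * loc_in z = loc_in z * loc_inv).
rewrite -[LHS]mulr1 -loc_mulVr mulrA -(mulrA _ (loc_in z)) zd mulrA.
by rewrite loc_mulV mul1r.
Qed.

End Localization.

Section Commutant.
Variables (K : comPzRingType) (A : pzAlgType K).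

Definition commutant (S : set A) : {pred A} :=
  (fun u => `[< forall x, S x -> x * u = u * x >]).

Variable S : set A.

Lemma commutantP u :
  reflect (forall x, S x -> x * u = u * x) (u \in commutant S).
Proof. exact: asboolP. Qed.

Fact commutant_subring : subring_closed (commutant S).
Proof.
split=> [|u v /commutantP uS /commutantP vS|u v /commutantP uS /commutantP vS];
  apply/commutantP=> x Sx.
- by rewrite mulr1 mul1r.
- by rewrite mulrBr mulrBl uS // vS.
- by rewrite mulrA uS // -mulrA vS // mulrA.
Qed.
HB.instance Definition _ :=
  GRing.isSubringClosed.Build A (commutant S) commutant_subring.

Definition commutant_alg := {u : A | u \in commutant S}.
HB.instance Definition _ := SubChoice.on commutant_alg.
HB.instance Definition _ :=
  GRing.SubChoice_isSubPzRing.Build A (commutant S) commutant_alg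
    (subringClosedP _).

Fact scal_commutant c : scal c \in commutant S.
Proof. by apply/commutantP=> x _; rewrite scalC. Qed.

Definition commutant_scal (c : K) : commutant_alg :=
  exist _ (scal c) (scal_commutant c).

Fact commutant_scal1 : commutant_scal 1 = 1.
Proof. exact/val_inj/scal1. Qed.
Fact commutant_scalD c d :
  commutant_scal (c + d) = commutant_scal c + commutant_scal d.
Proof. exact/val_inj/scalD. Qed.
Fact commutant_scalM c d :
  commutant_scal (c * d) = commutant_scal c * commutant_scal d.
Proof. exact/val_inj/scalM. Qed.
Fact commutant_scalC c (x : commutant_alg) :
  commutant_scal c * x = x * commutant_scal c.
Proof. exact/val_inj/scalC. Qed.
HB.instance Definition _ := PzRing_isPzAlgebra.Build K commutant_alg
  commutant_scal1 commutant_scalD commutant_scalM commutant_scalC.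

End Commutant.

Section CenterRing.
Variables (K : comPzRingType) (A : pzAlgType K).

Definition zcenter := commutant_alg (@setT A).
HB.instance Definition _ := SubChoice.on zcenter.
HB.instance Definition _ := GRing.SubPzRing.on zcenter.

Lemma zcenterP (z : zcenter) : center A (val z).
Proof. by move=> x; have /commutantP := valP z; apply. Qed.

Fact zcenter_mulC : commutative (@GRing.mul zcenter).
Proof. by move=> x y; apply/val_inj; rewrite /= zcenterP. Qed.
HB.instance Definition _ :=
  GRing.PzRing_hasCommutativeMul.Build zcenter zcenter_mulC.

Fact zcenter_in_subproof z : center A z -> z \in commutant (@setT A).
Proof. by move=> zC; apply/commutantP => x _. Qed.

Definition zcenter_in z (zC : center A z) : zcenter :=
  exist _ z (zcenter_in_subproof zC).

End CenterRing.

Definition two_sided (A : pzRingType) (I : {pred A}) : Prop :=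
  forall a u, u \in I -> (a * u \in I) /\ (u * a \in I).

HB.mixin Record isTwoSided (A : pzRingType) (I : A -> bool) := {
  two_sided_subproof : two_sided I
}.
#[short(type="twoSidedIdeal")]
HB.structure Definition TwoSidedIdeal (A : pzRingType) :=
  {I of GRing.ZmodClosed A I & isTwoSided A I}.

Lemma ideal_mull (A : pzRingType) (I : twoSidedIdeal A) a u :
  u \in (I : {pred A}) -> a * u \in (I : {pred A}).
Proof. by move=> /(two_sided_subproof a)[]. Qed.

Lemma ideal_mulr (A : pzRingType) (I : twoSidedIdeal A) a u :
  u \in (I : {pred A}) -> u * a \in (I : {pred A}).
Proof. by move=> /(two_sided_subproof a)[]. Qed.

Section QuotientAlgebra.
Variables (K : comPzRingType) (A : pzAlgType K) (I : twoSidedIdeal A).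

Definition quot_alg := Quotient.quot (I : zmodClosed A).
HB.instance Definition _ := GRing.Zmodule.on quot_alg.

Definition quot_proj (x : A) : quot_alg := \pi_quot_alg x.

Lemma quot_projP x y : quot_proj x = quot_proj y <-> x - y \in I.
Proof.
rewrite Quotient.idealrBE; split=> [/eqP//|/eqP//].
Qed.

Definition quot_mul (x y : quot_alg) : quot_alg :=
  quot_proj (repr x * repr y).

Lemma quot_projK x : quot_proj (repr x) = x. Proof. exact: reprK. Qed.

Lemma quot_projM x y : quot_proj (x * y) = quot_mul (quot_proj x) (quot_proj y).
Proof.
have xI : x - repr (quot_proj x) \in I by apply/quot_projP; rewrite quot_projK.
have yI : y - repr (quot_proj y) \in I by apply/quot_projP; rewrite quot_projK.
apply/quot_projP; move: (repr (quot_proj x)) (repr (quot_proj y)) xI yI => x' y' xI yI.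
rewrite (_ : _ - _ = (x - x') * y + x' * (y - y')).
  by apply: rpredD; [exact: ideal_mulr|exact: ideal_mull].
by rewrite mulrBl mulrBr addrA subrK.
Qed.

Lemma quot_projD x y : quot_proj (x + y) = quot_proj x + quot_proj y.
Proof. by rewrite /quot_proj !piE. Qed.

Fact quot_mulA : associative quot_mul.
Proof.
move=> x y z; rewrite -[x]quot_projK -[y]quot_projK -[z]quot_projK.
by rewrite -!quot_projM mulrA.
Qed.
Fact quot_mul1l : left_id (quot_proj 1) quot_mul.
Proof. by move=> x; rewrite -[x]quot_projK -quot_projM mul1r. Qed.
Fact quot_mul1r : right_id (quot_proj 1) quot_mul.
Proof. by move=> x; rewrite -[x]quot_projK -quot_projM mulr1. Qed.
Fact quot_mulDl : left_distributive quot_mul +%R.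
Proof.
move=> x y z; rewrite -[x]quot_projK -[y]quot_projK -[z]quot_projK.
by rewrite -!quot_projM -!quot_projD -quot_projM mulrDl.
Qed.
Fact quot_mulDr : right_distributive quot_mul +%R.
Proof.
move=> x y z; rewrite -[x]quot_projK -[y]quot_projK -[z]quot_projK.
by rewrite -!quot_projM -!quot_projD -quot_projM mulrDr.
Qed.
HB.instance Definition _ := GRing.Zmodule_isPzRing.Build quot_alg
  quot_mulA quot_mul1l quot_mul1r quot_mulDl quot_mulDr.

Definition quot_scal (c : K) : quot_alg := quot_proj (scal c).

Fact quot_scal1 : quot_scal 1 = 1.
Proof. by rewrite /quot_scal scal1. Qed.
Fact quot_scalD c d : quot_scal (c + d) = quot_scal c + quot_scal d.
Proof. by rewrite /quot_scal scalD quot_projD. Qed.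
Fact quot_scalM c d : quot_scal (c * d) = quot_scal c * quot_scal d.
Proof. by rewrite /quot_scal scalM quot_projM. Qed.
Fact quot_scalC c (x : quot_alg) : quot_scal c * x = x * quot_scal c.
Proof.
by rewrite -[x]quot_projK -[LHS]quot_projM scalC quot_projM.
Qed.
HB.instance Definition _ := PzRing_isPzAlgebra.Build K quot_alg
  quot_scal1 quot_scalD quot_scalM quot_scalC.

End QuotientAlgebra.

Section LeftIdeal.
Variables (A : pzRingType).

Definition left_ideal (I : set A) : Prop :=
  [/\ I 0, forall x y, I x -> I y -> I (x + y) & forall a x, I x -> I (a * x)].

Definition left_ideal_gen (S : set A) : set A := smallest left_ideal S.

Lemma left_ideal_genP S : left_ideal (left_ideal_gen S).
Proof.
split=> [J [[]]//|x y xS yS J [Jl SJ]|a x xS J [Jl SJ]].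
- by case: (Jl) => _ + _; apply; [exact: xS|exact: yS].
- by case: (Jl) => _ _; apply; exact: xS.
Qed.

Lemma sub_left_ideal_gen S x : S x -> left_ideal_gen S x.
Proof. by move=> Sx J [_]; apply. Qed.

End LeftIdeal.

Section JacobiLieAlgebra.
Variables (C : comNzRingType) (N : nat).

Inductive jbasis : Type :=
| bE | bF | bH | be of 'I_N | bf of 'I_N
| bZ of {p : 'I_N * 'I_N | (p.1 <= p.2)%N}.

Let code_type : Type :=
  option (option (option ('I_N + 'I_N + {p : 'I_N * 'I_N | (p.1 <= p.2)%N}))).

Let jcode (b : jbasis) : code_type := match b with
  | bE => None | bF => Some None | bH => Some (Some None)
  | be r => Some (Some (Some (inl (inl r))))
  | bf r => Some (Some (Some (inl (inr r))))
  | bZ p => Some (Some (Some (inr p)))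
  end.

Let jdecode (c : code_type) : jbasis := match c with
  | None => bE | Some None => bF | Some (Some None) => bH
  | Some (Some (Some (inl (inl r)))) => be r
  | Some (Some (Some (inl (inr r)))) => bf r
  | Some (Some (Some (inr p))) => bZ p
  end.

Fact jcodeK : cancel jcode jdecode. Proof. by case. Qed.

HB.instance Definition _ := Finite.copy jbasis (can_type jcodeK).

(* The free module on [jbasis], with basis [jvec]. *)
Definition jacobi := {ffun jbasis -> C^o}.
HB.instance Definition _ := Vector.on jacobi.

Definition jvec (b : jbasis) : jacobi := [ffun b' => (b' == b)%:R].

Fact zpair_subproof (r s : 'I_N) (p := if (r <= s)%N then (r, s) else (s, r)) :
  (p.1 <= p.2)%N.
Proof. by rewrite /p; case: (boolP (r <= s)%N) => //=; rewrite -ltnNge => /ltnW. Qed.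

Definition zpair (r s : 'I_N) : {p : 'I_N * 'I_N | (p.1 <= p.2)%N} :=
  exist _ (if (r <= s)%N then (r, s) else (s, r)) (zpair_subproof r s).

Lemma zpairC r s : zpair r s = zpair s r.
Proof. by apply/val_inj => /=; case: ltngtP => // /val_inj ->. Qed.

Definition jE := jvec bE.
Definition jF := jvec bF.
Definition jH := jvec bH.
Definition je r := jvec (be r).
Definition jf r := jvec (bf r).
Definition jZ r s := jvec (bZ (zpair r s)).

Lemma jZC r s : jZ r s = jZ s r. Proof. by rewrite /jZ zpairC. Qed.

(* Each nonzero bracket of basis vectors is listed in one order only. *)
Definition jtable (x y : jbasis) : jacobi := match x, y with
  | bH, bE => 2 *: jE
  | bH, bF => (- 2) *: jF
  | bE, bF => jH
  | bH, be r => je r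
  | bH, bf r => - jf r
  | bE, bf r => - je r
  | bF, be r => - jf r
  | be r, bf s => (- 2) *: jZ r s
  | _, _ => 0
  end.

Definition jbr (x y : jbasis) : jacobi := jtable x y - jtable y x.

Definition jlie (u v : jacobi) : jacobi :=
  \sum_x \sum_y (u x * v y) *: jbr x y.

Fact jlieDl u v w : jlie (u + v) w = jlie u w + jlie v w.
Proof.
rewrite -big_split; apply: eq_bigr => x _; rewrite -big_split.
by apply: eq_bigr => y _; rewrite ffunE mulrDl scalerDl.
Qed.
Fact jlieZl c u v : jlie (c *: u) v = c *: jlie u v.
Proof.
rewrite scaler_sumr; apply: eq_bigr => x _; rewrite scaler_sumr.
by apply: eq_bigr => y _; rewrite ffunE scalerA mulrA.
Qed.
Fact jlieC u v : jlie u v = - jlie v u.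
Proof.
rewrite /jlie exchange_big -sumrN; apply: eq_bigr => x _; rewrite -sumrN.
by apply: eq_bigr => y _; rewrite mulrC -scalerN opprB.
Qed.
Fact jlieDr u v w : jlie u (v + w) = jlie u v + jlie u w.
Proof. by rewrite jlieC jlieDl opprD -!jlieC. Qed.
Fact jlieZr c u v : jlie u (c *: v) = c *: jlie u v.
Proof. by rewrite jlieC jlieZl -scalerN -jlieC. Qed.
Fact jliexx u : jlie u u = 0.
Proof.
rewrite /jlie; under eq_bigr do under eq_bigr do rewrite scalerBr.
under eq_bigr do rewrite sumrB.
rewrite sumrB [X in _ - X]exchange_big /= -sumrB big1// => x _.
by rewrite -sumrB big1// => y _; rewrite mulrC subrr.
Qed.
Fact jlie_jvec x y : jlie (jvec x) (jvec y) = jbr x y.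
Proof.
rewrite /jlie (bigD1 x)//= (bigD1 y)//= !ffunE !eqxx mul1r scale1r.
rewrite !big1 ?addr0// => [z /negPf zx|z /negPf zy].
  by rewrite big1// => w _; rewrite !ffunE zx mul0r scale0r.
by rewrite !ffunE zy mulr0 scale0r.
Qed.
Fact jvec_sum (u : jacobi) : u = \sum_x u x *: jvec x.
Proof.
apply/ffunP => x; rewrite sum_ffunE (bigD1 x)//= big1 => [|y /negPf yx].
  by rewrite !ffunE eqxx addr0 [RHS]mulr1.
by rewrite !ffunE eq_sym yx scaler0.
Qed.

Let jac x y z := jlie x (jlie y z) + jlie y (jlie z x) + jlie z (jlie x y).

Fact jac_cycle x y z : jac x y z = jac y z x.
Proof. by rewrite /jac -addrA addrC. Qed.

Fact lin_eq0 (f : jacobi -> jacobi) :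
    (forall x y, f (x + y) = f x + f y) ->
    (forall c x, f (c *: x) = c *: f x) ->
  (forall b, f (jvec b) = 0) -> forall x, f x = 0.
Proof.
move=> fD fZ fb x; rewrite [x]jvec_sum.
apply: (big_ind (fun y => f y = 0)) => [|y z y0 z0|b _].
- by have := fZ 0 0; rewrite !scale0r.
- by rewrite fD y0 z0 addr0.
- by rewrite fZ fb scaler0.
Qed.

Let tab (x y : jbasis) : int * jbasis := match x, y with
  | bH, bE => (2, bE) | bE, bH => (-2, bE)
  | bH, bF => (-2, bF) | bF, bH => (2, bF)
  | bE, bF => (1, bH) | bF, bE => (-1, bH)
  | bH, be r => (1, be r) | be r, bH => (-1, be r)
  | bH, bf r => (-1, bf r) | bf r, bH => (1, bf r)
  | bE, bf r => (-1, be r) | bf r, bE => (1, be r)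
  | bF, be r => (-1, bf r) | be r, bF => (1, bf r)
  | be r, bf s => (-2, bZ (zpair r s)) | bf s, be r => (2, bZ (zpair r s))
  | _, _ => (0, bE)
  end.

Let jbr_tab x y : jbr x y = (tab x y).1%:~R *: jvec (tab x y).2.
Proof.
case: x => [|||r|r|p]; case: y => [|||s|s|q];
  by rewrite /jbr /jtable /tab ?(subr0, sub0r, scaleNr, opprK, scale0r, scale1r).
Qed.

Let comb0 b c1 c2 c3 b1 b2 b3 : (c1 = 0 \/ b1 = b) -> (c2 = 0 \/ b2 = b) ->
  (c3 = 0 \/ b3 = b) -> c1 + c2 + c3 = 0 ->
  c1%:~R *: jvec b1 + c2%:~R *: jvec b2 + c3%:~R *: jvec b3 = 0.
Proof.
have e c b' : (c = 0 \/ b' = b) -> c%:~R *: jvec b' = c%:~R *: jvec b.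
  by case=> ->//; rewrite !scale0r.
move=> /e-> /e-> /e-> c0.
by rewrite -!scalerDl -!intrD c0 scale0r.
Qed.

Fact jac_basis a b c : jac (jvec a) (jvec b) (jvec c) = 0.
Proof.
rewrite /jac !jlie_jvec !jbr_tab !jlieZr !jlie_jvec !jbr_tab !scalerA -!intrM.
case: a => [|||r|r|p]; case: b => [|||s|s|q]; case: c => [|||t|t|o].
all: cbv beta iota delta [tab fst snd].
all: match goal with
  |- _ *: jvec ?b1 + _ *: jvec ?b2 + _ *: jvec ?b3 = 0 =>
    let tac b := apply: (@comb0 b); [by left + by right.. | by []] in
    first [tac b1 | tac b2 | rewrite (zpairC r); first [tac b1 | tac b2 | tac b3]
         | rewrite (zpairC s); first [tac b1 | tac b2 | tac b3]]
  end.
Qed.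

Fact jacDl u v x y : jac (u + v) x y = jac u x y + jac v x y.
Proof.
by rewrite /jac !(jlieDl, jlieDr) [RHS]addrACA [X in _ = X + _]addrACA.
Qed.
Fact jacZl c x y z : jac (c *: x) y z = c *: jac x y z.
Proof. by rewrite /jac !(jlieZl, jlieZr) !scalerDr. Qed.

Fact jlieJ x y z : jac x y z = 0.
Proof.
move: x; apply: lin_eq0 => [u v|c u|a]; rewrite ?jacDl ?jacZl//.
rewrite jac_cycle; move: y.
apply: lin_eq0 => [u v|c u|b]; rewrite ?jacDl ?jacZl//.
rewrite jac_cycle; move: z.
apply: lin_eq0 => [u v|d u|c]; rewrite ?jacDl ?jacZl//.
exact: jac_basis.
Qed.

HB.instance Definition _ := Lmodule_isLieAlgebra.Build C jacobi
  jlieDl jlieZl jlieDr jlieZr jliexx jlieJ.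

End JacobiLieAlgebra.

Definition alg_eval (K : comNzRingType) (A : pzAlgType K) (a : A) (p : {poly K}) :
  A := \sum_(i < size p) scal p`_i * a ^+ i.

Section InvariantAlgebra.
Variables (R : realType) (N : nat).

Local Notation C := R[i].
Local Notation g := (jacobi C N).

Definition Ug := uea g.
HB.instance Definition _ := PzAlgebra.on Ug.

Definition iota (x : g) : Ug := uea_in x.

Definition Htilde : g := 'i *: (jF C N - jE C N).
Definition Ztilde (r s : 'I_N) : g := ('i / 2) *: jZ C r s.

Definition kJ : {vspace g} :=
  <<Htilde :: [seq Ztilde p.1 p.2 | p : 'I_N * 'I_N]>>%VS.

Definition kUg : set Ug := iota @` [set x | x \in kJ].

(* U(g)^k; [commutant_alg] is a subtype, so [val u : Ug] for [u : Ugk]. *)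
Definition Ugk := commutant_alg kUg.
HB.instance Definition _ := PzAlgebra.on Ugk.

Fact Ht_kUg : kUg (iota Htilde).
Proof. by exists Htilde => //; apply: memv_span; rewrite mem_head. Qed.

Fact Zt_kUg r s : kUg (iota (Ztilde r s)).
Proof.
exists (Ztilde r s) => //; apply: memv_span; rewrite inE; apply/orP; right.
exact: (map_f (fun p => Ztilde p.1 p.2) (mem_enum predT (r, s))).
Qed.

Section Ideal.
Variables (k : C) (L : 'M[C]_N).

Definition I_kL : set Ug := left_ideal_gen
  ([set iota Htilde - scal k] `|`
   [set iota (Ztilde p.1 p.2) + scal (pi%:C%C * L p.1 p.2) | p in setT]).

Definition I_kL_k : {pred Ugk} := (fun u => `[< I_kL (val u) >]).

Fact I_kL_k_zmod : zmod_closed I_kL_k.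
Proof.
have [I0 ID IM] := left_ideal_genP ([set iota Htilde - scal k] `|`
  [set iota (Ztilde p.1 p.2) + scal (pi%:C%C * L p.1 p.2) | p in setT]).
split=> [|u v /asboolP uI /asboolP vI]; apply/asboolP; first exact: I0.
by rewrite raddfB /= -mulN1r; apply: ID => //; apply: IM.
Qed.
HB.instance Definition _ := GRing.isZmodClosed.Build Ugk I_kL_k I_kL_k_zmod.

Fact I_kL_k_two_sided : two_sided I_kL_k.
Proof.
set S := [set iota Htilde - scal k] `|`
  [set iota (Ztilde p.1 p.2) + scal (pi%:C%C * L p.1 p.2) | p in setT].
have [I0 ID IM] := left_ideal_genP S.
move=> a u /asboolP uI; split; apply/asboolP; first exact: IM.
have : [set w | I_kL (w * val a)] (val u); last by [].
apply: uI; split; first split=> [|x y /= xI yI|b x /= xI].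
- by rewrite /= mul0r.
- by rewrite mulrDl; apply: ID.
- by rewrite -mulrA; apply: IM.
have /commutantP aC := valP a.
move=> x xS /=; rewrite (_ : x * _ = val a * x).
  by apply: IM; apply: sub_left_ideal_gen.
case: xS => [->|[p _ <-]].
  by rewrite mulrBl mulrBr aC ?scalC//; exact: Ht_kUg.
by rewrite mulrDl mulrDr aC ?scalC//; exact: Zt_kUg.
Qed.
HB.instance Definition _ := isTwoSided.Build Ugk I_kL_k I_kL_k_two_sided.

Definition D_kL := quot_alg (I_kL_k : twoSidedIdeal Ugk).
HB.instance Definition _ := PzAlgebra.on D_kL.

Definition D_proj (u : Ugk) : D_kL := quot_proj (I_kL_k : twoSidedIdeal Ugk) u.

End Ideal.

Section Casimir.

Definition Zmx : 'M[Ug]_N := \matrix_(r, s) iota (jZ C r s).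

Definition Uloc := loc (\det Zmx).
HB.instance Definition _ := PzAlgebra.on Uloc.

Definition Uloc_in (u : Ug) : Uloc := loc_in (\det Zmx) u.
Definition detVZ : Uloc := loc_inv (\det Zmx).

Definition Zloc : 'M[Uloc]_N := map_mx Uloc_in Zmx.
(* Z^{-1}, by Cramer's rule; see [mulVZ]. *)
Definition invZ : 'M[Uloc]_N := \matrix_(r, s) (detVZ * (\adj Zloc) r s).

Lemma jZ_lie r s (x : g) : lie (jZ C r s) x = 0.
Proof.
change (jlie (jZ C r s) x = 0); rewrite (jvec_sum x).
apply: (big_ind (fun y => jlie (jZ C r s) y = 0)) => [|y z y0 z0|b _].
- by have := jlieZr 0 (jZ C r s) 0; rewrite !scale0r.
- by rewrite jlieDr y0 z0 addr0.
- by rewrite jlieZr jlie_jvec /jbr; case: b => *; rewrite subrr scaler0.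
Qed.

Lemma Zmx_central r s : center Ug (Zmx r s).
Proof.
rewrite mxE; apply: pres_central => x; apply/esym/eqP; rewrite -subr_eq0.
by rewrite -[X in X - _]/(iota _ * iota x) -uea_in_lie jZ_lie uea_in0.
Qed.

Lemma Zloc_central r s : center Uloc (Zloc r s).
Proof.
rewrite mxE; apply: loc_central; exact: Zmx_central.
Qed.

Lemma mulVZ : invZ *m Zloc = 1%:M.
Proof.
have [Zc ZcE] : exists Zc : 'M[zcenter Uloc]_N, Zloc = map_mx val Zc.
  exists (\matrix_(r, s) zcenter_in (Zloc_central r s)).
  by apply/matrixP => r s; rewrite [RHS]mxE [X in val X]mxE.
have detE : \det Zloc = Uloc_in (\det Zmx).
  exact: (det_map_mx (loc_in (\det Zmx))).
have /matrixP adjZ : \adj Zloc *m Zloc = (\det Zloc)%:M.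
  by rewrite ZcE -map_mx_adj -map_mxM mul_adj_mx map_scalar_mx det_map_mx.
apply/matrixP => r s; have := adjZ r s; rewrite !mxE => rsE.
under eq_bigr do rewrite mxE -mulrA.
by rewrite -mulr_sumr rsE mulrnAr detE loc_mulV.
Qed.

Definition eloc : 'cV[Uloc]_N := \col_r Uloc_in (iota (je C r)).
Definition floc : 'cV[Uloc]_N := \col_r Uloc_in (iota (jf C r)).

Local Notation form x y := ((x^T *m invZ *m y) 0 0).

Definition nuH : Uloc := Uloc_in (iota (jH C N))
  - scal (4^-1) * (form floc eloc + form eloc floc).
Definition nuE : Uloc := Uloc_in (iota (jE C N)) - scal (4^-1) * form eloc eloc.
Definition nuF : Uloc := Uloc_in (iota (jF C N)) + scal (4^-1) * form floc floc.

(* nu applied to H^2 + 2 H + 4 F E. *)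
Definition nu_Casimir_sl2 : Uloc := nuH ^+ 2 + nuH *+ 2 + (nuF * nuE) *+ 4.

(* [w] is the element of U(g) whose image in the localization is
   det(Z) (nu(Omega_sl2) - N (N + 4) / 4). *)
Definition is_Casimir (w : Ug) : Prop :=
  Uloc_in w =
    Uloc_in (\det Zmx) * (nu_Casimir_sl2 - scal ((N * (N + 4))%:R / 4)).

End Casimir.
End InvariantAlgebra.

(* Main.v *)
(* Modulo the central elements Z - lambda, with lambda = 2 pi i L invertible, U(g)
   becomes a tensor product of nu(U(sl2)) with a Weyl algebra on generators p_r
   and d_r. Together with the Cayley transforms X and Y of nu(E) and nu(F) these
   make it a generalized Weyl algebra, graded by integer vectors of length N + 1,
   and Htilde is the Cayley element of nu(sl2) plus the Euler operator of the Weyl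
   algebra. It acts on functions on this lattice with polynomial values in N + 1
   generic weights: modulo U(g)(Htilde - k) every element is a sum of monomials,
   and these act independently on delta_0, so that the annihilator of delta_0 is
   exactly the ideal I_kL. A central element of D_kL commutes with the p_r d_r and
   the d_r^2 X, hence acts on delta_0 by a polynomial in the Casimir variable X_0,
   while Omega acts by an affine function of X_0 and det(Z)^2 nu(Omega_sl2), which
   is central in U(g), by a nonzero multiple of X_0. The Casimir element exists
   because det(Z) clears the 2x2 minors of Z^-1; a projection to weight 0 for
   ad Htilde moves it into the commutant. *)

Require Import Defs.
From HB Require Import structures.
From mathcomp Require Import all_boot all_order all_algebra.
From mathcomp Require Import boolp classical_sets reals trigo complex.
From mathcomp Require Import mpoly.
From mathcomp Require Import ring.

Set Implicit Arguments.
Unset Strict Implicit.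
Unset Printing Implicit Defensive.

Import Order.TTheory GRing.Theory Num.Theory.
Local Open Scope classical_set_scope.
Local Open Scope ring_scope.

(** * Brackets and presented algebras *)

(** The obstacle is that [Htilde] is not central: [I_kL] is only a left ideal, so its quotient is a
    module and not an algebra, and membership in it has to be decided by an action. The central
    relations are therefore divided out first, by a two-sided ideal, and h - k is treated afterwards
    through a vector of weight k. With numerical weights a lowering operator could vanish and
    enlarge the annihilator; with polynomial weights every word takes delta_0 to a nonzero multiple
    of a delta function. The variables are arranged so that h still acts by numbers. The elements
    d_r^2 X are chosen because their weight is -1 - 1 + 2 = 0, as for elements of the commutant,
    while they move the r-th Euler eigenvalue by 2; characteristic 0 then excludes any dependence on
    that eigenvalue. Omega is given only through its image in the localization, so its class is
    studied by its action on delta_0. The central elements of U(g) are instead produced as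
    polynomials in det(Z)^2 nu(Omega_sl2), which can be written with the adjugate of Z and so lies
    in U(g) from the start. *)

Section Bracket.
Variable A : pzRingType.
Implicit Types x y z d : A.

Definition br x y := x * y - y * x.

Lemma brP x y : br x y = 0 <-> x * y = y * x.
Proof.
by split=> [/eqP|xy]; [rewrite subr_eq0 => /eqP|rewrite /br xy subrr].
Qed.

Lemma brC x y : br x y = - br y x. Proof. by rewrite /br opprB. Qed.
Lemma brDr x y z : br x (y + z) = br x y + br x z.
Proof. by rewrite /br mulrDr mulrDl opprD addrACA. Qed.
Lemma brDl x y z : br (x + y) z = br x z + br y z.
Proof. by rewrite brC brDr opprD -!brC. Qed.
Lemma brNr x y : br x (- y) = - br x y.
Proof. by rewrite /br mulrN mulNr opprD. Qed.
Lemma brNl x y : br (- x) y = - br x y.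
Proof. by rewrite brC brNr -brC. Qed.
Lemma brBr x y z : br x (y - z) = br x y - br x z.
Proof. by rewrite brDr brNr. Qed.
Lemma brBl x y z : br (x - y) z = br x z - br y z.
Proof. by rewrite brDl brNl. Qed.
Lemma brxx x : br x x = 0. Proof. exact: subrr. Qed.
Lemma brx0 x : br x 0 = 0. Proof. by rewrite /br mulr0 mul0r subr0. Qed.
Lemma br0x x : br 0 x = 0. Proof. by rewrite brC brx0 oppr0. Qed.
Lemma brMr x y z : br x (y * z) = br x y * z + y * br x z.
Proof. by rewrite /br mulrBl mulrBr !mulrA addrA subrK. Qed.
Lemma brMl x y z : br (x * y) z = br x z * y + x * br y z.
Proof. by rewrite brC brMr opprD -mulNr -mulrN -!brC addrC // addrC. Qed.
Lemma brMnr x y n : br x (y *+ n) = br x y *+ n.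
Proof. by rewrite /br mulrnAr mulrnAl mulrnBl. Qed.
Lemma brMnl x y n : br (x *+ n) y = br x y *+ n.
Proof. by rewrite brC brMnr -mulNrn -brC. Qed.
Lemma br_sumr I (s : seq I) P x (F : I -> A) :
  br x (\sum_(i <- s | P i) F i) = \sum_(i <- s | P i) br x (F i).
Proof. by apply: big_morph; [exact: brDr|exact: brx0]. Qed.
Lemma br_suml I (s : seq I) P x (F : I -> A) :
  br (\sum_(i <- s | P i) F i) x = \sum_(i <- s | P i) br (F i) x.
Proof. by apply: (big_morph (br^~ x)) => [y z|]; rewrite ?brDl ?br0x. Qed.

Lemma br_centerr x d : center A d -> br x d = 0.
Proof. by move=> dC; apply/brP. Qed.
Lemma br_centerl x d : center A d -> br d x = 0.
Proof. by move=> dC; rewrite brC br_centerr ?oppr0. Qed.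
Lemma brZr x y d : center A d -> br x (d * y) = d * br x y.
Proof. by move=> dC; rewrite brMr br_centerr// mul0r add0r. Qed.
Lemma brZl x y d : center A d -> br (d * x) y = d * br x y.
Proof. by move=> dC; rewrite brMl br_centerl// mul0r add0r. Qed.

Lemma center0 : center A 0. Proof. by move=> x; rewrite mulr0 mul0r. Qed.
Lemma centerM x y : center A x -> center A y -> center A (x * y).
Proof. by move=> xC yC z; rewrite mulrA xC -mulrA yC mulrA. Qed.
Lemma centerD x y : center A x -> center A y -> center A (x + y).
Proof. by move=> xC yC z; rewrite mulrDr mulrDl xC yC. Qed.

End Bracket.

Lemma br_morph (A B : pzRingType) (phi : {rmorphism A -> B}) x y :
  phi (br x y) = br (phi x) (phi y).
Proof. by rewrite rmorphB !rmorphM. Qed.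

Lemma center_scal (K : comPzRingType) (A : pzAlgType K) (c : K) :
  center A (scal c).
Proof. by move=> x; rewrite scalC. Qed.

Section Scalars.
Variables (K : comPzRingType) (A : pzAlgType K).
Implicit Types (a b : K) (x y : A).

Lemma scal0 : scal 0 = 0 :> A.
Proof. by apply: (addrI (scal 0)); rewrite -scalD !addr0. Qed.
Lemma scalN a : scal (- a) = - scal a :> A.
Proof. by apply/eqP; rewrite -addr_eq0 -scalD addNr scal0. Qed.
Lemma scalB a b : scal (a - b) = scal a - scal b :> A.
Proof. by rewrite scalD scalN. Qed.
Lemma scalMn a n : scal (a *+ n) = scal a *+ n :> A.
Proof. by elim: n => [|n IHn]; rewrite ?mulr0n ?scal0// !mulrS scalD IHn. Qed.
Lemma scal_nat n : scal n%:R = n%:R :> A.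
Proof. by rewrite scalMn scal1. Qed.
Lemma scal_sum I (s : seq I) P (F : I -> K) :
  scal (\sum_(i <- s | P i) F i) = \sum_(i <- s | P i) scal (F i) :> A.
Proof. by apply: big_morph; [exact: scalD|exact: scal0]. Qed.
Lemma brscalr a x y : br x (scal a * y) = scal a * br x y.
Proof. exact/brZr/center_scal. Qed.
Lemma brscall a x y : br (scal a * x) y = scal a * br x y.
Proof. exact/brZl/center_scal. Qed.
End Scalars.

Section PresentedLift.
Variables (K : comPzRingType) (X : Type) (rel : term K X -> term K X -> Prop).
Variables (A : pzAlgType K) (f : X -> A).

Fixpoint term_eval (t : term K X) : A := match t with
  | Gen x => f x | Cst c => scal c
  | Add s t => term_eval s + term_eval t
  | Mul s t => term_eval s * term_eval t
  end.

Lemma term_eval_pres_eq : (forall s t, rel s t -> term_eval s = term_eval t) ->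
  forall s t, pres_eq rel s t -> term_eval s = term_eval t.
Proof.
move=> frel s t; elim=> //=.
- by move=> y x z _ -> _ ->.
- by move=> x x' y y' _ -> _ ->.
- by move=> x x' y y' _ -> _ ->.
- by move=> x y z; rewrite addrA.
- by move=> x y; rewrite addrC.
- by move=> x; rewrite scal0 add0r.
- by move=> x; rewrite scalN scal1 mulN1r addNr scal0.
- by move=> x y z; rewrite mulrA.
- by move=> x; rewrite scal1 mul1r.
- by move=> x; rewrite scal1 mulr1.
- by move=> x y z; rewrite mulrDl.
- by move=> x y z; rewrite mulrDr.
- by move=> c d; rewrite scalD.
- by move=> c d; rewrite scalM.
- by move=> c x; rewrite scalC.
Qed.

Lemma pres_lift : (forall s t, rel s t -> term_eval s = term_eval t) ->
  exists phi : {rmorphism pres_alg rel -> A},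
    (forall x, phi (pres_gen rel x) = f x) /\ (forall c, phi (scal c) = scal c).
Proof.
move=> /term_eval_pres_eq evP.
pose phi0 (x : pres_alg rel) : A := term_eval (repr x).
have phi0E t : phi0 (pres_class rel t) = term_eval t by apply/evP/pres_repr.
have phi0D x y : phi0 (x + y) = phi0 x + phi0 y.
  by rewrite -[x]pres_classK -[y]pres_classK -[_ + _]pres_classD !phi0E.
have phi0_zmod : zmod_morphism phi0.
  by move=> x y; apply: (addIr (phi0 y)); rewrite subrK -phi0D subrK.
have phi0_mon : monoid_morphism phi0.
  split=> [|x y]; first by rewrite [LHS]phi0E /= scal1.
  by rewrite -[x]pres_classK -[y]pres_classK -[_ * _]pres_classM !phi0E.
pose phi : {rmorphism pres_alg rel -> A} := HB.pack phi0
  (GRing.isZmodMorphism.Build _ _ phi0 phi0_zmod)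
  (GRing.isMonoidMorphism.Build _ _ phi0 phi0_mon).
by exists phi; split=> x; rewrite [LHS]phi0E.
Qed.

Lemma pres_alg_ind (P : pres_alg rel -> Prop) :
  (forall x, P (pres_gen rel x)) -> (forall c, P (scal c)) ->
  (forall x y, P x -> P y -> P (x + y)) ->
  (forall x y, P x -> P y -> P (x * y)) -> forall x, P x.
Proof.
move=> Pg Pc PD PM x; rewrite -[x]pres_classK.
elim: (repr x) => [y|c|s Ps t Pt|s Ps t Pt]; [exact: Pg|exact: Pc| |].
  by rewrite pres_classD; apply: PD.
by rewrite pres_classM; apply: PM.
Qed.

End PresentedLift.

(* The weights y are meant to be a quarter of the adjugate (or of the inverse)
   of the matrix z; the quadratic elements below then implement the action of
   sl2 on the span of the e_r and f_r up to the factor d. *)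
Section Quadratic.
Variables (A : pzRingType) (N : nat) (y : 'I_N -> 'I_N -> A).
Hypothesis yC : forall r s, center A (y r s).
Implicit Types u v : 'I_N -> A.

Definition quad u v := \sum_r \sum_s y r s * u r * v s.

Lemma eq_quad u u' v v' : u =1 u' -> v =1 v' -> quad u v = quad u' v'.
Proof. by move=> uu vv; apply: eq_bigr => r _; apply: eq_bigr => s _; rewrite uu vv. Qed.

Lemma br_quad x u v : br x (quad u v) =
  quad (fun r => br x (u r)) v + quad u (fun s => br x (v s)).
Proof.
rewrite br_sumr -big_split; apply: eq_bigr => r _.
rewrite br_sumr -big_split; apply: eq_bigr => s _ /=.
by rewrite -mulrA brZr// brMr mulrDr !mulrA.
Qed.

Lemma quad0l v : quad (fun=> 0) v = 0.
Proof. by apply: big1 => r _; apply: big1 => s _; rewrite mulr0 mul0r. Qed.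
Lemma quad0r u : quad u (fun=> 0) = 0.
Proof. by apply: big1 => r _; apply: big1 => s _; rewrite mulr0. Qed.
Lemma quadNl u v : quad (fun r => - u r) v = - quad u v.
Proof.
rewrite -sumrN; apply: eq_bigr => r _; rewrite -sumrN.
by apply: eq_bigr => s _; rewrite mulrN mulNr.
Qed.
Lemma quadNr u v : quad u (fun r => - v r) = - quad u v.
Proof.
rewrite -sumrN; apply: eq_bigr => r _; rewrite -sumrN.
by apply: eq_bigr => s _; rewrite mulrN.
Qed.
Lemma quadZl d u v : center A d -> quad (fun r => d * u r) v = d * quad u v.
Proof.
move=> dC; rewrite mulr_sumr; apply: eq_bigr => r _; rewrite mulr_sumr.
by apply: eq_bigr => s _; rewrite !mulrA (dC (y r s)).
Qed.
Lemma quadZr d u v : center A d -> quad u (fun r => d * v r) = d * quad u v.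
Proof.
move=> dC; rewrite mulr_sumr; apply: eq_bigr => r _; rewrite mulr_sumr.
by apply: eq_bigr => s _; rewrite !mulrA (dC (_ * _)) !mulrA.
Qed.

Variables e f : 'I_N -> A.

Definition quadE := quad e e.
Definition quadF := quad (fun r => - f r) f.
Definition quadH := quad f e + quad e f.

Lemma quadFE : quadF = - quad f f. Proof. exact: quadNl. Qed.

Lemma br_quad_commute x : (forall r, br x (e r) = 0) -> (forall r, br x (f r) = 0) ->
  [/\ br x quadE = 0, br x quadF = 0 & br x quadH = 0].
Proof.
move=> xe xf; rewrite quadFE /quadE /quadH brNr brDr !br_quad.
have q0 u u' v : (forall r, br x (u r) = 0) -> quad (fun r => br x (u r)) v = 0.
  by move=> xu; rewrite (eq_quad xu (frefl v)) quad0l.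
have q1 u v : (forall r, br x (u r) = 0) -> quad v (fun r => br x (u r)) = 0.
  by move=> xu; rewrite (eq_quad (frefl v) xu) quad0r.
by split; rewrite !q0 ?q1 ?addr0 ?oppr0.
Qed.

Variable d : A.
Hypothesis dC : center A d.

Definition acts_as_E x :=
  (forall r, br x (e r) = 0) /\ (forall r, br x (f r) = - (d * e r)).
Definition acts_as_F x :=
  (forall r, br x (e r) = - (d * f r)) /\ (forall r, br x (f r) = 0).
Definition acts_as_H x :=
  (forall r, br x (e r) = d * e r) /\ (forall r, br x (f r) = - (d * f r)).

Lemma br_quad_E x : acts_as_E x ->
  [/\ br x quadE = 0, br x quadF = d * quadH & br x quadH = - (d * quadE *+ 2)].
Proof.
case=> xe xf; rewrite quadFE /quadE /quadH brNr brDr !br_quad.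
rewrite !(eq_quad xe (frefl _)) !(eq_quad (frefl _) xe) !(eq_quad xf (frefl _)).
rewrite !(eq_quad (frefl _) xf) !quad0l !quad0r !quadNl !quadNr !quadZl// !quadZr//.
split; first by rewrite addr0.
- by rewrite opprD !opprK -mulrDr addrC.
- by rewrite add0r addr0 mulr2n opprD.
Qed.

Lemma br_quad_F x : acts_as_F x ->
  [/\ br x quadE = - (d * quadH), br x quadF = 0 & br x quadH = d * quadF *+ 2].
Proof.
case=> xe xf; rewrite quadFE /quadE /quadH brNr brDr !br_quad.
rewrite !(eq_quad xe (frefl _)) !(eq_quad (frefl _) xe) !(eq_quad xf (frefl _)).
rewrite !(eq_quad (frefl _) xf) !quad0l !quad0r !quadNl !quadNr !quadZl// !quadZr//.
split; first by rewrite -opprD -mulrDr.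
- by rewrite addr0 oppr0.
- by rewrite add0r addr0 mulr2n mulrN.
Qed.

Lemma br_quad_H x : acts_as_H x ->
  [/\ br x quadE = d * quadE *+ 2, br x quadF = - (d * quadF *+ 2) & br x quadH = 0].
Proof.
case=> xe xf; rewrite quadFE /quadE /quadH brNr brDr !br_quad.
rewrite !(eq_quad xe (frefl _)) !(eq_quad (frefl _) xe) !(eq_quad xf (frefl _)).
rewrite !(eq_quad (frefl _) xf) !quadNl !quadNr !quadZl// !quadZr//.
split; first by rewrite mulr2n.
- by rewrite mulrN mulNrn opprK -opprD opprK mulr2n.
- by rewrite addNr add0r subrr.
Qed.

Variable z : 'I_N -> 'I_N -> A.
Hypothesis zC : forall r s, center A (z r s).
Hypothesis ysym : forall r s, y r s = y s r.
Hypothesis zsym : forall r s, z r s = z s r.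
Hypothesis yz : forall r t, (\sum_s y r s * z s t) *+ 4 = if r == t then d else 0.

Definition heisenberg := [/\ (forall r s, br (e r) (e s) = 0),
  (forall r s, br (f r) (f s) = 0) & (forall r s, br (e r) (f s) = - (z r s *+ 2))].

Lemma quad_zr u t : quad u (fun s => z s t) *+ 4 = d * u t.
Proof.
rewrite /quad (eq_bigr (fun r => u r * (\sum_s y r s * z s t))); last first.
  move=> r _; rewrite mulr_sumr; apply: eq_bigr => s _.
  by rewrite -(yC r s (u r)) mulrA.
rewrite -sumrMnl (bigD1 t)//= [X in _ + X]big1 ?addr0 => [|r /negPf rt].
  by rewrite -mulrnAr yz eqxx dC.
by rewrite -mulrnAr yz rt mulr0.
Qed.

Lemma quad_zl u t : quad (fun s => z s t) u = quad u (fun s => z s t).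
Proof.
rewrite /quad exchange_big; apply: eq_bigr => r _.
by apply: eq_bigr => s _; rewrite (ysym s r) -!mulrA zC.
Qed.

Lemma quadMnl u v n : quad (fun r => u r *+ n) v = quad u v *+ n.
Proof.
rewrite -sumrMnl; apply: eq_bigr => r _; rewrite -sumrMnl.
by apply: eq_bigr => s _; rewrite mulrnAr mulrnAl.
Qed.
Lemma quadMnr u v n : quad u (fun r => v r *+ n) = quad u v *+ n.
Proof.
rewrite -sumrMnl; apply: eq_bigr => r _; rewrite -sumrMnl.
by apply: eq_bigr => s _; rewrite mulrnAr.
Qed.

Hypothesis heis : heisenberg.

(** Each of the two factors contributes a bracket 2 z, and contracting both with y gives 4 y z = d.
    This is where the quarter in the weights y comes from. *)
Lemma quadE_acts : acts_as_E quadE.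
Proof.
have [ee ff ef] := heis; split=> t.
  rewrite brC /quadE br_quad (eq_quad (ee t) (frefl _)) (eq_quad (frefl _) (ee t)).
  by rewrite quad0l quad0r addr0 oppr0.
have fe r : br (f t) (e r) = z r t *+ 2 by rewrite brC ef opprK.
rewrite brC /quadE br_quad (eq_quad fe (frefl _)) (eq_quad (frefl _) fe).
by rewrite quadMnl quadMnr quad_zl -mulrnDr quad_zr.
Qed.

Lemma quadF_acts : acts_as_F quadF.
Proof.
have [ee ff ef] := heis; split=> t.
  have fe r : br (e t) (f r) = - (z r t *+ 2) by rewrite ef zsym.
  rewrite brC quadFE brNr opprK br_quad (eq_quad fe (frefl _)) (eq_quad (frefl _) fe).
  by rewrite quadNl quadNr quadMnl quadMnr quad_zl -opprD -mulrnDr quad_zr.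
rewrite brC quadFE brNr br_quad (eq_quad (ff t) (frefl _)) (eq_quad (frefl _) (ff t)).
by rewrite quad0l quad0r addr0 !oppr0.
Qed.

Lemma quadH_acts : acts_as_H quadH.
Proof.
have [ee ff ef] := heis; split=> t; rewrite brC /quadH brDr !br_quad.
  have fe r : br (e t) (f r) = - (z r t *+ 2) by rewrite ef zsym.
  rewrite !(eq_quad fe (frefl _)) !(eq_quad (frefl _) fe).
  rewrite !(eq_quad (ee t) (frefl _)) !(eq_quad (frefl _) (ee t)) quad0l quad0r.
  rewrite addr0 add0r quadNl quadNr quadMnl quadMnr quad_zl -opprD opprK.
  by rewrite -mulrnDr quad_zr.
have fe r : br (f t) (e r) = z r t *+ 2 by rewrite brC ef opprK.
rewrite !(eq_quad fe (frefl _)) !(eq_quad (frefl _) fe).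
rewrite !(eq_quad (ff t) (frefl _)) !(eq_quad (frefl _) (ff t)) quad0l quad0r.
by rewrite addr0 add0r quadMnl quadMnr quad_zl -mulrnDr quad_zr.
Qed.

End Quadratic.

(** * The Jacobi relations and the Casimir element *)

Section JacobiRelations.
Variables (A : pzRingType) (N : nat).

Definition sl2_relations (E F H : A) :=
  [/\ br H E = E *+ 2, br H F = - (F *+ 2) & br E F = H].

(** The defining relations of g are stated for elements of an arbitrary ring, so that one
    computation serves U(g), its localization, its quotient by the central relations and the
    operators on the lattice. *)
Record jacobi_relations (E F H : A) (e f : 'I_N -> A) (z : 'I_N -> 'I_N -> A) : Prop := {
  jrel_sl2 : sl2_relations E F H;
  jrel_E : acts_as_E e f 1 E;
  jrel_F : acts_as_F e f 1 F;
  jrel_H : acts_as_H e f 1 H;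
  jrel_heis : heisenberg e f z;
  jrel_z : forall r s, center A (z r s);
  jrel_zC : forall r s, z r s = z s r
}.

End JacobiRelations.

(** This is what remains of the bracket of a Casimir element with a root vector: [a] and [w] are a
    product of a root element and a Cartan element in the two orders, and [t] is half their
    commutator. *)
Lemma casimir_cancelE (V : zmodType) (a w t : V) : w - a = t *+ 2 ->
  - (a *+ 2) - w *+ 2 - t *+ 2 *+ 2 + w *+ 4 = 0.
Proof.
move=> <-; rewrite mulrnBl opprB [X in X + _]addrACA addNr add0r -opprD.
by rewrite -mulrnDr addNr.
Qed.

Lemma casimir_cancelF (V : zmodType) (a w t : V) : w - a = - (t *+ 2) ->
  a *+ 2 + w *+ 2 + t *+ 2 *+ 2 - a *+ 4 = 0.
Proof.
move=> /(congr1 -%R); rewrite opprK opprB => <-.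
by rewrite mulrnBl [X in X - _]addrACA subrr addr0 -mulrnDr subrr.
Qed.

Section ClearedNu.
Variables (A : pzRingType) (N : nat) (E F H : A) (e f : 'I_N -> A).
Variables (z y : 'I_N -> 'I_N -> A) (d : A).
Hypothesis rel : jacobi_relations E F H e f z.
Hypothesis yC : forall r s, center A (y r s).
Hypothesis dC : center A d.
Hypothesis ysym : forall r s, y r s = y s r.
Hypothesis yz : forall r t, (\sum_s y r s * z s t) *+ 4 = if r == t then d else 0.

Let qE := quadE y e.
Let qF := quadF y f.
Let qH := quadH y e f.

(* Multiplying nu by the central element d = det Z clears all denominators:
   dE, dF, dH are d nu(E), d nu(F), d nu(H); with d = 1 they are nu itself. *)
Definition dE := d * E - qE.
Definition dF := d * F - qF.
Definition dH := d * H - qH.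

Let c1 : center A 1. Proof. by move=> x; rewrite mulr1 mul1r. Qed.

Let zC := jrel_z rel.
Let qEa : acts_as_E e f d qE := quadE_acts yC dC zC ysym yz (jrel_heis rel).
Let qFa : acts_as_F e f d qF :=
  quadF_acts yC dC zC ysym (jrel_zC rel) yz (jrel_heis rel).
Let qHa : acts_as_H e f d qH :=
  quadH_acts yC dC zC ysym (jrel_zC rel) yz (jrel_heis rel).

(** The elements d E and [quadE] have the same brackets with the e_r and f_r, so their difference
    commutes with them. The same holds for F and H below. *)
Lemma br_dE_ef : (forall r, br dE (e r) = 0) /\ (forall r, br dE (f r) = 0).
Proof.
have [Ee Ef] := jrel_E rel; have [qe qf] := qEa.
split=> r; rewrite /dE brBl brZl// ?Ee ?Ef ?qe ?qf ?mulr0 ?subrr//.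
by rewrite mul1r mulrN subrr.
Qed.

Lemma br_dF_ef : (forall r, br dF (e r) = 0) /\ (forall r, br dF (f r) = 0).
Proof.
have [Ee Ef] := jrel_F rel; have [qe qf] := qFa.
split=> r; rewrite /dF brBl brZl// ?Ee ?Ef ?qe ?qf ?mulr0 ?subrr//.
by rewrite mul1r mulrN subrr.
Qed.

Lemma br_dH_ef : (forall r, br dH (e r) = 0) /\ (forall r, br dH (f r) = 0).
Proof.
have [Ee Ef] := jrel_H rel; have [qe qf] := qHa.
split=> r; rewrite /dH brBl brZl// ?Ee ?Ef ?qe ?qf ?mul1r ?subrr//.
by rewrite mulrN subrr.
Qed.

Lemma br_E_cleared : [/\ br E dE = 0, br E dF = dH & br E dH = - (dE *+ 2)].
Proof.
have [HE HF EF] := jrel_sl2 rel.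
have [Eq1 Eq2 Eq3] := br_quad_E yC c1 (jrel_E rel).
rewrite /dE /dF /dH !brBr !brZr// Eq1 Eq2 Eq3 !mul1r brxx mulr0 subr0 EF.
by split=> //; rewrite brC HE mulrN mulrnAr mulrnBl opprB opprK addrC.
Qed.

Lemma br_F_cleared : [/\ br F dE = - dH, br F dF = 0 & br F dH = dF *+ 2].
Proof.
have [HE HF EF] := jrel_sl2 rel.
have [Eq1 Eq2 Eq3] := br_quad_F yC c1 (jrel_F rel).
rewrite /dE /dF /dH !brBr !brZr// Eq1 Eq2 Eq3 !mul1r brxx mulr0 subr0.
rewrite (brC F E) EF (brC F H) HF !opprK mulrN.
split=> //; first by rewrite opprB addrC.
by rewrite mulrnAr -mulrnBl.
Qed.

Lemma br_H_cleared : [/\ br H dE = dE *+ 2, br H dF = - (dF *+ 2) & br H dH = 0].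
Proof.
have [HE HF EF] := jrel_sl2 rel.
have [Eq1 Eq2 Eq3] := br_quad_H yC c1 (jrel_H rel).
rewrite /dE /dF /dH !brBr !brZr// Eq1 Eq2 Eq3 !mul1r brxx mulr0 subr0 HE HF.
split=> //; first by rewrite mulrnAr mulrnBl.
by rewrite mulrN mulrnAr -opprD -mulrnBl.
Qed.

(** The elements [dE], [dF], [dH] commute with the e_r and f_r, hence with all quadratic parts. So
    one argument of each bracket can be replaced by d times E, F or H. *)
Lemma br_cleared :
  [/\ br dH dE = d * dE *+ 2, br dH dF = - (d * dF *+ 2) & br dE dF = d * dH].
Proof.
have [He Hf] := br_dH_ef; have [Ee Ef] := br_dE_ef.
have [Eq1 Eq2 Eq3] := br_E_cleared.
have [Fq1 Fq2 Fq3] := br_F_cleared.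
have [HqE HqF _] := br_quad_commute yC He Hf.
have [EqE EqF _] := br_quad_commute yC Ee Ef.
rewrite {2}/dE {3}/dF {2}/dF !brBr !brZr// HqE HqF EqF !subr0.
rewrite (brC dH) Eq3 (brC dH) Fq3 (brC dE) Fq1 !opprK mulrN.
by rewrite !mulrnAr.
Qed.

(** This is d^2 nu(Omega_sl2); the linear term needs an additional factor d to be homogeneous with
    the other two. *)
Definition cleared_casimir := dH ^+ 2 + d * dH *+ 2 + (dF * dE) *+ 4.

Let br_casimir x :
  br x cleared_casimir = br x dH * dH + dH * br x dH + d * br x dH *+ 2
    + (br x dF * dE + dF * br x dE) *+ 4.
Proof.
rewrite /cleared_casimir brDr brDr [br x (_ *+ 2)]brMnr [br x (_ *+ 4)]brMnr.
by rewrite expr2 brMr brZr// [br x (dF * _)]brMr.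
Qed.

Lemma br_casimir_E : br E cleared_casimir = 0.
Proof.
have [Eq1 Eq2 Eq3] := br_E_cleared; have [Hq _ _] := br_cleared.
rewrite br_casimir Eq1 Eq2 Eq3 mulr0 addr0 !mulrN mulNr mulNrn.
by rewrite !mulrnAl !mulrnAr; apply: casimir_cancelE.
Qed.

Lemma br_casimir_F : br F cleared_casimir = 0.
Proof.
have [Eq1 Eq2 Eq3] := br_F_cleared; have [_ Hq _] := br_cleared.
rewrite br_casimir Eq1 Eq2 Eq3 mul0r add0r mulrN mulNrn.
by rewrite !mulrnAl !mulrnAr; apply: casimir_cancelF.
Qed.

Lemma br_casimir_H : br H cleared_casimir = 0.
Proof.
have [Eq1 Eq2 Eq3] := br_H_cleared.
rewrite br_casimir Eq1 Eq2 Eq3 !(mulr0, mul0r, mul0rn, add0r) mulNr.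
by rewrite mulrnAr mulrnAl addNr mul0rn.
Qed.

Lemma br_casimir_ef :
  (forall r, br (e r) cleared_casimir = 0) /\ (forall r, br (f r) cleared_casimir = 0).
Proof.
have [[ee ef] [fe ff]] := (br_dE_ef, br_dF_ef); have [he hf] := br_dH_ef.
split=> r; rewrite br_casimir; set x := (X in br X).
  have [-> -> ->] : [/\ br x dE = 0, br x dF = 0 & br x dH = 0].
    by split; rewrite brC ?ee ?fe ?he oppr0.
  by rewrite !(mulr0, mul0r, addr0, mul0rn).
have [-> -> ->] : [/\ br x dE = 0, br x dF = 0 & br x dH = 0].
  by split; rewrite brC ?ef ?ff ?hf oppr0.
by rewrite !(mulr0, mul0r, addr0, mul0rn).
Qed.

End ClearedNu.

Section JacobiEnveloping.
Variables (C : comNzRingType) (N : nat).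
Local Notation g := (jacobi C N).
Local Notation U := (uea g).

Lemma uea_in_br (x y : g) : br (uea_in x) (uea_in y) = uea_in (lie x y).
Proof. by rewrite uea_in_lie. Qed.

Lemma uea_inN (x : g) : uea_in (- x) = - uea_in x.
Proof. by apply/eqP; rewrite -addr_eq0 -uea_inD addNr uea_in0. Qed.

Lemma uea_inMn (x : g) n : uea_in (x *+ n) = uea_in x *+ n.
Proof. by elim: n => [|n IHn]; rewrite ?uea_in0// !mulrS uea_inD IHn. Qed.

Lemma uea_in_sum I (s : seq I) P (F : I -> g) :
  uea_in (\sum_(i <- s | P i) F i) = \sum_(i <- s | P i) uea_in (F i).
Proof. by apply: big_morph; [exact: uea_inD|exact: uea_in0]. Qed.

Lemma uea_in_jvec (x : g) : uea_in x = \sum_b scal (x b) * uea_in (jvec C b).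
Proof.
rewrite {1}(jvec_sum x) uea_in_sum; apply: eq_bigr => b _.
exact: uea_inZ.
Qed.

Lemma uea_in_jbr (b b' : jbasis N) :
  br (uea_in (jvec C b)) (uea_in (jvec C b')) = uea_in (jbr C b b').
Proof. by rewrite uea_in_br; congr uea_in; exact: jlie_jvec. Qed.

Lemma uea_jacobi_relations : jacobi_relations
  (uea_in (jE C N)) (uea_in (jF C N)) (uea_in (jH C N))
  (fun r => uea_in (je C r)) (fun r => uea_in (jf C r))
  (fun r s => uea_in (jZ C r s)).
Proof.
have two (x : g) : uea_in (2 *: x) = uea_in x *+ 2 by rewrite scaler_nat uea_inMn.
split.
- split; rewrite uea_in_jbr /jbr /= ?subr0 ?scaleNr ?uea_inN ?two//.
- by split=> r; rewrite uea_in_jbr /jbr /= ?subr0 ?uea_inN ?uea_in0// mul1r.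
- by split=> r; rewrite uea_in_jbr /jbr /= ?subr0 ?uea_inN ?uea_in0// mul1r.
- by split=> r; rewrite uea_in_jbr /jbr /= ?subr0 ?uea_inN ?uea_in0// mul1r.
- split=> r s; rewrite uea_in_jbr /jbr /= ?subr0 ?scaleNr ?uea_inN ?two ?uea_in0//.
- move=> r s; apply: pres_central => x; rewrite -[pres_gen _ x]/(uea_in x).
  apply/brP; rewrite uea_in_jvec br_suml big1// => b _.
  rewrite brscall uea_in_jbr /jbr; case: b => *; rewrite /= subr0 uea_in0 mulr0//.
- by move=> r s; rewrite jZC.
Qed.

Lemma uea_jacobi_center (x : U) :
  br (uea_in (jE C N)) x = 0 -> br (uea_in (jF C N)) x = 0 ->
  br (uea_in (jH C N)) x = 0 ->
  (forall r, br (uea_in (je C r)) x = 0) -> (forall r, br (uea_in (jf C r)) x = 0) ->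
  center U x.
Proof.
move=> Ex Fx Hx ex fx; apply: pres_central => y; rewrite -[pres_gen _ y]/(uea_in y).
apply/brP; rewrite uea_in_jvec br_suml big1// => b _; rewrite brscall.
case: b => [|||r|r|[[r s] /= rs]]; rewrite ?Ex ?Fx ?Hx ?ex ?fx ?mulr0//.
rewrite (_ : exist _ _ _ = zpair r s); last by apply/val_inj; rewrite /= rs.
by rewrite (br_centerl _ (jrel_z uea_jacobi_relations r s)) mulr0.
Qed.

Lemma uea_jacobi_ind (P : U -> Prop) :
  P (uea_in (jE C N)) -> P (uea_in (jF C N)) -> P (uea_in (jH C N)) ->
  (forall r, P (uea_in (je C r))) -> (forall r, P (uea_in (jf C r))) ->
  (forall r s, P (uea_in (jZ C r s))) ->
  (forall c, P (scal c)) -> (forall x y, P x -> P y -> P (x + y)) ->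
  (forall x y, P x -> P y -> P (x * y)) -> forall x, P x.
Proof.
move=> PE PF PH Pe Pf PZ Pc PD PM; apply: pres_alg_ind => // x.
rewrite -[pres_gen _ x]/(uea_in x) uea_in_jvec.
apply: (big_ind P) => [||b _] //; first by rewrite -(scal0 U).
apply: (PM _ _ (Pc _)); case: b => [|||r|r|[[r s] rs]];
  [exact: PE|exact: PF|exact: PH|exact: Pe|exact: Pf|].
rewrite (_ : exist _ _ _ = zpair r s); last by apply/val_inj; rewrite /= rs.
exact: PZ.
Qed.

Lemma uea_jacobi_lift (A : pzAlgType C) E F H e f z :
  jacobi_relations E F H e f (z : 'I_N -> 'I_N -> A) ->
  exists phi : {rmorphism U -> A}, (forall c, phi (scal c) = scal c) /\
  [/\ phi (uea_in (jE C N)) = E, phi (uea_in (jF C N)) = F,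
      phi (uea_in (jH C N)) = H,
      (forall r, phi (uea_in (je C r)) = e r) &
      (forall r, phi (uea_in (jf C r)) = f r) /\
      (forall r s, phi (uea_in (jZ C r s)) = z r s)].
Proof.
case=> -[HE HF EF] [Ee Ef] [Fe Ff] [He Hf] [ee ff ef] zC zsym.
pose rb (b : jbasis N) : A := match b with
  | bE => E | bF => F | bH => H | be r => e r | bf r => f r
  | bZ p => z (val p).1 (val p).2 end.
pose rho (x : g) : A := \sum_b scal (x b) * rb b.
have rhoD x y : rho (x + y) = rho x + rho y.
  by rewrite -big_split; apply: eq_bigr => b _; rewrite ffunE scalD mulrDl.
have rhoZ c x : rho (c *: x) = scal c * rho x.
  by rewrite mulr_sumr; apply: eq_bigr => b _; rewrite ffunE scalM mulrA.
have rhoN x : rho (- x) = - rho x by rewrite -scaleN1r rhoZ scalN scal1 mulN1r.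
have rho0 : rho 0 = 0 by rewrite -(scale0r 0) rhoZ scal0 mul0r.
have rhob b : rho (jvec C b) = rb b.
  rewrite /rho (bigD1 b)//= big1 => [|b' /negPf b'b].
    by rewrite ffunE eqxx scal1 mul1r addr0.
  by rewrite ffunE b'b scal0 mul0r.
have two x : rho (2 *: x) = rho x *+ 2 by rewrite rhoZ scal_nat mulr_natl.
have rhoZp r s : rb (bZ (zpair r s)) = z r s by rewrite /= /zpair /=; case: ifP.
have rho_table b b' : br (rb b) (rb b') = rho (jbr C b b').
  rewrite /jbr; case: b => [|||r|r|p]; case: b' => [|||s|s|q] /=;
  rewrite ?subr0 ?sub0r ?subrr ?scaleNr ?opprK ?rhoN ?two ?rho0 ?rhob ?rhoZp
    ?oppr0 //= ?brxx // ?(br_centerl _ (zC _ _)) ?(br_centerr _ (zC _ _)) //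
    ?HE ?HF ?EF ?Ee ?Ef ?Fe ?Ff ?He ?Hf ?ee ?ff ?ef ?mul1r //;
  rewrite brC ?HE ?HF ?EF ?Ee ?Ef ?Fe ?Ff ?He ?Hf ?ef ?mul1r ?oppr0 ?opprK //.
have rho_lie x y : rho (lie x y) = br (rho x) (rho y).
  rewrite -[lie x y]/(jlie x y) /jlie.
  rewrite (big_morph rho rhoD rho0) br_suml; apply: eq_bigr => b _.
  rewrite (big_morph rho rhoD rho0) br_sumr; apply: eq_bigr => b' _.
  by rewrite brscall brscalr rhoZ -rho_table scalM mulrA.
have [s t|phi [phiG phiC]] := @pres_lift C g (@uea_rel C g) A rho.
  by case=> [x y|c x|x y] /=; rewrite ?rhoD ?rhoZ ?rho_lie ?subrK.
exists phi; split=> //; split; rewrite ?[LHS]phiG ?rhob//.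
- by move=> r; rewrite [LHS]phiG rhob.
- by split=> [r|r s]; rewrite [LHS]phiG rhob.
Qed.

End JacobiEnveloping.

(** * Quotients by central relations *)

Section CentralQuotient.
Variables (K : comPzRingType) (A : pzAlgType K) (S : set A).
Hypothesis SC : forall x, S x -> center A x.

(** Since S is central, the left ideal generated by it is two-sided and the quotient is again an
    algebra. The existential statement hides its construction behind the universal property. *)
Lemma central_quotient : exists (Q : pzAlgType K) (pr : {rmorphism A -> Q}),
  [/\ forall c, pr (scal c) = scal c, forall q, exists a, pr a = q,
      forall a, pr a = 0 <-> left_ideal_gen S a &
      forall (B : pzAlgType K) (phi : {rmorphism A -> B}),
        (forall x, S x -> phi x = 0) ->
        exists psi : {rmorphism Q -> B}, forall a, psi (pr a) = phi a].
Proof.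
pose I0 (u : A) : bool := `[< left_ideal_gen S u >].
have [g0 gD gM] := left_ideal_genP S.
have I0z : zmod_closed I0.
  split=> [|u v /asboolP uI /asboolP vI]; apply/asboolP; first exact: g0.
  by rewrite -mulN1r; apply: gD => //; apply: gM.
have I02 : two_sided I0.
  move=> a u /asboolP uI; split; apply/asboolP; first exact: gM.
  have : [set w | left_ideal_gen S (w * a)] u; last by [].
  apply: uI; split; first split=> [|x y /= xI yI|b x /= xI].
  - by rewrite /= mul0r.
  - by rewrite mulrDl; apply: gD.
  - by rewrite -mulrA; apply: gM.
  by move=> x Sx /=; rewrite -SC//; apply: gM; apply: sub_left_ideal_gen.
pose I : twoSidedIdeal A := HB.pack I0 (GRing.isZmodClosed.Build A I0 I0z)
  (isTwoSided.Build A I0 I02).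
have pzmod : zmod_morphism (quot_proj I).
  by move=> x y; apply: (addIr (quot_proj I y)); rewrite -quot_projD !subrK.
have pmon : monoid_morphism (quot_proj I) by split=> // x y; exact: quot_projM.
pose pr : {rmorphism A -> quot_alg I} := HB.pack (quot_proj I)
  (GRing.isZmodMorphism.Build _ _ _ pzmod) (GRing.isMonoidMorphism.Build _ _ _ pmon).
have pr0 a : pr a = 0 <-> left_ideal_gen S a.
  rewrite -(raddf0 pr); split=> [/quot_projP|aI].
    by rewrite subr0 => /asboolP.
  by apply/quot_projP; rewrite subr0; apply/asboolP.
exists (quot_alg I), pr; split=> // [q|B phi phiS].
  by exists (repr q); exact: quot_projK.
have phiI a : left_ideal_gen S a -> phi a = 0.
  move=> aI; have : [set w | phi w = 0] a; last by [].
  apply: aI; split; last by move=> x /phiS.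
  split=> [|x y /= x0 y0|b x /= x0]; rewrite /= ?rmorph0 ?rmorphD ?rmorphM ?x0 ?y0 ?addr0//.
  by rewrite mulr0.
pose psi0 (q : quot_alg I) : B := phi (repr q).
have psi0E a : psi0 (pr a) = phi a.
  apply/eqP; rewrite -subr_eq0 -rmorphB; apply/eqP/phiI/pr0.
  by rewrite rmorphB /= [quot_proj I _]quot_projK subrr.
have psi_zmod : zmod_morphism psi0.
  by move=> x y; rewrite -[x]quot_projK -[y]quot_projK -[_ - _](rmorphB pr) !psi0E rmorphB.
have psi_mon : monoid_morphism psi0.
  split=> [|x y]; first by rewrite -(rmorph1 pr) psi0E rmorph1.
  by rewrite -[x]quot_projK -[y]quot_projK -[_ * _](rmorphM pr) !psi0E rmorphM.
pose psi : {rmorphism quot_alg I -> B} := HB.pack psi0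
  (GRing.isZmodMorphism.Build _ _ _ psi_zmod) (GRing.isMonoidMorphism.Build _ _ _ psi_mon).
by exists psi.
Qed.

End CentralQuotient.

Lemma jacobi_relations_morph (A B : pzRingType) (phi : {rmorphism A -> B}) N
  (E F H : A) (e f : 'I_N -> A) z (w : 'I_N -> 'I_N -> B) :
  (forall r s, phi (z r s) = w r s) -> (forall r s, center B (w r s)) ->
  jacobi_relations E F H e f z ->
  jacobi_relations (phi E) (phi F) (phi H) (phi \o e) (phi \o f) w.
Proof.
move=> zw wC [[HE HF EF] [Ee Ef] [Fe Ff] [He Hf] [ee ff ef] zC zsym].
split=> [||||||r s]; first by split; rewrite -br_morph ?HE ?HF ?EF ?rmorphN ?rmorphMn.
- by split=> r; rewrite -br_morph ?Ee ?Ef ?rmorph0 ?mul1r ?rmorphN.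
- by split=> r; rewrite -br_morph ?Fe ?Ff ?rmorph0 ?mul1r ?rmorphN.
- by split=> r; rewrite -br_morph ?He ?Hf ?rmorph0 ?mul1r ?rmorphN.
- by split=> r s; rewrite -br_morph ?ee ?ff ?ef ?rmorph0 ?rmorphN ?rmorphMn ?zw.
- exact: wC.
- by rewrite -!zw zsym.
Qed.

Section JacobiCasimir.
Variables (R : realType) (N : nat).
Local Notation C := R[i].
Local Notation U := (Ug R N).
Local Notation io := (@Defs.iota R N).

(** Lifting Z to a matrix over the center, a commutative ring, makes the theory of determinants and
    adjugates available. *)
Lemma Zmx_center_lift :
  exists Zc : 'M[zcenter U]_N, Zmx R N = map_mx val Zc.
Proof.
exists (\matrix_(r, s) zcenter_in (@Zmx_central R N r s)).
by apply/matrixP => r s; rewrite [RHS]mxE [X in val X]mxE.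
Qed.

Lemma det_Zmx_center : center U (\det (Zmx R N)).
Proof.
have [Zc ->] := Zmx_center_lift; rewrite det_map_mx; exact: zcenterP.
Qed.

Lemma adj_Zmx_center r s : center U ((\adj (Zmx R N)) r s).
Proof.
by have [Zc ->] := Zmx_center_lift; rewrite -map_mx_adj mxE; exact: zcenterP.
Qed.

Lemma adj_Zmx_sym r s : (\adj (Zmx R N)) r s = (\adj (Zmx R N)) s r.
Proof.
have [Zc ZcE] := Zmx_center_lift; rewrite ZcE -map_mx_adj [LHS]mxE [RHS]mxE.
congr val.
have ZcT : Zc^T = Zc.
  apply/matrixP => i j; rewrite mxE; apply/val_inj.
  have /matrixP Zij := ZcE; have := Zij i j; have := Zij j i.
  by rewrite !mxE => <- <-; rewrite jZC.
have /matrixP/(_ r s) := trmx_adj Zc; rewrite ZcT => <-; exact: mxE.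
Qed.

(** A quarter of the adjugate satisfies 4 y Z = det Z inside U(g), so [casimirU] can be formed
    before localizing. *)
Definition adj4 r s : U := scal 4^-1 * (\adj (Zmx R N)) r s.

Lemma adj4_center r s : center U (adj4 r s).
Proof. by apply: centerM; [exact: center_scal|exact: adj_Zmx_center]. Qed.

Lemma adj4_sym r s : adj4 r s = adj4 s r.
Proof. by rewrite /adj4 adj_Zmx_sym. Qed.

Lemma adj4_mul r t : (\sum_s adj4 r s * io (jZ C s t)) *+ 4 =
  if r == t then \det (Zmx R N) else 0.
Proof.
have [Zc ZcE] := Zmx_center_lift.
have /matrixP/(_ r t) : \adj (Zmx R N) *m Zmx R N = (\det (Zmx R N))%:M.
  by rewrite ZcE -map_mx_adj -map_mxM mul_adj_mx map_scalar_mx det_map_mx.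
rewrite [LHS]mxE [RHS]mxE => adjE; rewrite -mulr_natl -scal_nat mulr_sumr.
transitivity (\sum_s (\adj (Zmx R N)) r s * Zmx R N s t); last first.
  by rewrite adjE; case: eqP.
apply: eq_bigr => s _; rewrite /adj4 !mulrA -scalM mulfV ?pnatr_eq0//.
by rewrite scal1 mul1r [Zmx R N s t]mxE.
Qed.

Local Notation E := (io (jE C N)).
Local Notation F := (io (jF C N)).
Local Notation H := (io (jH C N)).
Local Notation e := (fun r => io (je C r) : U).
Local Notation f := (fun r => io (jf C r) : U).

Definition casimirU : U := cleared_casimir E F H e f adj4 (\det (Zmx R N)).

Lemma Ug_relations : jacobi_relations E F H e f (fun r s => io (jZ C r s)).
Proof. exact: uea_jacobi_relations. Qed.

Lemma Ug_center (x : U) : br E x = 0 -> br F x = 0 -> br H x = 0 ->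
  (forall r, br (e r) x = 0) -> (forall r, br (f r) x = 0) -> center U x.
Proof. exact: uea_jacobi_center. Qed.

Lemma casimirU_center : center U casimirU.
Proof.
have [[[[rel yC] dC] ys] yz] :=
  (Ug_relations, adj4_center, det_Zmx_center, adj4_sym, adj4_mul).
have [ce cf] := br_casimir_ef rel yC dC ys yz.
exact: (Ug_center (br_casimir_E rel yC dC ys yz) (br_casimir_F rel yC dC ys yz)
                  (br_casimir_H rel yC dC) ce cf).
Qed.

End JacobiCasimir.

Section OneFactor.
Variables (A : pzRingType) (I : eqType).

(** In an ordered product of noncommuting factors, x and the new coefficient c can be carried past
    all factors but the i-th, so only that one changes. *)
Lemma mul_prod_one (s : seq I) (i : I) (x c : A) (F F' : I -> A) :
  uniq s -> i \in s -> x * F i = c * F' i -> {in predC1 i, F =1 F'} ->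
  {in predC1 i, forall j, br x (F j) = 0} ->
  {in predC1 i, forall j, br c (F j) = 0} ->
  x * \prod_(j <- s) F j = c * \prod_(j <- s) F' j.
Proof.
move=> + + xi FF' xF cF; elim: s => [//|j s IHs] /= /andP[js us].
rewrite inE !big_cons; have [ij|ij] := eqVneq i j.
  move=> _; rewrite -ij !mulrA xi; congr (_ * _); apply: eq_big_seq => k ks.
  by apply: FF'; rewrite inE; apply: contraNneq js => ki; rewrite -ij -ki.
move=> /= /(IHs us) IH; have jp : j \in predC1 i by rewrite inE eq_sym.
have /brP xj := xF _ jp; have /brP cj := cF _ jp.
by rewrite mulrA xj -mulrA IH mulrA -cj FF'// mulrA.
Qed.

End OneFactor.

(** * Generalized Weyl algebras and their normal forms *)

Section GeneralizedWeylAlgebra.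
Variables (C : comNzRingType) (A : pzAlgType C) (n : nat).
Variables (R L t : 'I_n -> A) (h : A) (k : C) (wt eps : 'I_n -> C).

(** The subalgebra generated by h and the t_i. The products R_i L_i and L_i R_i are only required to
    lie in it, because for the sl2 pair they involve the Cayley element, which is h minus the Euler
    operators and a constant. *)
Inductive cartan : A -> Prop :=
| cartan_scal c : cartan (scal c)
| cartan_h : cartan h
| cartan_t i : cartan (t i)
| cartan_add x y : cartan x -> cartan y -> cartan (x + y)
| cartan_mul x y : cartan x -> cartan y -> cartan (x * y).

Record weyl_relations : Prop := {
  weyl_RR : forall i j, br (R i) (R j) = 0;
  weyl_LL : forall i j, br (L i) (L j) = 0;
  weyl_RL : forall i j, i != j -> br (R i) (L j) = 0;
  weyl_tt : forall i j, br (t i) (t j) = 0;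
  weyl_ht : forall i, br h (t i) = 0;
  weyl_hR : forall i, br h (R i) = scal (wt i) * R i;
  weyl_hL : forall i, br h (L i) = - (scal (wt i) * L i);
  weyl_tR : forall i j, br (t i) (R j) = if i == j then scal (eps i) * R i else 0;
  weyl_tL : forall i j, br (t i) (L j) = if i == j then - (scal (eps i) * L i) else 0;
  weyl_cRL : forall i, cartan (R i * L i);
  weyl_cLR : forall i, cartan (L i * R i)
}.

Definition zpow i (m : int) : A :=
  match m with Posz p => R i ^+ p | Negz p => L i ^+ p.+1 end.
Definition word (v : {ffun 'I_n -> int}) : A := \prod_i zpow i (v i).
Definition weight (v : {ffun 'I_n -> int}) : C := \sum_i wt i *~ v i.
Definition tmon (m : 'X_{1..n}) : A := \prod_i t i ^+ m i.

(* Normal forms modulo the left ideal generated by h - k. *)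
Inductive normal : A -> Prop :=
| normal_word v : normal (word v)
| normal_ideal a : normal (a * (h - scal k))
| normal_add x y : normal x -> normal y -> normal (x + y)
| normal_scal c x : normal x -> normal (scal c * x)
| normal_t i x : normal x -> normal (t i * x).

Hypothesis rel : weyl_relations.

Let brX x y p : br x y = 0 -> br x (y ^+ p) = 0 :> A.
Proof.
move=> xy; elim: p => [|p IHp]; first by rewrite expr0 br_centerr// => z; rewrite mulr1 mul1r.
by rewrite exprS brMr xy IHp mul0r mulr0 addr0.
Qed.

Let br_zpow x i m : br x (R i) = 0 -> br x (L i) = 0 -> br x (zpow i m) = 0.
Proof. by move=> xR xL; case: m => p /=; apply: brX. Qed.

Let brX_eigen (x y : A) (c : C) p : br x y = scal c * y ->
  br x (y ^+ p) = scal (c *+ p) * y ^+ p.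
Proof.
move=> xy; elim: p => [|p IHp].
  by rewrite expr0 mulr0n scal0 mul0r br_centerr// => z; rewrite mulr1 mul1r.
by rewrite exprS brMr xy IHp mulrS scalD [RHS]mulrDl !mulrA (scalC (c *+ p) y).
Qed.

Lemma br_h_word v : br h (word v) = scal (weight v) * word v.
Proof.
rewrite /word /weight; elim: (index_enum _) => [|i s IHs].
  by rewrite !big_nil scal0 mul0r br_centerr// => z; rewrite mulr1 mul1r.
rewrite !big_cons brMr IHs scalD [RHS]mulrDl; congr (_ + _).
  2: by rewrite [RHS]mulrA (scalC _ (zpow _ _)) -mulrA.
rewrite mulrA; congr (_ * _); case: (v i) => p /=.
  by rewrite (brX_eigen p (weyl_hR rel i)) pmulrn.
have hL : br h (L i) = scal (- wt i) * L i by rewrite (weyl_hL rel) scalN mulNr.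
by rewrite (brX_eigen p.+1 hL) NegzE mulrNz -mulNrz pmulrn.
Qed.

Lemma normal_opp x : normal x -> normal (- x).
Proof. by move=> /(normal_scal (-1)); rewrite scalN scal1 mulN1r. Qed.

(** Moving h to the right of a word costs the weight of the word, and on the far right h equals k
    modulo the ideal. *)
Lemma normal_h x : normal x -> normal (h * x).
Proof.
elim=> [v|a|y z _ hy _ hz|c y _ hy|i y _ hy].
- have -> : h * word v = word v * (h - scal k) + scal (k + weight v) * word v.
    rewrite scalD mulrDl -br_h_word /br mulrBr scalC addrA subrK.
    by rewrite addrC subrK.
  by apply: normal_add; [exact: normal_ideal|apply: normal_scal; exact: normal_word].
- by rewrite mulrA; exact: normal_ideal.
- by rewrite mulrDr; exact: normal_add.
- by rewrite mulrA -scalC -mulrA; exact: normal_scal.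
- by have /brP ht := weyl_ht rel i; rewrite mulrA ht -mulrA; exact: normal_t.
Qed.

Lemma normal_cartan c x : cartan c -> normal x -> normal (c * x).
Proof.
move=> cc; elim: cc x => [d||i|y z _ Hy _ Hz|y z _ Hy _ Hz] x Nx.
- exact: normal_scal.
- exact: normal_h.
- exact: normal_t.
- by rewrite mulrDl; apply: normal_add; [exact: Hy|exact: Hz].
- by rewrite -mulrA; apply/Hy/Hz.
Qed.

Let step (v : {ffun 'I_n -> int}) (i : 'I_n) (d : int) : {ffun 'I_n -> int} :=
  [ffun j => if j == i then v j + d else v j].

Let word_step (v : {ffun 'I_n -> int}) i (d : int) x c : x * zpow i (v i) = c * zpow i (v i + d) ->
  (forall j, j != i -> br x (R j) = 0 /\ br x (L j) = 0) ->
  (forall j, j != i -> br c (R j) = 0 /\ br c (L j) = 0) ->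
  x * word v = c * word (step v i d).
Proof.
move=> xi xC cC; apply: (mul_prod_one (index_enum_uniq _) (mem_index_enum i)).
- by rewrite ffunE eqxx.
- by move=> j /negPf ji; rewrite ffunE ji.
- by move=> j /xC[xR xL]; exact: br_zpow.
- by move=> j /cC[xR xL]; exact: br_zpow.
Qed.

(** R_i commutes with the other letters and reaches the i-th power. It lengthens a power of R_i;
    against a power of L_i it cancels one letter and leaves the Cartan element R_i L_i, covered by
    [normal_cartan]. *)
Lemma normal_R i x : normal x -> normal (R i * x).
Proof.
have RC j : j != i -> br (R i) (R j) = 0 /\ br (R i) (L j) = 0.
  by move=> ji; rewrite (weyl_RR rel) (weyl_RL rel) 1?eq_sym.
have LC j : j != i -> br (L i) (R j) = 0 /\ br (L i) (L j) = 0.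
  by move=> ji; rewrite (weyl_LL rel) brC (weyl_RL rel) ?oppr0.
elim=> [v|a|y z _ hy _ hz|c y _ hy|j y _ hy].
- case vi: (v i) => [p|p].
    rewrite (@word_step v i 1 (R i) 1); first by rewrite mul1r; exact: normal_word.
    + by rewrite vi mul1r /= -exprS -addn1.
    + exact: RC.
    + by move=> j _; split; rewrite br_centerl// => z; rewrite mulr1 mul1r.
  rewrite (@word_step v i 1 (R i) (R i * L i)).
  + by apply: normal_cartan (normal_word _); exact: weyl_cRL.
  + rewrite vi -mulrA [zpow i (Negz p)]exprS mulrA.
    rewrite (_ : zpow i (Negz p + 1) = L i ^+ p); first by rewrite mulrA.
    case: p {vi} => [|p]; first by rewrite NegzE addNr expr0.
    by rewrite !NegzE (intS p.+1) opprD addrAC addNr add0r -NegzE.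
  + exact: RC.
  + move=> j ji; have [? ?] := RC j ji; have [? ?] := LC j ji.
    by split; rewrite brMl (_ : br (R i) _ = 0)// (_ : br (L i) _ = 0)// mul0r mulr0 addr0.
- by rewrite mulrA; exact: normal_ideal.
- by rewrite mulrDr; exact: normal_add.
- by rewrite mulrA -scalC -mulrA; exact: normal_scal.
- have := weyl_tR rel j i => tR.
  have -> : R i * (t j * y) = t j * (R i * y) - br (t j) (R i) * y.
    by rewrite /br mulrBl !mulrA opprB addrC subrK.
  apply: normal_add; first exact: normal_t.
  apply: normal_opp; rewrite tR; case: eqP => [->|_].
    by rewrite -mulrA; exact: normal_scal.
  by rewrite mul0r -(mul0r (h - scal k)); exact: normal_ideal.
Qed.

Lemma normal_L i x : normal x -> normal (L i * x).
Proof.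
have RC j : j != i -> br (R i) (R j) = 0 /\ br (R i) (L j) = 0.
  by move=> ji; rewrite (weyl_RR rel) (weyl_RL rel) 1?eq_sym.
have LC j : j != i -> br (L i) (R j) = 0 /\ br (L i) (L j) = 0.
  by move=> ji; rewrite (weyl_LL rel) brC (weyl_RL rel) ?oppr0.
elim=> [v|a|y z _ hy _ hz|c y _ hy|j y _ hy].
- have c1 j : br (1 : A) (R j) = 0 /\ br (1 : A) (L j) = 0.
    by split; rewrite br_centerl// => z; rewrite mulr1 mul1r.
  case vi: (v i) => [[|p]|p].
  + rewrite (@word_step v i (-1) (L i) 1); first by rewrite mul1r; exact: normal_word.
    * by rewrite vi mul1r /= expr0 mulr1 expr1.
    * exact: LC.
    * by move=> j _; exact: c1.
  + rewrite (@word_step v i (-1) (L i) (L i * R i)).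
    * by apply: normal_cartan (normal_word _); exact: weyl_cLR.
    * rewrite vi (_ : zpow i (p.+1%:Z + -1) = R i ^+ p); first by rewrite /= exprS mulrA.
      by rewrite intS addrAC subrr add0r.
    * exact: LC.
    * move=> j ji; have [? ?] := RC j ji; have [? ?] := LC j ji.
      by split; rewrite brMl (_ : br (R i) _ = 0)// (_ : br (L i) _ = 0)// mul0r mulr0 addr0.
  + rewrite (@word_step v i (-1) (L i) 1); first by rewrite mul1r; exact: normal_word.
    * by rewrite vi mul1r /= -exprS addn0.
    * exact: LC.
    * by move=> j _; exact: c1.
- by rewrite mulrA; exact: normal_ideal.
- by rewrite mulrDr; exact: normal_add.
- by rewrite mulrA -scalC -mulrA; exact: normal_scal.
- have := weyl_tL rel j i => tR.
  have -> : L i * (t j * y) = t j * (L i * y) - br (t j) (L i) * y.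
    by rewrite /br mulrBl !mulrA opprB addrC subrK.
  apply: normal_add; first exact: normal_t.
  apply: normal_opp; rewrite tR; case: eqP => [->|_].
    by rewrite mulNr -mulrA; apply: normal_opp; exact: normal_scal.
  by rewrite mul0r -(mul0r (h - scal k)); exact: normal_ideal.
Qed.

Lemma normal1 : normal 1.
Proof.
have -> : 1 = word 0 by rewrite /word big1// => i _; rewrite ffunE.
exact: normal_word.
Qed.

Lemma tmonS i m : t i * tmon m = tmon (U_(i) + m)%MM.
Proof.
rewrite -[RHS]mul1r; apply: (mul_prod_one (index_enum_uniq _) (mem_index_enum i)).
- by rewrite mul1r -exprS mnmDE mnm1E eqxx add1n.
- by move=> j ji; rewrite mnmDE mnm1E eq_sym (negPf ji).
- by move=> j _; apply: brX; exact: weyl_tt.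
- by move=> j _; rewrite br_centerl// => z; rewrite mulr1 mul1r.
Qed.

Definition term_sum (s : seq (C * ('X_{1..n} * {ffun 'I_n -> int}))) : A :=
  \sum_(y <- s) scal y.1 * (tmon y.2.1 * word y.2.2).

Lemma normal_sum x : normal x -> exists a s, x = a * (h - scal k) + term_sum s.
Proof.
elim=> [v|a|y z _ [a [s ->]] _ [b [u ->]]|c y _ [a [s ->]]|i y _ [a [s ->]]].
- exists 0, [:: (1, (0%MM, v))]; rewrite mul0r add0r /term_sum big_seq1 /= scal1 mul1r.
  by rewrite /tmon big1 ?mul1r// => i _; rewrite mnmE.
- by exists a, [::]; rewrite /term_sum big_nil addr0.
- by exists (a + b), (s ++ u); rewrite /term_sum big_cat mulrDl addrACA.
- exists (scal c * a), [seq (c * y.1, y.2) | y <- s].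
  rewrite mulrDr mulrA /term_sum big_map mulr_sumr; congr (_ + _).
  by apply: eq_bigr => z _; rewrite scalM mulrA.
- exists (t i * a), [seq (y.1, ((U_(i) + y.2.1)%MM, y.2.2)) | y <- s].
  rewrite mulrDr mulrA /term_sum big_map mulr_sumr; congr (_ + _).
  by apply: eq_bigr => z _; rewrite -tmonS /= !mulrA scalC.
Qed.

End GeneralizedWeylAlgebra.

(** * The Cayley transform *)

Section LinearForms.
Variables (C : comNzRingType) (A : pzAlgType C).
Implicit Types (a b c u v w : C).

(** Elements are handled through their coefficients in C, so that identities in the noncommutative
    algebra reduce to identities in a field. *)
Definition lin3 (x y z : A) a b c := scal a * x + scal b * y + scal c * z.
Definition lin2 (x y : A) a b := scal a * x + scal b * y.

Lemma lin3D x y z a b c a' b' c' :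
  lin3 x y z a b c + lin3 x y z a' b' c' = lin3 x y z (a + a') (b + b') (c + c').
Proof. by rewrite /lin3 !scalD !mulrDl addrACA [in LHS](addrACA (scal a * x)). Qed.
Lemma lin3Z x y z a b c u :
  scal u * lin3 x y z a b c = lin3 x y z (u * a) (u * b) (u * c).
Proof. by rewrite /lin3 !scalM !mulrDr !mulrA. Qed.
Lemma lin3_1 x y z : x = lin3 x y z 1 0 0.
Proof. by rewrite /lin3 scal0 scal1 !mul0r mul1r !addr0. Qed.
Lemma lin3_2 x y z : y = lin3 x y z 0 1 0.
Proof. by rewrite /lin3 scal0 scal1 !mul0r mul1r addr0 add0r. Qed.
Lemma lin3_3 x y z : z = lin3 x y z 0 0 1.
Proof. by rewrite /lin3 scal0 scal1 !mul0r mul1r !add0r. Qed.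

Lemma lin3_0 x y z : lin3 x y z 0 0 0 = 0.
Proof. by rewrite /lin3 scal0 !mul0r !addr0. Qed.

Lemma lin2D x y a b a' b' : lin2 x y a b + lin2 x y a' b' = lin2 x y (a + a') (b + b').
Proof. by rewrite /lin2 !scalD !mulrDl addrACA. Qed.
Lemma lin2Z x y a b u : scal u * lin2 x y a b = lin2 x y (u * a) (u * b).
Proof. by rewrite /lin2 !scalM !mulrDr !mulrA. Qed.
Lemma lin2_1 x y : x = lin2 x y 1 0.
Proof. by rewrite /lin2 scal0 scal1 !mul0r mul1r !addr0. Qed.
Lemma lin2_2 x y : y = lin2 x y 0 1.
Proof. by rewrite /lin2 scal0 scal1 !mul0r mul1r add0r. Qed.

(** The triple x, y, z spans an image of the adjoint representation of E, F, H. It is kept separate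
    from E, F, H because nu(E), nu(F), nu(H) form such a triple too. *)
Record adjoint_action (E F H x y z : A) : Prop := {
  adj_Ex : br E x = 0; adj_Ey : br E y = z; adj_Ez : br E z = - (x *+ 2);
  adj_Fx : br F x = - z; adj_Fy : br F y = 0; adj_Fz : br F z = y *+ 2;
  adj_Hx : br H x = x *+ 2; adj_Hy : br H y = - (y *+ 2); adj_Hz : br H z = 0
}.

Lemma sl2_adjoint E F H : sl2_relations E F H -> adjoint_action E F H E F H.
Proof.
by case=> HE HF EF; split; rewrite ?brxx ?HE ?HF ?EF // brC ?HE ?HF ?EF ?opprK.
Qed.

Lemma br_lin3 E F H x y z u v w a b c : adjoint_action E F H x y z ->
  br (lin3 E F H u v w) (lin3 x y z a b c) =
  lin3 x y z (2 * (w * a - u * c)) (2 * (v * c - w * b)) (u * b - v * a).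
Proof.
case=> Ex Ey Ez Fx Fy Fz Hx Hy Hz.
have brl (t : A) : br t (lin3 x y z a b c) =
    scal a * br t x + scal b * br t y + scal c * br t z.
  by rewrite /lin3 !brDr !brscalr.
have EE : br E (lin3 x y z a b c) = lin3 x y z (- 2 * c) 0 b.
  rewrite brl Ex Ey Ez mulr0 add0r addrC /lin3 scal0 mul0r addr0; congr (_ + _).
  by rewrite scalM scalN scal_nat mulrN mulrnAr mulNr -mulr_natl mulNr !mulrA.
have FF : br F (lin3 x y z a b c) = lin3 x y z 0 (2 * c) (- a).
  rewrite brl Fx Fy Fz mulr0 addr0 addrC /lin3 scal0 mul0r add0r; congr (_ + _).
    by rewrite scalM scal_nat -mulrA mulr_natl mulrnAr.
  by rewrite scalN mulrN mulNr.
have HH : br H (lin3 x y z a b c) = lin3 x y z (2 * a) (- 2 * b) 0.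
  rewrite brl Hx Hy Hz mulr0 addr0 /lin3 scal0 mul0r addr0; congr (_ + _).
    by rewrite scalM scal_nat -mulrA mulr_natl mulrnAr.
  by rewrite scalM scalN scal_nat mulrN mulrnAr !mulNr -mulrA mulr_natl.
rewrite {1}/lin3 !brDl !brscall EE FF HH !lin3Z !lin3D.
congr lin3; ring.
Qed.

Lemma br_lin3_2 E F H x y u v w a b :
  br E x = 0 -> br E y = - x -> br F x = - y -> br F y = 0 ->
  br H x = x -> br H y = - y ->
  br (lin3 E F H u v w) (lin2 x y a b) = lin2 x y (w * a - u * b) (- v * a - w * b).
Proof.
move=> Ex Ey Fx Fy Hx Hy.
have brl (t : A) : br t (lin2 x y a b) = scal a * br t x + scal b * br t y.
  by rewrite /lin2 brDr !brscalr.
have EE : br E (lin2 x y a b) = lin2 x y (- b) 0.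
  by rewrite brl Ex Ey /lin2 scal0 mul0r addr0 mulr0 add0r mulrN scalN mulNr.
have FF : br F (lin2 x y a b) = lin2 x y 0 (- a).
  by rewrite brl Fx Fy /lin2 scal0 mul0r add0r mulr0 addr0 mulrN scalN mulNr.
have HH : br H (lin2 x y a b) = lin2 x y a (- b).
  by rewrite brl Hx Hy /lin2 mulrN scalN mulNr.
rewrite /lin3 !brDl !brscall EE FF HH !lin2Z !lin2D.
congr lin2; ring.
Qed.

End LinearForms.

Section Cayley.
Variables (C : numClosedFieldType) (A : pzAlgType C).

Let i2 : 'i * 'i = -1 :> C. Proof. by rewrite -expr2 sqrCi. Qed.

Definition rotation (E F : A) := scal 'i * (F - E).
(** [cayleyX] and [cayleyY] are the raising and lowering elements for the compact Cartan element
    [rotation E F], with eigenvalues 2 and -2. *)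
Definition cayleyX (E F H : A) := lin3 E F H 2^-1 2^-1 (- 'i / 2).
Definition cayleyY (E F H : A) := lin3 E F H 2^-1 2^-1 ('i / 2).

Lemma rotation_lin3 E F H : rotation E F = lin3 E F H (- 'i) 'i 0.
Proof. by rewrite /lin3 scal0 mul0r addr0 /rotation mulrBr addrC scalN mulNr. Qed.

Let two0 : 2 != 0 :> C. Proof. by rewrite pnatr_eq0. Qed.

Lemma br_rotation E F H x y z : adjoint_action E F H x y z ->
  [/\ br (rotation E F) (cayleyX x y z) = scal 2 * cayleyX x y z,
      br (rotation E F) (cayleyY x y z) = - (scal 2 * cayleyY x y z) &
      br (rotation E F) (rotation x y) = 0].
Proof.
move=> act; rewrite (rotation_lin3 E F H) (rotation_lin3 x y z).
rewrite -[X in _ = - X]mul1r -mulNr -scal1 -scalN.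
rewrite !(br_lin3 _ _ _ _ _ _ act) !lin3Z.
split; last by rewrite -(lin3_0 x y z); congr lin3; ring.
- by congr lin3; field: i2.
- by congr lin3; field: i2.
Qed.

Lemma sl2_cayley E F H : sl2_relations E F H ->
  sl2_relations (cayleyX E F H) (cayleyY E F H) (rotation E F).
Proof.
move=> /sl2_adjoint act; have [hX hY _] := br_rotation act.
split; rewrite ?hX ?hY ?scal_nat ?mulr_natl//.
rewrite (br_lin3 _ _ _ _ _ _ act) (rotation_lin3 E F H).
by congr lin3; field: i2.
Qed.

Definition casimir (E F H : A) := H ^+ 2 + H *+ 2 + (F * E) *+ 4.

(** With S = E + F and D = F - E one has 4 Y X = S^2 + H^2 + 'i [H, S], the square of [rotation E F]
    is -D^2, and its double cancels 'i [H, S]. What is left is H^2 + S^2 - D^2 = H^2 + 2 (E F + F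
    E). *)
Lemma casimir_cayley E F H : sl2_relations E F H ->
  casimir (cayleyX E F H) (cayleyY E F H) (rotation E F) = casimir E F H.
Proof.
move=> rel; have [HE HF EF] := rel.
pose S := E + F; pose D := F - E; pose I : A := scal 'i.
have IC x : I * x = x * I by exact: scalC.
have II : I * I = -1 by rewrite -scalM i2 scalN scal1.
have XE : cayleyX E F H = scal 2^-1 * (S - I * H).
  have -> : S - I * H = lin3 E F H 1 1 (- 'i) by rewrite /lin3 scal1 !mul1r scalN mulNr.
  by rewrite lin3Z; congr lin3; ring.
have YE : cayleyY E F H = scal 2^-1 * (S + I * H).
  have -> : S + I * H = lin3 E F H 1 1 'i by rewrite /lin3 scal1 !mul1r.
  by rewrite lin3Z; congr lin3; ring.
have YX : (cayleyY E F H * cayleyX E F H) *+ 4 = S ^+ 2 + H ^+ 2 + I * br H S.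
  have half (a b : A) : (scal (2^-1 : C) * a) * (scal (2^-1 : C) * b) *+ 4 = a * b.
    rewrite -mulr_natl -scal_nat (mulrA (scal _ * a)).
    rewrite -(scalC 2^-1 (scal _ * a)) !mulrA -!scalM.
    by rewrite (_ : _ / 2 = 1) ?scal1 ?mul1r//; field.
  rewrite YE XE half.
  rewrite mulrDl /br !mulrBr -expr2 (mulrA S) -(IC S) !mulrA.
  have -> : I * H * I * H = - H ^+ 2.
    by rewrite -(mulrA I) -(IC H) mulrA II mulN1r mulNr expr2.
  by rewrite opprK -!addrA; congr (_ + _); rewrite addrC -!addrA addrCA.
have hh : rotation E F ^+ 2 = - D ^+ 2.
  by rewrite expr2 /rotation -/I -/D mulrA -(mulrA I) -(IC D) mulrA II -mulrA mulN1r expr2.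
have SH : I * br H S = I * (E - F) *+ 2.
  by rewrite /S brDr HE HF -mulrnAr mulrnBl.
have SD : S ^+ 2 - D ^+ 2 = (E * F + F * E) *+ 2.
  have -> : S ^+ 2 = E * E + E * F + (F * E + F * F) by rewrite expr2 mulrDl !mulrDr.
  have -> : D ^+ 2 = F * F - F * E - (E * F - E * E) by rewrite expr2 mulrBl !mulrBr.
  rewrite (opprB (F * F - F * E)) (opprB (F * F)) addrACA.
  have -> : E * E + E * F + (E * F - E * E) = E * F + E * F by rewrite addrC addrA subrK.
  have -> : F * E + F * F + (F * E - F * F) = F * E + F * E.
    by rewrite addrACA subrr addr0.
  by rewrite mulr2n addrACA.
rewrite /casimir YX hh SH.
have -> : rotation E F = - (I * (E - F)) by rewrite -mulrN opprB.
rewrite mulNrn addrACA addNr addr0 addrA [- _ + _]addrC SD addrC -addrA.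
have -> : E * F = H + F * E by rewrite -EF subrK.
by rewrite -addrA -mulr2n mulrnDl -mulrnA.
Qed.

End Cayley.

Lemma eq_matrix_sum (C : comUnitRingType) N (M : 'M[C]_N) (i j : 'I_N) :
  M \in unitmx -> \sum_s invmx M i s * M s j = (i == j)%:R.
Proof. by move=> Mu; have /matrixP/(_ i j) := mulVmx Mu; rewrite !mxE. Qed.

(** * The Heisenberg part as a Weyl algebra *)

Section HeisenbergToWeyl.
Variables (C : numClosedFieldType) (A : pzAlgType C) (N : nat) (M : 'M[C]_N).
Hypothesis M_sym : M^T = M.
Hypothesis M_unit : M \in unitmx.

Let i2 : 'i * 'i = -1 :> C. Proof. by rewrite -expr2 sqrCi. Qed.
Let Msym r s : M r s = M s r. Proof. by rewrite -{1}M_sym mxE. Qed.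

Definition inv4 r s : A := scal (4^-1 * invmx M r s).
Definition scal_mx r s : A := scal (M r s).

Lemma inv4_center r s : center A (inv4 r s). Proof. exact: center_scal. Qed.

Lemma inv4_sym r s : inv4 r s = inv4 s r.
Proof.
rewrite /inv4; congr (scal (_ * _)).
have /matrixP/(_ s r) : (invmx M)^T = invmx M by rewrite trmx_inv M_sym.
by rewrite mxE.
Qed.

Lemma inv4_mul r t : (\sum_s inv4 r s * scal_mx s t) *+ 4 = if r == t then 1 else 0.
Proof.
rewrite /inv4 /scal_mx; under eq_bigr do rewrite -scalM -mulrA.
rewrite -scal_sum -mulr_sumr eq_matrix_sum// -scalMn -mulrnAl.
rewrite -[_ *+ 4]mulr_natl mulfV ?pnatr_eq0// mul1r.
by case: eqP; rewrite ?scal1 ?scal0.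
Qed.

Variables (E F H : A) (e f : 'I_N -> A).
Hypothesis rel : jacobi_relations E F H e f scal_mx.

Definition raise r := lin2 (e r) (f r) 1 (- 'i).
Definition lower r := lin2 (e r) (f r) 1 'i.
(** The factor -'i / 4 and the inverse of M undo the bracket 4 'i M of [lower] with [raise], so that
    [partial] and [raise] satisfy the canonical commutation relations. *)
Definition partial r := \sum_s scal (- 'i / 4 * invmx M r s) * lower s.

Let br_ef r s a b c d :
  br (lin2 (e r) (f r) a b) (lin2 (e s) (f s) c d) = scal (- 2 * M r s * (a * d - b * c)).
Proof.
have [ee ff ef] := jrel_heis rel.
rewrite /lin2 !brDl !brscall !brDr !brscalr ee ff ef (brC (f r)) ef opprK.
rewrite !mulr0 add0r addr0 /scal_mx -!scalMn -scalN -!scalM -scalD (Msym s).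
by congr scal; ring.
Qed.

Lemma br_raise r s : br (raise r) (raise s) = 0.
Proof. by rewrite br_ef -[RHS](scal0 A); congr scal; ring. Qed.
Lemma br_lower r s : br (lower r) (lower s) = 0.
Proof. by rewrite br_ef -[RHS](scal0 A); congr scal; ring. Qed.
Lemma br_lower_raise r s : br (lower r) (raise s) = scal (4 * 'i * M r s).
Proof. by rewrite br_ef; congr scal; ring. Qed.

Lemma br_partial r s : br (partial r) (partial s) = 0.
Proof.
rewrite /partial br_suml big1// => a _; rewrite br_sumr big1// => b _.
by rewrite brscall brscalr br_lower !mulr0.
Qed.

Lemma br_partial_raise r s : br (partial r) (raise s) = (r == s)%:R.
Proof.
rewrite /partial br_suml; under eq_bigr do rewrite brscall br_lower_raise -scalM.
rewrite -scal_sum -[RHS](scal_nat A) -(eq_matrix_sum r s M_unit).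
by congr scal; apply: eq_bigr => a _; field: i2.
Qed.

Lemma br_sl2_lin2 r u v w a b : br (lin3 E F H u v w) (lin2 (e r) (f r) a b) =
  lin2 (e r) (f r) (w * a - u * b) (- v * a - w * b).
Proof.
have [[Ee Ef] [Fe Ff] [He Hf]] := And3 (jrel_E rel) (jrel_F rel) (jrel_H rel).
by apply: br_lin3_2; rewrite ?Ee ?Ef ?Fe ?Ff ?He ?Hf ?mul1r.
Qed.

Lemma br_rotation_raise r : br (rotation E F) (raise r) = raise r.
Proof. by rewrite (rotation_lin3 E F H) br_sl2_lin2; congr lin2; ring: i2. Qed.

Lemma br_rotation_lower r : br (rotation E F) (lower r) = - lower r.
Proof.
have -> : - lower r = scal (-1) * lower r by rewrite scalN scal1 mulN1r.
rewrite (rotation_lin3 E F H) br_sl2_lin2 lin2Z.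
by congr lin2; ring: i2.
Qed.

Lemma br_rotation_partial r : br (rotation E F) (partial r) = - partial r.
Proof.
rewrite /partial br_sumr -sumrN; apply: eq_bigr => s _.
by rewrite brscalr br_rotation_lower mulrN.
Qed.

Let nE := dE E e inv4 1.
Let nF := dF F f inv4 1.
Let nH := dH H e f inv4 1.

(** Reordering e and f contributes -2 z contracted with y, that is -1/2 for each of the N
    indices. *)
Let quad_skew : quad inv4 e f - quad inv4 f e = scal (- (N%:R / 2)).
Proof.
have [_ _ ef] := jrel_heis rel.
rewrite /quad [X in _ - X]exchange_big -sumrB.
transitivity (\sum_(r < N) scal (- 2^-1) : A); last first.
  by rewrite -scal_sum sumr_const card_ord -[_ *+ N]mulr_natr; congr scal; field.
apply: eq_bigr => r _; rewrite -sumrB.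
transitivity (- 2%:R * \sum_s inv4 r s * scal_mx s r).
  rewrite mulr_sumr; apply: eq_bigr => s _.
  rewrite (inv4_sym s r) -!mulrA -mulrBr -[_ - _]/(br (e r) (f s)) ef /scal_mx Msym.
  by rewrite mulrN mulNr mulrnAr mulr_natl.
have := inv4_mul r r; rewrite eqxx => /(congr1 (fun x => scal (- 2^-1) * x)).
rewrite mulr1 => <-; rewrite -[_ *+ 4]mulr_natl -(scal_nat A 4) mulrA -scalM.
by rewrite -(scal_nat A 2) -scalN; congr (scal _ * _); field.
Qed.

(** Up to the factor -'i, the quadratic part of the rotation is a sum of squares in e and f.
    Factoring it into [raise] and [lower] gives the Euler operator, and N/2 is the constant produced
    by the reordering, as for N harmonic oscillators. *)
Lemma rotation_euler : rotation E F =
  rotation nE nF + \sum_r raise r * partial r + scal (N%:R / 2).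
Proof.
pose I : A := scal 'i; have II : I * I = -1 by rewrite -scalM i2 scalN scal1.
have IC x : I * x = x * I by exact: scalC.
have ICA x y : x * (I * y) = I * (x * y) by rewrite !mulrA IC.
have quad_rl : quad inv4 raise lower =
    quad inv4 e e + quad inv4 f f + I * (quad inv4 e f - quad inv4 f e).
  rewrite mulrBr /quad !mulr_sumr -!sumrB -!big_split; apply: eq_bigr => r _ /=.
  rewrite !mulr_sumr -!sumrB -!big_split; apply: eq_bigr => s _ /=.
  rewrite -!mulrA -!ICA -mulrBr -!mulrDr; congr (_ * _).
  rewrite /raise /lower /lin2 scal1 !mul1r scalN -/I mulNr.
  have -> : (e r - I * f r) * (e s + I * f s) =
      e r * e s + I * (e r * f s) - (I * (f r * e s) + - (f r * f s)).
    have IfIf : I * f r * (I * f s) = - (f r * f s).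
      by rewrite ICA !mulrA II mulN1r mulNr.
    by rewrite mulrBl !mulrDr IfIf ICA -mulrA.
  by rewrite opprB addrACA (ICA (e r)) (ICA (f r)).
have pp : \sum_r raise r * partial r = - (I * quad inv4 raise lower).
  rewrite /quad mulr_sumr -sumrN; apply: eq_bigr => r _.
  rewrite /partial mulr_sumr mulr_sumr -sumrN; apply: eq_bigr => s _.
  rewrite !mulrA -(scalC _ (raise r)) -!mulNr /inv4 /I -scalN -scalM.
  by congr (scal _ * _ * _); ring.
have half : I * (I * scal (- (N%:R / 2))) = scal (N%:R / 2).
  by rewrite mulrA II mulN1r scalN opprK.
rewrite pp quad_rl quad_skew [I * (_ + _)]mulrDr half opprD addrA subrK.
rewrite /rotation -/I /nE /nF /dE /dF !mul1r quadFE /quadE.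
rewrite -mulrN -mulrDr; congr (_ * _).
by rewrite opprK opprB [quad inv4 e e - E]addrC addrACA [_ + quad inv4 e e]addrC addrK.
Qed.

End HeisenbergToWeyl.

Lemma br_casimir_sl2 (C : numClosedFieldType) (A : pzAlgType C) (x y z : A) : sl2_relations x y z ->
  [/\ br (casimir x y z) x = 0, br (casimir x y z) y = 0 & br (casimir x y z) z = 0].
Proof.
case=> zx zy xy.
have e1 t : br (casimir x y z) t =
    br z t * z + z * br z t + br z t *+ 2 + (br y t * x + y * br x t) *+ 4.
  rewrite /casimir brDl brDl [br (_ *+ 2) t]brMnl [br (_ *+ 4) t]brMnl.
  by rewrite expr2 brMl brMl.
have yx : br y x = - z by rewrite brC xy.
have xz : br x z = - (x *+ 2) by rewrite brC zx.
have yz' : br y z = y *+ 2 by rewrite brC zy opprK.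
split.
- rewrite e1 brxx zx yx mulr0 addr0.
  rewrite mulNr mulNrn mulrnAl mulrnAr [x * z *+ 2 + _]addrC.
  by apply: casimir_cancelF; rewrite -opprB -[_ - _]/(br z x) zx.
- rewrite e1 brxx zy xy mul0r add0r.
  rewrite mulNr mulrN mulNrn mulrnAl mulrnAr [- (y * z *+ 2) - _]addrC.
  by apply: casimir_cancelE; rewrite -opprB -[_ - _]/(br z y) zy opprK.
- by rewrite e1 brxx yz' xz mulr0 mul0r addr0 mul0rn add0r mulrN mulrnAl mulrnAr subrr mul0rn addr0.
Qed.

(** * From the Jacobi relations to a generalized Weyl algebra *)

Section JacobiToWeyl.
Variables (C : numClosedFieldType) (A : pzAlgType C) (N : nat) (M : 'M[C]_N).
Hypothesis M_sym : M^T = M.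
Hypothesis M_unit : M \in unitmx.
Variables (E F H : A) (e f : 'I_N -> A).
Hypothesis rel : jacobi_relations E F H e f (scal_mx A M).

Let y := inv4 A M.
Let yC : forall r s, center A (y r s) := @inv4_center _ A _ M.
Let c1 : center A 1. Proof. by move=> x; rewrite mulr1 mul1r. Qed.
Let ys : forall r s, y r s = y s r := inv4_sym A M_sym.
Let yz := inv4_mul A M_unit.

Definition nuEa := dE E e y 1.
Definition nuFa := dF F f y 1.
Definition nuHa := dH H e f y 1.

Lemma nua_sl2 : sl2_relations nuEa nuFa nuHa.
Proof.
by have [] := br_cleared rel yC c1 ys yz; rewrite !mul1r.
Qed.

Lemma nua_commute x : x = nuEa \/ x = nuFa \/ x = nuHa ->
  (forall r, br x (e r) = 0) /\ (forall r, br x (f r) = 0).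
Proof.
case=> [->|[->|->]].
- exact: br_dE_ef rel yC c1 ys yz.
- exact: br_dF_ef rel yC c1 ys yz.
- exact: br_dH_ef rel yC c1 ys yz.
Qed.

Let commute_lin3 (x1 x2 x3 z : A) a b c : br x1 z = 0 -> br x2 z = 0 -> br x3 z = 0 ->
  br (lin3 x1 x2 x3 a b c) z = 0.
Proof. by move=> b1 b2 b3; rewrite /lin3 !brDl !brscall b1 b2 b3 !mulr0 !addr0. Qed.

Lemma nua_lin3_commute a b c :
  (forall r, br (lin3 nuEa nuFa nuHa a b c) (raise e f r) = 0) /\
  (forall r, br (lin3 nuEa nuFa nuHa a b c) (partial M e f r) = 0).
Proof.
have [Ee Ef] := nua_commute (or_introl erefl).
have [Fe Ff] := nua_commute (or_intror (or_introl erefl)).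
have [He Hf] := nua_commute (or_intror (or_intror erefl)).
have le r u v : br (lin3 nuEa nuFa nuHa a b c) (lin2 (e r) (f r) u v) = 0.
  by rewrite /lin2 brDr !brscalr !commute_lin3 ?mulr0 ?addr0.
split=> r; first exact: le.
by rewrite /partial br_sumr big1// => s _; rewrite brscalr le mulr0.
Qed.

(** Index 0 is reserved for the sl2 part, and the index [lift ord0 r] stands for the r-th Weyl
    pair. *)
Definition pick_index T (x0 : T) (x : 'I_N -> T) (i : 'I_N.+1) : T :=
  if unlift ord0 i is Some r then x r else x0.

Lemma pick_index0 T (x0 : T) x : pick_index x0 x ord0 = x0.
Proof. by rewrite /pick_index unlift_none. Qed.
Lemma pick_indexS T (x0 : T) x r : pick_index x0 x (lift ord0 r) = x r.
Proof. by rewrite /pick_index liftK. Qed.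

Definition wX := cayleyX nuEa nuFa nuHa.
Definition wY := cayleyY nuEa nuFa nuHa.
Definition wh := rotation nuEa nuFa.
Definition wR := pick_index wX (raise e f).
Definition wL := pick_index wY (partial M e f).
Definition wt := pick_index (casimir nuEa nuFa nuHa) (fun r => raise e f r * partial M e f r).

Let whE : wh = lin3 nuEa nuFa nuHa (- 'i) 'i 0. Proof. exact: rotation_lin3. Qed.

Lemma wXY : sl2_relations wX wY wh. Proof. exact: sl2_cayley nua_sl2. Qed.

Let h := rotation E F.
Let p := raise e f.
Let d := partial M e f.

Let br0C (x z : A) : br x z = 0 -> br z x = 0.
Proof. by rewrite brC => /eqP; rewrite oppr_eq0 => /eqP. Qed.

Let XYh_pd r : [/\ br wX (p r) = 0, br wX (d r) = 0, br wY (p r) = 0,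
  br wY (d r) = 0 & br wh (p r) = 0 /\ br wh (d r) = 0].
Proof.
by rewrite whE /wX /wY; split; try split;
  rewrite ?(proj1 (nua_lin3_commute _ _ _)) ?(proj2 (nua_lin3_commute _ _ _)).
Qed.

Let cas := casimir nuEa nuFa nuHa.

Let casE : cas = casimir wX wY wh. Proof. exact/esym/casimir_cayley/nua_sl2. Qed.

Let br_cas : [/\ br cas wX = 0, br cas wY = 0 & br cas wh = 0].
Proof. by rewrite casE; exact: br_casimir_sl2 wXY. Qed.

Let br_cas_pd r : br cas (p r) = 0 /\ br cas (d r) = 0.
Proof.
have [Xp Xd Yp Yd [hp hd]] := XYh_pd r; rewrite casE /casimir.
by split; rewrite brDl brDl [br (_ *+ 2) _]brMnl [br (_ *+ 4) _]brMnl expr2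
  (brMl wh wh) (brMl wY wX)
  ?Xp ?Xd ?Yp ?Yd ?hp ?hd !(mulr0, mul0r, mul0rn, addr0).
Qed.

Let br_dp r s : br (d r) (p s) = (r == s)%:R. Proof. exact: (br_partial_raise M_sym M_unit rel). Qed.
Let br_pd r s : br (p r) (d s) = - (r == s)%:R.
Proof. by rewrite brC br_dp eq_sym. Qed.
Let br_pp r s : br (p r) (p s) = 0. Proof. exact: (br_raise M_sym rel). Qed.
Let br_dd r s : br (d r) (d s) = 0. Proof. exact: (br_partial M_sym rel). Qed.

Let br_tp r s : br (p r * d r) (p s) = if r == s then p r else 0.
Proof. by rewrite brMl br_pp mul0r add0r br_dp; case: eqP; rewrite ?mulr1 ?mulr0. Qed.
Let br_td r s : br (p r * d r) (d s) = if r == s then - d r else 0.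
Proof.
by rewrite brMl br_dd mulr0 addr0 br_pd; case: eqP; rewrite ?mulNr ?mul1r ?mul0r ?oppr0.
Qed.
Let br_tt r s : br (p r * d r) (p s * d s) = 0.
Proof.
rewrite brMr br_tp br_td; case: eqP => [->|_]; last by rewrite mul0r mulr0 addr0.
by rewrite mulrN subrr.
Qed.

Let euler : h = wh + \sum_r p r * d r + scal (N%:R / 2).
Proof. exact: (rotation_euler M_sym M_unit rel). Qed.

Let br_sum_XY x : (forall r, br (p r) x = 0) -> (forall r, br (d r) x = 0) ->
  br h x = br wh x.
Proof.
move=> px dx; rewrite euler !brDl br_suml big1 ?addr0 => [|r _].
  by rewrite (br_centerl _ (@center_scal _ A _)) addr0.
by rewrite brMl px dx mulr0 mul0r addr0.
Qed.

Definition weyl_wt := pick_index (2 : C) (fun=> 1).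
(** The entry 0 belongs to the Casimir element of nu(sl2), which commutes with all letters; the
    entries 1 belong to the Euler operators. *)
Definition weyl_eps := pick_index (0 : C) (fun=> 1).

Lemma jacobi_weyl : weyl_relations wR wL wt h weyl_wt weyl_eps.
Proof.
have [hX hY XY] := wXY; have [casX casY cash] := br_cas.
have h_p r : br h (p r) = p r := br_rotation_raise rel r.
have h_d r : br h (d r) = - d r := br_rotation_partial rel r.
have h_t r : br h (p r * d r) = 0 by rewrite brMr h_p h_d mulrN subrr.
have lift0 r : (lift ord0 r == ord0 :> 'I_N.+1) = false by [].
have lift0' r : (ord0 == lift ord0 r :> 'I_N.+1) = false by [].
have liftE (r s : 'I_N) : (lift ord0 r == lift ord0 s :> 'I_N.+1) = (r == s).
  exact/inj_eq/lift_inj.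
have pickE := (pick_index0, pick_indexS, lift0, lift0', liftE, eqxx).
have cartan_sum (F' : 'I_N -> A) : (forall r, cartan wt h (F' r)) ->
    cartan wt h (\sum_r F' r).
  move=> cF; apply: (big_ind (cartan wt h)) => [||r _] //.
    by rewrite -(scal0 A); exact: cartan_scal.
  exact: cartan_add.
have cartan_pd r : cartan wt h (p r * d r).
  by have := @cartan_t _ _ _ wt h (lift ord0 r); rewrite /wt pickE.
have cartan_cas : cartan wt h cas.
  by have := @cartan_t _ _ _ wt h ord0; rewrite /wt pickE.
have cartan_opp x : cartan wt h x -> cartan wt h (- x).
  move=> cx; have -> : - x = scal (-1) * x by rewrite scalN scal1 mulN1r.
  by apply: cartan_mul => //; exact: cartan_scal.
(* The Euler decomposition of h expresses [wh] through h and the t_r. *)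
have cartan_wh : cartan wt h wh.
  have -> : wh = h - scal (N%:R / 2) - \sum_r p r * d r by rewrite euler !addrK.
  apply: cartan_add; last exact/cartan_opp/cartan_sum.
  by apply: cartan_add; [exact: cartan_h|exact/cartan_opp/cartan_scal].
have YXE : wY * wX = wX * wY - wh by rewrite -XY /br opprB addrC subrK.
(* The Casimir element [wh]^2 + 2 [wh] + 4 Y X is solved for X Y = Y X + [wh], which turns the sign
   of the linear term. *)
have XYE : wX * wY = scal 4^-1 * (cas - wh ^+ 2 + scal 2 * wh).
  have -> : cas - wh ^+ 2 + scal 2 * wh = (wX * wY) *+ 4.
    rewrite casE /casimir YXE scal_nat mulr_natl mulrnBl.
    rewrite -(addrA (wh ^+ 2)) (addrC (wh ^+ 2)) addrK addrAC -mulrnDr.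
    by rewrite addrC subrK.
  by rewrite -[(_ * _) *+ 4]mulr_natl -(scal_nat A 4) (mulrA (scal _) (scal _)) -scalM mulVf ?pnatr_eq0// scal1 mul1r.
have cartan_XY : cartan wt h (wX * wY).
  rewrite XYE; apply: cartan_mul; first exact: cartan_scal.
  apply: cartan_add; last by apply: cartan_mul => //; exact: cartan_scal.
  by apply: cartan_add => //; apply: cartan_opp; apply: cartan_mul.
split.
- move=> i j; rewrite /wR; case: (unliftP ord0 i) => [r ->|->];
  case: (unliftP ord0 j) => [s ->|->]; rewrite !pickE ?brxx //.
  + by apply: br0C; have [] := XYh_pd r.
  + by have [] := XYh_pd s.
- move=> i j; rewrite /wL; case: (unliftP ord0 i) => [r ->|->];
  case: (unliftP ord0 j) => [s ->|->]; rewrite !pickE ?brxx //.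
  + by apply: br0C; have [] := XYh_pd r.
  + by have [] := XYh_pd s.
- move=> i j; rewrite /wR /wL; case: (unliftP ord0 i) => [r ->|->];
  case: (unliftP ord0 j) => [s ->|->]; rewrite !pickE //.
  + by move=> /negPf rs; rewrite -/p -/d br_pd rs oppr0.
  + by move=> _; apply: br0C; have [] := XYh_pd r.
  + by move=> _; have [] := XYh_pd s.
- move=> i j; rewrite /wt; case: (unliftP ord0 i) => [r ->|->];
  case: (unliftP ord0 j) => [s ->|->]; rewrite !pickE ?brxx //.
  + by apply: br0C; have [cp cd] := br_cas_pd r; rewrite brMr cp cd mul0r mulr0 addr0.
  + by have [cp cd] := br_cas_pd s; rewrite brMr cp cd mul0r mulr0 addr0.
- move=> i; rewrite /wt; case: (unliftP ord0 i) => [r ->|->]; rewrite !pickE //.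
  rewrite br_sum_XY; first exact: br0C.
    by move=> r; apply: br0C; case: (br_cas_pd r).
  by move=> r; apply: br0C; case: (br_cas_pd r).
- move=> i; rewrite /wR /weyl_wt; case: (unliftP ord0 i) => [r ->|->]; rewrite !pickE.
    by rewrite scal1 mul1r.
  rewrite br_sum_XY ?hX ?scal_nat ?mulr_natl// => r; apply: br0C; have [] // := XYh_pd r.
- move=> i; rewrite /wL /weyl_wt; case: (unliftP ord0 i) => [r ->|->]; rewrite !pickE.
    by rewrite scal1 mul1r.
  rewrite br_sum_XY ?hY ?scal_nat ?mulr_natl// => r; apply: br0C; have [] // := XYh_pd r.
- move=> i j; rewrite /wR /wt /weyl_eps; case: (unliftP ord0 i) => [r ->|->];
  case: (unliftP ord0 j) => [s ->|->]; rewrite !pickE ?scal0 ?scal1 ?mul0r ?mul1r //.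
  + have [Xp Xd _ _ _] := XYh_pd r.
    by rewrite brMl (br0C Xp) (br0C Xd) mulr0 mul0r addr0.
  + by have [] := br_cas_pd s.
- move=> i j; rewrite /wL /wt /weyl_eps; case: (unliftP ord0 i) => [r ->|->];
  case: (unliftP ord0 j) => [s ->|->]; rewrite !pickE ?scal0 ?scal1 ?mul0r ?mul1r ?oppr0 //.
  + have [_ _ Yp Yd _] := XYh_pd r.
    by rewrite brMl (br0C Yp) (br0C Yd) mulr0 mul0r addr0.
  + by have [] := br_cas_pd s.
- move=> i; rewrite /wR /wL; case: (unliftP ord0 i) => [r ->|->]; rewrite !pickE //.
- move=> i; rewrite /wR /wL; case: (unliftP ord0 i) => [r ->|->]; rewrite !pickE.
    have -> : d r * p r = p r * d r + scal 1.
      have dp : br (d r) (p r) = 1 by rewrite br_dp eqxx.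
      by rewrite scal1 -dp addrC subrK.
    by apply: cartan_add => //; exact: cartan_scal.
  by rewrite YXE; apply: cartan_add => //; exact: cartan_opp.
Qed.

End JacobiToWeyl.

(** * The inverse construction: Jacobi relations from Weyl pairs and an sl2-triple *)

Section WeylToJacobi.
Variables (C : numClosedFieldType) (A : pzAlgType C) (N : nat) (M : 'M[C]_N).
Hypothesis M_sym : M^T = M.
Hypothesis M_unit : M \in unitmx.
Variables (p d : 'I_N -> A) (X Y hh : A).
Hypothesis sl2 : sl2_relations X Y hh.
Hypothesis br_pp : forall r s, br (p r) (p s) = 0.
Hypothesis br_dd : forall r s, br (d r) (d s) = 0.
Hypothesis br_dp : forall r s, br (d r) (p s) = (r == s)%:R.
Hypothesis br_Xpd : forall r, br X (p r) = 0 /\ br X (d r) = 0.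
Hypothesis br_Ypd : forall r, br Y (p r) = 0 /\ br Y (d r) = 0.
Hypothesis br_hpd : forall r, br hh (p r) = 0 /\ br hh (d r) = 0.

Let i2 : 'i * 'i = -1 :> C. Proof. by rewrite -expr2 sqrCi. Qed.
Let Msym r s : M r s = M s r. Proof. by rewrite -{1}M_sym mxE. Qed.
Let y := inv4 A M.
Let yC : forall r s, center A (y r s) := @inv4_center _ A _ M.
Let c1 : center A 1. Proof. by move=> x; rewrite mulr1 mul1r. Qed.
Let ys : forall r s, y r s = y s r := inv4_sym A M_sym.
Let yz := inv4_mul A M_unit.
Let zC r s : center A (scal_mx A M r s). Proof. exact: center_scal. Qed.
Let zs r s : scal_mx A M r s = scal_mx A M s r. Proof. by rewrite /scal_mx Msym. Qed.

(** Here and below the formulas for [partial], for [raise] and [lower], for the Cayley transform and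
    for nu are solved for the generators of g. A representation of g can thus be prescribed by its
    Weyl operators. *)
Definition low r := \sum_s scal (4 * 'i * M r s) * d s.
Definition ee r := lin2 (p r) (low r) 2^-1 2^-1.
Definition ff r := lin2 (p r) (low r) ('i / 2) (- 'i / 2).

Definition E0 := lin3 X Y hh 2^-1 2^-1 ('i / 2).
Definition F0 := lin3 X Y hh 2^-1 2^-1 (- 'i / 2).
Definition H0 := lin3 X Y hh 'i (- 'i) 0.

Definition EE := E0 + quadE y ee.
Definition FF := F0 + quadF y ff.
Definition HH := H0 + quadH y ee ff.

Let sl2_0 : sl2_relations E0 F0 H0.
Proof.
have act := sl2_adjoint sl2; have lin3_double x : x *+ 2 = scal 2 * x :> A.
  by rewrite scal_nat mulr_natl.
have lin3_doubleN x : - (x *+ 2) = scal (- 2) * x :> A by rewrite scalN mulNr lin3_double.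
rewrite /E0 /F0 /H0; split; rewrite (br_lin3 _ _ _ _ _ _ act) ?lin3_doubleN ?lin3_double.
- by rewrite lin3Z; congr lin3; field: i2.
- by rewrite lin3Z; congr lin3; field: i2.
- by congr lin3; field: i2.
Qed.

Let br_low_p r s : br (low r) (p s) = scal (4 * 'i * M r s).
Proof.
rewrite /low br_suml (bigD1 s)//= big1 => [|t /negPf ts]; rewrite brscall br_dp.
  by rewrite eqxx mulr1 addr0.
by rewrite ts mulr0.
Qed.

Let br_low_low r s : br (low r) (low s) = 0.
Proof.
rewrite /low br_suml big1// => t _; rewrite br_sumr big1// => u _.
by rewrite brscall brscalr br_dd !mulr0.
Qed.

Let br_lin2 r s a b a' b' : br (lin2 (p r) (low r) a b) (lin2 (p s) (low s) a' b') =
  scal (4 * 'i * M r s * (b * a' - a * b')).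
Proof.
rewrite /lin2 !brDl !brscall !brDr !brscalr br_pp br_low_low br_low_p.
rewrite (brC (p r)) br_low_p !mulr0 add0r addr0 -!scalN -!scalM -scalD (Msym s).
by congr scal; ring.
Qed.

Let heis : heisenberg ee ff (scal_mx A M).
Proof.
split=> r s; rewrite /ee /ff br_lin2 ?/scal_mx -?scalMn -?scalN -1?[RHS](scal0 A) //;
  congr scal; by field: i2.
Qed.

Let qEa := quadE_acts yC c1 zC ys yz heis.
Let qFa := quadF_acts yC c1 zC ys zs yz heis.
Let qHa := quadH_acts yC c1 zC ys zs yz heis.

Let comm0 a b c :
  (forall r, br (lin3 X Y hh a b c) (ee r) = 0) /\
  (forall r, br (lin3 X Y hh a b c) (ff r) = 0).
Proof.
have lin3C z : br X z = 0 -> br Y z = 0 -> br hh z = 0 -> br (lin3 X Y hh a b c) z = 0.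
  by move=> b1 b2 b3; rewrite /lin3 !brDl !brscall b1 b2 b3 !mulr0 !addr0.
have lp r : br (lin3 X Y hh a b c) (p r) = 0.
  by apply: lin3C; [case: (br_Xpd r)|case: (br_Ypd r)|case: (br_hpd r)].
have ld r : br (lin3 X Y hh a b c) (d r) = 0.
  by apply: lin3C; [case: (br_Xpd r)|case: (br_Ypd r)|case: (br_hpd r)].
have ll r : br (lin3 X Y hh a b c) (low r) = 0.
  by rewrite /low br_sumr big1// => s _; rewrite brscalr ld mulr0.
by split=> r; rewrite /ee /ff /lin2 brDr !brscalr lp ll !mulr0 addr0.
Qed.

Let comm0q x : (exists a b c, x = lin3 X Y hh a b c) ->
  [/\ br x (quadE y ee) = 0, br x (quadF y ff) = 0 & br x (quadH y ee ff) = 0].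
Proof. by case=> a [b [c ->]]; have [? ?] := comm0 a b c; exact: br_quad_commute. Qed.

Let E0_ex : exists a b c, E0 = lin3 X Y hh a b c. Proof. by do 3!eexists. Qed.
Let F0_ex : exists a b c, F0 = lin3 X Y hh a b c. Proof. by do 3!eexists. Qed.
Let H0_ex : exists a b c, H0 = lin3 X Y hh a b c. Proof. by do 3!eexists. Qed.

(** The triple is the sum of two commuting sl2-triples, the inverse Cayley transform of X, Y, [hh]
    and the quadratic elements. Only the latter acts on [ee] and [ff], and since it acts there as
    sl2 does, it also satisfies the sl2 relations itself. *)
Lemma weyl_jacobi : jacobi_relations EE FF HH ee ff (scal_mx A M).
Proof.
have [EqE EqF EqH] := comm0q E0_ex; have [FqE FqF FqH] := comm0q F0_ex.
have [HqE HqF HqH] := comm0q H0_ex; have [HE HF EF] := sl2_0.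
have [qEE qEF qEH] := br_quad_E yC c1 qEa; have [qHE qHF qHH] := br_quad_H yC c1 qHa.
split=> //.
- have brDD x q x' q' : br x q' = 0 -> br x' q = 0 ->
      br (x + q) (x' + q') = br x x' + br q q' :> A.
    by move=> xq x'q; rewrite brDl !brDr xq (brC q) x'q oppr0 addr0 add0r.
  split; rewrite /EE /FF /HH brDD// ?HE ?HF ?EF ?qHE ?qHF ?qEF mul1r//.
    by rewrite [RHS]mulrnDl.
  by rewrite -opprD [in RHS](mulrnDl 2 F0).
- have [E0e E0f] := comm0 2^-1 2^-1 ('i / 2); have [qe qf] := qEa.
  by split=> r; rewrite /EE (brDl E0) ?E0e ?E0f add0r ?qe ?qf.
- have [E0e E0f] := comm0 2^-1 2^-1 (- 'i / 2); have [qe qf] := qFa.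
  by split=> r; rewrite /FF (brDl F0) ?E0e ?E0f add0r ?qe ?qf.
- have [E0e E0f] := comm0 'i (- 'i) 0; have [qe qf] := qHa.
  by split=> r; rewrite /HH (brDl H0) ?E0e ?E0f add0r ?qe ?qf.
Qed.

Lemma weyl_raise r : raise ee ff r = p r.
Proof.
rewrite /raise {1}/lin2 /ee /ff !lin2Z lin2D [RHS](lin2_1 (p r) (low r)).
by congr lin2; field: i2.
Qed.

Lemma weyl_partial r : partial M ee ff r = d r.
Proof.
have lowE s : lower ee ff s = low s.
  rewrite /lower {1}/lin2 /ee /ff !lin2Z lin2D [RHS](lin2_2 (p s) (low s)).
  by congr lin2; field: i2.
rewrite /partial; under eq_bigr do rewrite lowE /low mulr_sumr.
rewrite exchange_big (bigD1 r)//= [X in _ + X]big1 ?addr0 => [|s /negPf sr]; under eq_bigr do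
    rewrite mulrA -scalM.
  rewrite -mulr_suml -scal_sum (_ : \sum_i _ = 1) ?scal1 ?mul1r//.
  transitivity (\sum_s invmx M r s * M s r); last by rewrite eq_matrix_sum// eqxx.
  by apply: eq_bigr => s _; field: i2.
rewrite -mulr_suml -scal_sum (_ : \sum_i _ = 0) ?scal0 ?mul0r//.
transitivity (\sum_t invmx M r t * M t s); last by rewrite eq_matrix_sum// eq_sym sr.
by apply: eq_bigr => t _; field: i2.
Qed.

Lemma weyl_cayley :
  [/\ wX M EE FF HH ee ff = X, wY M EE FF HH ee ff = Y & wh M EE FF ee ff = hh].
Proof.
rewrite /wX /wY /wh /nuEa /nuFa /nuHa /dE /dF /dH !mul1r /EE /FF /HH !addrK.
have lin33 a b c : lin3 E0 F0 H0 a b c = lin3 X Y hh (a / 2 + b / 2 + c * 'i)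
    (a / 2 + b / 2 - c * 'i) (a * 'i / 2 - b * 'i / 2).
  rewrite {1}/lin3 /E0 /F0 /H0 !lin3Z !lin3D.
  by congr lin3; ring.
rewrite (rotation_lin3 E0 F0 H0) /cayleyX /cayleyY !lin33.
split; [rewrite [RHS](lin3_1 X Y hh) | rewrite [RHS](lin3_2 X Y hh)
  | rewrite [RHS](lin3_3 X Y hh)]; by congr lin3; field: i2.
Qed.

End WeylToJacobi.

(** * The lattice representation *)

Section EndomorphismAlgebra.
Variables (C : comNzRingType) (n : nat) (T : Type).
Local Notation K := {mpoly C[n]}.
Implicit Types (phi psi : T -> K).

(** Linearity is over the polynomial ring and not just over C, so that polynomial eigenvalues can be
    pulled out of every operator, as in [endoZ]. *)
Definition fun_linear (F : (T -> K) -> T -> K) := forall a phi psi,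
  F (fun q => a * phi q + psi q) = fun q => a * F phi q + F psi q.

Record endo := Endo { endo_fun :> (T -> K) -> T -> K; _ : fun_linear endo_fun }.

Lemma endo_linear (f : endo) : fun_linear f. Proof. by case: f. Qed.

Lemma endo_ext (f g : endo) : (forall phi q, f phi q = g phi q) -> f = g.
Proof.
case: f g => [f f_lin] [g g_lin] /= fg.
have {}fg : f = g by apply/funext => phi; apply/funext => q.
by move: f_lin; rewrite fg => f_lin; congr Endo; exact: Prop_irrelevance.
Qed.

HB.instance Definition _ := gen_eqMixin endo.
HB.instance Definition _ := gen_choiceMixin endo.

Fact endo_add_lin (f g : endo) : fun_linear (fun phi q => f phi q + g phi q).
Proof.
by move=> a phi psi; apply/funext => q; rewrite !endo_linear mulrDr addrACA.
Qed.
Fact endo_opp_lin (f : endo) : fun_linear (fun phi q => - f phi q).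
Proof. by move=> a phi psi; apply/funext => q; rewrite endo_linear mulrN opprD. Qed.
Fact endo_zero_lin : fun_linear (fun _ _ => 0).
Proof. by move=> a phi psi; apply/funext => q; rewrite mulr0 addr0. Qed.
Fact endo_one_lin : fun_linear id. Proof. by []. Qed.
Fact endo_mul_lin (f g : endo) : fun_linear (f \o g).
Proof. by move=> a phi psi; rewrite /= !endo_linear. Qed.
Fact endo_scal_lin (c : C) : fun_linear (fun phi q => c%:MP * phi q).
Proof.
by move=> a phi psi; apply/funext => q; rewrite mulrDr mulrCA.
Qed.

Definition endo_add f g := Endo (endo_add_lin f g).
Definition endo_opp f := Endo (endo_opp_lin f).
Definition endo_zero := Endo endo_zero_lin.
Definition endo_one := Endo endo_one_lin.
Definition endo_mul f g := Endo (endo_mul_lin f g).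
Definition endo_scal c := Endo (endo_scal_lin c).

Fact endo_addA : associative endo_add.
Proof. by move=> f g h; apply: endo_ext => phi q; exact: addrA. Qed.
Fact endo_addC : commutative endo_add.
Proof. by move=> f g; apply: endo_ext => phi q; exact: addrC. Qed.
Fact endo_add0 : left_id endo_zero endo_add.
Proof. by move=> f; apply: endo_ext => phi q; exact: add0r. Qed.
Fact endo_addN : left_inverse endo_zero endo_opp endo_add.
Proof. by move=> f; apply: endo_ext => phi q; exact: addNr. Qed.
HB.instance Definition _ :=
  GRing.isZmodule.Build endo endo_addA endo_addC endo_add0 endo_addN.

Fact endo_mulA : associative endo_mul.
Proof. by move=> f g h; apply: endo_ext. Qed.
Fact endo_mul1 : left_id endo_one endo_mul.
Proof. by move=> f; apply: endo_ext. Qed.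
Fact endo_mulr1 : right_id endo_one endo_mul.
Proof. by move=> f; apply: endo_ext. Qed.
Fact endo_mulDl : left_distributive endo_mul endo_add.
Proof. by move=> f g h; apply: endo_ext. Qed.
Fact endo_mulDr : right_distributive endo_mul endo_add.
Proof.
move=> f g h; apply: endo_ext => phi q /=.
have -> : (fun q => g phi q + h phi q) = (fun q => 1 * g phi q + h phi q).
  by apply/funext => r; rewrite mul1r.
by rewrite endo_linear mul1r.
Qed.
HB.instance Definition _ := GRing.Zmodule_isPzRing.Build endo
  endo_mulA endo_mul1 endo_mulr1 endo_mulDl endo_mulDr.

Fact endo_scal1 : endo_scal 1 = 1.
Proof. by apply: endo_ext => phi q /=; rewrite mpolyC1 mul1r. Qed.
Fact endo_scalD c d : endo_scal (c + d) = endo_scal c + endo_scal d.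
Proof. by apply: endo_ext => phi q /=; rewrite mpolyCD mulrDl. Qed.
Fact endo_scalM c d : endo_scal (c * d) = endo_scal c * endo_scal d.
Proof. by apply: endo_ext => phi q /=; rewrite mpolyCM mulrA. Qed.

Lemma endoZ (f : endo) a phi : f (fun q => a * phi q) = fun q => a * f phi q.
Proof.
have f0 : f (fun=> 0) = fun=> 0.
  have := endo_linear f (-1) (fun=> 0) (fun=> 0).
  rewrite (_ : (fun q => _) = fun=> 0); last by apply/funext => q; rewrite mulr0 addr0.
  move=> ->; apply/funext => q; rewrite mulN1r; exact: addNr.
have := endo_linear f a phi (fun=> 0); rewrite f0.
rewrite (_ : (fun q => a * phi q + 0) = fun q => a * phi q); last first.
  by apply/funext => q; rewrite addr0.
by move=> ->; apply/funext => q; rewrite addr0.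
Qed.

Fact endo_scalC c (x : endo) : endo_scal c * x = x * endo_scal c.
Proof. by apply: endo_ext => phi q /=; rewrite endoZ. Qed.
HB.instance Definition _ := PzRing_isPzAlgebra.Build C endo
  endo_scal1 endo_scalD endo_scalM endo_scalC.

Lemma endoDE (f g : endo) phi q : (f + g) phi q = f phi q + g phi q. Proof. by []. Qed.
Lemma endoNE (f : endo) phi q : (- f) phi q = - f phi q. Proof. by []. Qed.
Lemma endoME (f g : endo) phi : (f * g) phi = f (g phi). Proof. by []. Qed.
Lemma endo_scalE c phi q : (scal c : endo) phi q = c%:MP * phi q. Proof. by []. Qed.
Lemma endo_sumE I (s : seq I) (F : I -> endo) phi q :
  (\sum_(i <- s) F i) phi q = \sum_(i <- s) F i phi q.
Proof. by elim: s => [|i s IHs]; rewrite ?big_nil// !big_cons endoDE IHs. Qed.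

End EndomorphismAlgebra.

(** * Difference operators on the weight lattice *)

Section WeightLattice.
Variables (C : numClosedFieldType) (N : nat) (k : C).
Local Notation n := N.+1.
Local Notation K := {mpoly C[n]}.
Local Notation key := {ffun 'I_n -> int}.
Local Notation B := (endo C n key).

Definition unit_key (i : 'I_n) : key := [ffun j => (j == i)%:R].

Fact wshift_lin (a : key -> K) (s : key) :
  fun_linear (fun phi q => a q * phi (q + s)).
Proof. by move=> b phi psi; apply/funext => q; rewrite mulrDr mulrCA. Qed.
Definition wshift a s : B := Endo (wshift_lin a s).

Lemma wshiftM a b s u :
  wshift a s * wshift b u = wshift (fun q => a q * b (q + s)) (s + u).
Proof. by apply: endo_ext => phi q /=; rewrite -mulrA addrA. Qed.

Lemma br_wshift a b s u : br (wshift a s) (wshift b u) =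
  wshift (fun q => a q * b (q + s) - b q * a (q + u)) (s + u).
Proof.
rewrite /br !wshiftM (addrC u s).
by apply: endo_ext => phi q; rewrite endoDE endoNE /= mulrBl.
Qed.

Lemma wshiftD a b s : wshift a s + wshift b s = wshift (fun q => a q + b q) s.
Proof. by apply: endo_ext => phi q; rewrite endoDE /= mulrDl. Qed.

Lemma wshiftMn a s m : wshift a s *+ m = wshift (fun q => a q *+ m) s.
Proof.
elim: m => [|m IHm]; last first.
  by rewrite mulrS IHm wshiftD; apply: endo_ext => phi q /=; rewrite mulrS.
by apply: endo_ext => phi q; rewrite /= mul0r.
Qed.

Lemma eq_wshift a b s : a =1 b -> wshift a s = wshift b s.
Proof. by move=> ab; apply: endo_ext => phi q /=; rewrite ab. Qed.

Lemma wshift0 s : wshift (fun=> 0) s = 0.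
Proof. by apply: endo_ext => phi q /=; rewrite mul0r. Qed.

(* X_0 stands for the eigenvalue of the Casimir element and the other variables
   for those of the Euler operators at the key 0; etaK + 2 q_0 is then the
   weight of the sl2-part on the hyperplane where Htilde acts by k. *)
Definition eulerK (r : 'I_N) (q : key) : K := 'X_(lift ord0 r) + ((q (lift ord0 r))%:~R)%:MP.
Definition etaK : K := k%:MP - (N%:R / 2)%:MP - \sum_(r < N) 'X_(lift ord0 r).
Definition wtK (q : key) : K := etaK + ((q ord0)%:~R *+ 2)%:MP.
(** The eigenvalue of X Y at the key q: the Casimir relation 4 X Y = Omega - w^2 + 2 w, with w the
    sl2-weight, completed to a square. *)
Definition lowK0 (q : key) : K := (4^-1)%:MP * ('X_ord0 + 1 - (wtK q - 1) ^+ 2).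
Definition lowK (i : 'I_n) (q : key) : K := pick_index (lowK0 q) (eulerK ^~ q) i.

(** Shifting the argument by -s moves a delta function by s, so [Rop] raises the key and [Lop]
    lowers it. The coefficient 1 leaves the whole factor R_i L_i to [Lop]. *)
Definition Rop i := wshift (fun=> 1) (- unit_key i).
Definition Lop i := wshift (fun q => lowK i (q + unit_key i)) (unit_key i).
Definition hop := wshift wtK 0.
Definition diag (a : key -> K) := wshift a 0.

Lemma lowK_unit i j q : i != j -> lowK i (q + unit_key j) = lowK i q.
Proof.
rewrite /lowK; case: (unliftP ord0 i) => [r ->|->] ij; rewrite ?pick_index0 ?pick_indexS.
  by rewrite /eulerK !ffunE (negPf ij) addr0.
by rewrite /lowK0 /wtK !ffunE (negPf ij) addr0.
Qed.

Lemma lop_rop i j : i != j -> br (Lop i) (Rop j) = 0.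
Proof.
move=> ij; rewrite br_wshift -(wshift0 (unit_key i - unit_key j)); apply: eq_wshift => q.
rewrite mulr1 mul1r -[lowK i (q - _ + _)](lowK_unit _ ij).
by rewrite [q - _ + _ + _]addrAC subrK subrr.
Qed.

Lemma rop_rop i j : br (Rop i) (Rop j) = 0.
Proof.
rewrite br_wshift -(wshift0 (- unit_key i - unit_key j)); apply: eq_wshift => q.
by rewrite subrr.
Qed.

Lemma lop_lop i j : br (Lop i) (Lop j) = 0.
Proof.
have [->|ij] := eqVneq i j; first exact: brxx.
rewrite br_wshift -(wshift0 (unit_key i + unit_key j)); apply: eq_wshift => q.
have ji : j != i by rewrite eq_sym.
rewrite (addrAC q (unit_key i)) (lowK_unit (q + unit_key j) ji).
by rewrite (addrAC q (unit_key j)) (lowK_unit (q + unit_key i) ij) mulrC subrr.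
Qed.

Lemma lop_rop_euler r : br (Lop (lift ord0 r)) (Rop (lift ord0 r)) = 1.
Proof.
rewrite br_wshift subrr (_ : 1 = wshift (fun=> 1) 0).
  apply: eq_wshift => q; rewrite mulr1 mul1r subrK /lowK !pick_indexS /eulerK.
  rewrite !ffunE eqxx intrD mpolyCD addrA mpolyC1 [X in X - _]addrC.
  by rewrite addrK.
by apply: endo_ext => phi q /=; rewrite mul1r addr0.
Qed.

Lemma wtK_unit0 q : wtK (q + unit_key ord0) = wtK q + 2.
Proof.
rewrite /wtK !ffunE eqxx intrD mulrnDl mpolyCD addrA; congr (_ + _).
by rewrite -[_ *+ 2]/(2%:R) mpolyC_nat.
Qed.

Let four : 4 * (4^-1)%:MP = 1 :> K.
Proof. by rewrite -mpolyC_nat -mpolyCM mulfV ?pnatr_eq0// mpolyC1. Qed.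

Lemma sl2_lattice : sl2_relations (Rop ord0) (Lop ord0) hop.
Proof.
split.
- rewrite br_wshift mulr2n; apply: endo_ext => phi q; rewrite endoDE /= add0r.
  by rewrite -{1}[q](subrK (unit_key ord0)) wtK_unit0; ring.
- rewrite br_wshift mulr2n; apply: endo_ext => phi q; rewrite endoNE endoDE /= add0r addr0.
  by rewrite wtK_unit0; ring.
- rewrite br_wshift addNr; apply: eq_wshift => q.
  rewrite mul1r mulr1 subrK /lowK !pick_index0 /lowK0 wtK_unit0.
  by ring: four.
Qed.

Lemma hop_commute i : i != ord0 -> br hop (Rop i) = 0 /\ br hop (Lop i) = 0.
Proof.
move=> i0; have i0' : ord0 != i by rewrite eq_sym.
have wtK_unit q : wtK (q + unit_key i) = wtK q.
  by rewrite /wtK !ffunE (negPf i0') addr0.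
split; rewrite br_wshift.
  rewrite -(wshift0 (0 - unit_key i)); apply: eq_wshift => q.
  by rewrite mulr1 mul1r -[wtK (q - _)]wtK_unit subrK subrr.
rewrite -(wshift0 (0 + unit_key i)); apply: eq_wshift => q.
by rewrite addr0 wtK_unit mulrC subrr.
Qed.

Definition delta (q : key) : key -> K := fun q' => (q' == q)%:R.

Lemma Rop_delta i q : Rop i (delta q) = delta (q + unit_key i).
Proof. by apply/funext => q'; rewrite /= mul1r /delta subr_eq. Qed.

Lemma Lop_delta i q : Lop i (delta q) = fun q' => lowK i q * delta (q - unit_key i) q'.
Proof.
apply/funext => q'; rewrite /= /delta; have [<-|ne] := eqVneq (q' + unit_key i) q.
  by rewrite addrK eqxx.
by rewrite eq_sym subr_eq eq_sym (negPf ne) !mulr0.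
Qed.

Lemma diag_delta a q : diag a (delta q) = fun q' => a q * delta q q'.
Proof.
apply/funext => q'; rewrite /= addr0 /delta; have [->//|_] := eqVneq q' q.
by rewrite !mulr0.
Qed.

(** This is what the generic weights are for. At the evaluation points below, where X_r is 1 minus
    the coordinate q_r, or X_0 is the square [w0]^2 and the other variables are 0, the decisive
    factor takes the value 1. *)
Lemma lowK_neq0 i q : lowK i q != 0.
Proof.
rewrite /lowK; case: (unliftP ord0 i) => [r ->|->]; rewrite ?pick_index0 ?pick_indexS.
  rewrite /eulerK; apply/eqP => /(congr1 (meval (fun=> 1 - (q (lift ord0 r))%:~R))).
  by rewrite mevalD mevalXU mevalC subrK meval0 => /eqP; rewrite oner_eq0.
rewrite mulf_neq0 ?mpolyC_eq0 ?invr_eq0 ?pnatr_eq0//.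
pose w0 : C := k - N%:R / 2 + (q ord0)%:~R *+ 2 - 1.
apply/eqP => /(congr1 (meval (fun i => if i == ord0 then w0 ^+ 2 else 0))).
rewrite /wtK /etaK [(_ + _ - 1) ^+ 2]expr2 !(mevalM, mevalB, mevalD, mevalC, meval1, mevalXU).
rewrite (raddf_sum (meval _)) big1 => [|r _]; last by rewrite [LHS]mevalXU.
by rewrite eqxx subr0 addrAC subrr add0r => /eqP; rewrite oner_eq0.
Qed.

Definition tauK i q : K := pick_index 'X_ord0 (eulerK ^~ q) i.

Variable M : 'M[C]_N.
Hypothesis M_sym : M^T = M.
Hypothesis M_unit : M \in unitmx.

Let p r := Rop (lift ord0 r).
Let d r := Lop (lift ord0 r).

Definition latE : B := EE M p d (Rop ord0) (Lop ord0) hop.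
Definition latF : B := FF M p d (Rop ord0) (Lop ord0) hop.
Definition latH : B := HH M p d (Rop ord0) (Lop ord0) hop.
Definition late : 'I_N -> B := ee M p d.
Definition latf : 'I_N -> B := ff M p d.

Let lift_neq0 (r : 'I_N) : lift ord0 r != ord0 :> 'I_n. Proof. by []. Qed.
Let lift_neq0' (r : 'I_N) : ord0 != lift ord0 r :> 'I_n. Proof. by []. Qed.

Let pp r s : br (p r) (p s) = 0. Proof. exact: rop_rop. Qed.
Let dd r s : br (d r) (d s) = 0. Proof. exact: lop_lop. Qed.
Let dp r s : br (d r) (p s) = (r == s)%:R.
Proof.
have [->|rs] := eqVneq r s; first exact: lop_rop_euler.
by apply: lop_rop; rewrite (inj_eq lift_inj).
Qed.
Let Xpd r : br (Rop ord0) (p r) = 0 /\ br (Rop ord0) (d r) = 0.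
Proof. by rewrite rop_rop brC lop_rop// oppr0. Qed.
Let Ypd r : br (Lop ord0) (p r) = 0 /\ br (Lop ord0) (d r) = 0.
Proof. by rewrite lop_rop// lop_lop. Qed.
Let hpd r : br hop (p r) = 0 /\ br hop (d r) = 0.
Proof. exact: hop_commute. Qed.

Lemma lattice_relations : jacobi_relations latE latF latH late latf (scal_mx B M).
Proof. exact: (weyl_jacobi M_sym M_unit sl2_lattice pp dd dp Xpd Ypd hpd). Qed.

Let cay := weyl_cayley M p d (Rop ord0) (Lop ord0) hop.

Lemma lattice_R i : wR M latE latF latH late latf i = Rop i.
Proof.
rewrite /wR; case: (unliftP ord0 i) => [r ->|->]; rewrite ?pick_index0 ?pick_indexS.
  exact: weyl_raise.
by have [] := cay.
Qed.

Lemma lattice_L i : wL M latE latF latH late latf i = Lop i.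
Proof.
rewrite /wL; case: (unliftP ord0 i) => [r ->|->]; rewrite ?pick_index0 ?pick_indexS.
  exact: weyl_partial.
by have [] := cay.
Qed.

Let raise_partial r : raise late latf r * partial M late latf r =
  diag (eulerK r).
Proof.
rewrite weyl_raise weyl_partial// wshiftM addNr; apply: eq_wshift => q.
by rewrite mul1r subrK /lowK pick_indexS.
Qed.

Lemma lattice_casimir : casimir (nuEa M latE late) (nuFa M latF latf) (nuHa M latH late latf)
  = diag (fun=> 'X_ord0).
Proof.
rewrite -(casimir_cayley (nua_sl2 M_sym M_unit lattice_relations)).
have [X Y h] := cay; rewrite -[cayleyX _ _ _]/(wX _ _ _ _ _ _) -[cayleyY _ _ _]/(wY _ _ _ _ _ _).
rewrite -[rotation _ _]/(wh M latE latF late latf) X Y h /casimir.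
rewrite expr2 wshiftM wshiftM subrr addr0 !wshiftMn !wshiftD; apply: eq_wshift => q.
rewrite addr0 mulr1 /lowK pick_index0 /lowK0 wtK_unit0 -[_ *+ 4]mulr_natl mulrA.
by rewrite four; ring.
Qed.

Lemma lattice_t i : wt M latE latF latH late latf i = diag (tauK i).
Proof.
rewrite /wt /tauK; case: (unliftP ord0 i) => [r ->|->]; rewrite ?pick_index0 ?pick_indexS.
  by rewrite raise_partial; apply: eq_wshift => q; rewrite pick_indexS.
by rewrite lattice_casimir; apply: eq_wshift => q; rewrite pick_index0.
Qed.

(** The variables X_r enter the sl2-weight and the Euler operators with opposite signs. They cancel
    in h, which therefore acts by numbers although the separate weights are generic. *)
Lemma lattice_h : rotation latE latF =
  diag (fun q => (k + weight (@weyl_wt C N) q)%:MP).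
Proof.
rewrite (rotation_euler M_sym M_unit lattice_relations).
have [_ _ h] := cay; rewrite -[rotation _ _]/(wh M latE latF late latf) h.
apply: endo_ext => phi q; rewrite 2!endoDE endo_sumE endo_scalE.
under eq_bigr do rewrite raise_partial.
rewrite /= addr0 -mulr_suml -!mulrDl; congr (_ * _).
rewrite /weight big_ord_recl /weyl_wt pick_index0.
under [in RHS]eq_bigr do rewrite pick_indexS.
rewrite /wtK /etaK /eulerK big_split /= -(raddf_sum (mpolyC n (R := C))).
by rewrite -(mulrzr 2) mulr_natl !mpolyCD; ring.
Qed.

End WeightLattice.

Lemma sum_by_key (V : zmodType) (I J : eqType) (s : seq I) (key : I -> J) (F : I -> V) :
  \sum_(y <- s) F y = \sum_(x <- undup (map key s)) \sum_(y <- s | key y == x) F y.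
Proof.
under [RHS]eq_bigr do rewrite big_mkcond.
rewrite [RHS]exchange_big [LHS]big_seq [RHS]big_seq.
apply: eq_bigr => y ys; rewrite (bigD1_seq (key y)) ?undup_uniq//=; last first.
  by rewrite mem_undup map_f.
by rewrite eqxx big1_seq ?addr0// => x /andP[/negPf xy _]; rewrite eq_sym xy.
Qed.

Section MPolyFacts.
Variables (C : comNzRingType) (n : nat).
Local Notation K := {mpoly C[n]}.

Lemma mpoly_rmorph_ext (S : comNzRingType) (f g : {rmorphism K -> S}) :
  (forall c, f c%:MP = g c%:MP) -> (forall i, f 'X_i = g 'X_i) -> f =1 g.
Proof.
move=> fgC fgX p; rewrite [p]mpolyE !raddf_sum; apply: eq_bigr => m _.
rewrite /= -mul_mpolyC mpolyXE_id !rmorphM !rmorph_prod fgC; congr (_ * _).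
by apply: eq_bigr => i _; rewrite !rmorphXn fgX.
Qed.

(* Distinct monomials are independent, so the hypothesis is a trivial relation. *)
Lemma monomial_relation (A : pzAlgType C) (t : 'I_n -> A) (I : eqType) (s : seq I)
    (c : I -> C) (m : I -> 'X_{1..n}) : \sum_(y <- s) c y *: 'X_[m y] = 0 :> K ->
  \sum_(y <- s) scal (c y) * tmon t (m y) = 0.
Proof.
move=> rel; rewrite (sum_by_key s m) big1_seq// => x _.
transitivity (scal (\sum_(y <- s | m y == x) c y) * tmon t x).
  by rewrite scal_sum mulr_suml; apply: eq_bigr => y /eqP ->.
rewrite (_ : \sum_(y <- s | _) _ = 0) ?scal0 ?mul0r//.
have := congr1 (mcoeff x) rel; rewrite raddf_sum mcoeff0 => relx; rewrite -[RHS]relx.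
rewrite [LHS]big_mkcond; apply: eq_bigr => y _ /=.
by rewrite mcoeffZ mcoeffX; case: eqP; rewrite ?mulr1 ?mulr0.
Qed.

End MPolyFacts.

(** * Polynomials invariant under shifts of variables *)

Section ShiftInvariance.
Variables (C : numClosedFieldType) (N : nat).
Local Notation K := {mpoly C[N.+1]}.

Definition subst (h : 'I_N.+1 -> K) : K -> K := mmap (@mpolyC N.+1 C) h.
HB.instance Definition _ h := GRing.RMorphism.copy (subst h) (mmap (@mpolyC N.+1 C) h).

Lemma substX h i : subst h 'X_i = h i. Proof. by rewrite /subst mmapX mmap1U. Qed.
Lemma substC h c : subst h c%:MP = c%:MP. Proof. by rewrite /subst mmapC. Qed.
Lemma subst_id f : subst (fun i => 'X_i) f = f.
Proof.
apply: (@mpoly_rmorph_ext _ _ K (subst (fun i => 'X_i)) idfun) => [c|i] /=.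
  exact: substC.
exact: substX.
Qed.
Lemma subst_comp h h' f : subst h' (subst h f) = subst (fun i => subst h' (h i)) f.
Proof.
apply: (@mpoly_rmorph_ext _ _ K (subst h' \o subst h) (subst (fun i => subst h' (h i))))
  => [c|i] /=; first by rewrite !substC.
by rewrite !substX.
Qed.
Lemma eq_subst h h' f : h =1 h' -> subst h f = subst h' f.
Proof. by move=> hh'; congr (subst _ f); apply/funext. Qed.

Definition shift2 (r : 'I_N.+1) (i : 'I_N.+1) : K := 'X_i - 2 *+ (i == r).
Definition kill (s : seq 'I_N.+1) (i : 'I_N.+1) : K := if i \in s then 0 else 'X_i.

(* Along the multiples of the shift, f is a one-variable polynomial taking the
   same value at all natural numbers. *)
Lemma shift2_kill r f : subst (shift2 r) f = f -> subst (kill [:: r]) f = f.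
Proof.
move=> inv.
pose line i : {poly K} := ('X_i)%:P - (2%:P * 'X) *+ (i == r).
pose gam : K -> {poly K} := mmap (polyC \o @mpolyC N.+1 C) line.
pose gamr : {rmorphism K -> {poly K}} := mmap (polyC \o @mpolyC N.+1 C) line.
have gamX i : gam 'X_i = line i by rewrite /gam mmapX mmap1U.
have gamC c : gam c%:MP = (c%:MP)%:P by rewrite /gam mmapC.
have gam_eval x : (gam f).[x] = subst (fun i => 'X_i - 2 * x *+ (i == r)) f.
  apply: (@mpoly_rmorph_ext _ _ K (horner_eval x \o gamr)
    (subst (fun i => 'X_i - 2 * x *+ (i == r)))) => [c|i] /=; rewrite /horner_eval.
    by rewrite mmapC substC hornerC.
  by rewrite mmapX mmap1U substX /line hornerD hornerN hornerMn hornerCM hornerX hornerC.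
have gam_nat j : (gam f).[j%:R] = f.
  rewrite gam_eval; elim: j => [|j IHj].
    by rewrite -[RHS]subst_id; apply: eq_subst => i; rewrite mulr0 mul0rn subr0.
  rewrite -[RHS]IHj -{2}inv subst_comp; apply: eq_subst => i.
  rewrite /shift2 rmorphB /= substX rmorphMn rmorph_nat -natr1.
  by case: (i == r); rewrite ?mulr1n ?mulr0n; ring.
have gam_const : gam f = f%:P.
  apply/eqP; rewrite -subr_eq0; apply: contraT => nz.
  have := @max_poly_roots _ (gam f - f%:P) [seq j%:R | j <- iota 0 (size (gam f - f%:P))] nz.
  rewrite size_map size_iota ltnn => -> //.
    apply/allP => _ /mapP[j _ ->]; rewrite /root hornerD hornerN hornerC gam_nat.
    by rewrite subrr.
  rewrite map_inj_uniq ?iota_uniq// => i j /(congr1 (mcoeff 0%MM)).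
  rewrite -!mpolyC_nat !mcoeffC !eqxx !mulr1 => /eqP; rewrite eqr_nat => /eqP//.
(* At the parameter X_r / 2 the shifted variable X_r - 2 (X_r / 2) is zero. *)
have := gam_eval ((2^-1)%:MP * 'X_r); rewrite gam_const hornerC => {2}->.
apply: eq_subst => i; rewrite /kill inE mulrA -mpolyC_nat -mpolyCM.
rewrite mulfV ?pnatr_eq0// mpolyC1 mul1r.
by case: eqP => [->|_]; rewrite ?subrr ?mulr0n ?subr0.
Qed.

Definition polyK (p : {poly C}) : K := (map_poly (@mpolyC N.+1 C) p).['X_ord0].

Lemma polyK_meval p (v : 'I_N.+1 -> C) : meval v (polyK p) = p.[v ord0].
Proof.
rewrite /polyK -(horner_map (meval v)) /= mevalXU -map_poly_comp.
by rewrite (eq_map_poly (g := id)) ?map_poly_id// => c /=; rewrite mevalC.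
Qed.

Lemma polyK_inj : injective polyK.
Proof.
move=> p q pq; apply/eqP; rewrite -subr_eq0; apply: contraT => nz.
have := @max_poly_roots _ (p - q) [seq j%:R | j <- iota 0 (size (p - q))] nz.
rewrite size_map size_iota ltnn => -> //.
  apply/allP => _ /mapP[j _ ->]; rewrite /root hornerD hornerN.
  by rewrite -!(polyK_meval _ (fun=> j%:R)) pq subrr.
by rewrite map_inj_uniq ?iota_uniq// => i j /eqP; rewrite eqr_nat => /eqP.
Qed.

Lemma shift2_invariant f : (forall r : 'I_N, subst (shift2 (lift ord0 r)) f = f) ->
  exists p, f = polyK p.
Proof.
move=> inv; have kill_f (s : seq 'I_N) : subst (kill (map (lift ord0) s)) f = f.
  elim: s => [|r s IHs]; first by rewrite -[RHS]subst_id; apply: eq_subst.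
  rewrite -[RHS]IHs -[in RHS](shift2_kill (inv r)) subst_comp.
  apply: eq_subst => i; rewrite /kill !inE; case: eqP => _ /=; first by rewrite rmorph0.
  by rewrite substX.
pose pi0 (i : 'I_N.+1) : {poly C} := if i == ord0 then 'X else 0.
pose pim : {rmorphism K -> {poly C}} := mmap polyC pi0.
exists (pim f).
rewrite -{1}(kill_f (enum 'I_N)); apply/esym.
apply: (@mpoly_rmorph_ext _ _ K (horner_eval 'X_ord0 \o map_poly (@mpolyC N.+1 C) \o pim)
  (subst (kill (map (lift ord0) (enum 'I_N))))) => [c|i] /=.
  by rewrite substC /pim /= mmapC map_polyC /horner_eval hornerC.
rewrite substX mmapX mmap1U /pi0 /kill /horner_eval.
case: (unliftP ord0 i) => [r ->|->]; rewrite ?eqxx /=.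
  by rewrite map_poly0 horner0 mem_map ?mem_enum//; exact: lift_inj.
rewrite map_polyX hornerX ifF//; apply/negP => /mapP[r _].
by move/eqP; rewrite (negPf (neq_lift _ _)).
Qed.

End ShiftInvariance.

Definition jacobi_generated (C : numClosedFieldType) (A : pzAlgType C) (N : nat)
    (E F H : A) (e f : 'I_N -> A) (z : 'I_N -> 'I_N -> A) := forall P : A -> Prop,
  P E -> P F -> P H -> (forall r, P (e r)) -> (forall r, P (f r)) ->
  (forall r s, P (z r s)) -> (forall c, P (scal c)) ->
  (forall x y, P x -> P y -> P (x + y)) -> (forall x y, P x -> P y -> P (x * y)) ->
  forall x, P x.

(** * Normal forms *)

Section JacobiQuotient.
Variables (C : numClosedFieldType) (N : nat) (M : 'M[C]_N).
Hypothesis M_sym : M^T = M.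
Hypothesis M_unit : M \in unitmx.
Variables (U : pzAlgType C) (EU FU HU : U) (eU fU : 'I_N -> U) (zU : 'I_N -> 'I_N -> U).
Hypothesis relU : jacobi_relations EU FU HU eU fU zU.
Hypothesis genU : jacobi_generated EU FU HU eU fU zU.
Variables (Q : pzAlgType C) (pr : {rmorphism U -> Q}) (k : C).
Hypothesis pr_scal : forall c, pr (scal c) = scal c.
Hypothesis pr_surj : forall q, exists u, pr u = q.
Hypothesis pr_Z : forall r s, pr (zU r s) = scal_mx Q M r s.

Let E : Q := pr EU.
Let F : Q := pr FU.
Let H : Q := pr HU.
Let e r : Q := pr (eU r).
Let f r : Q := pr (fU r).

Lemma quotient_relations : jacobi_relations E F H e f (scal_mx Q M).
Proof.
apply: (jacobi_relations_morph pr_Z _ relU) => r s.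
exact: center_scal.
Qed.
Let rel := quotient_relations.

Local Notation RQ := (wR M E F H e f).
Local Notation LQ := (wL M E F H e f).
Local Notation tQ := (wt M E F H e f).
Local Notation h := (rotation E F).
Local Notation normal := (normal RQ LQ tQ h k).

Let wrel : weyl_relations RQ LQ tQ h (@weyl_wt C N) (@weyl_eps C N) :=
  jacobi_weyl M_sym M_unit rel.

Let i2 : 'i * 'i = -1 :> C. Proof. by rewrite -expr2 sqrCi. Qed.

(** The left multipliers of normal forms are a subalgebra, so it suffices to find the generators of
    g in it. They are recovered from the letters R_i and L_i by inverting the Cayley transform,
    [raise] and [partial], and nu. *)
Let closedL x := forall y, normal y -> normal (x * y).

Let closed_scal c : closedL (scal c). Proof. by move=> y; exact: normal_scal. Qed.
Let closedD x y : closedL x -> closedL y -> closedL (x + y).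
Proof. by move=> cx cy z nz; rewrite mulrDl; apply: normal_add; [exact: cx|exact: cy]. Qed.
Let closedM x y : closedL x -> closedL y -> closedL (x * y).
Proof. by move=> cx cy z nz; rewrite -mulrA; apply/cx/cy. Qed.
Let closedN x : closedL x -> closedL (- x).
Proof. by move=> cx y ny; rewrite mulNr; apply/normal_opp/cx. Qed.
Let closed_sum (I : finType) (G : I -> Q) : (forall i, closedL (G i)) -> closedL (\sum_i G i).
Proof.
move=> cG; apply: (big_ind closedL) => // y _.
by rewrite mul0r -(mul0r (h - scal k)); exact: normal_ideal.
Qed.

Let closed_R i : closedL (RQ i). Proof. by move=> y; exact: (normal_R wrel). Qed.
Let closed_L i : closedL (LQ i). Proof. by move=> y; exact: (normal_L wrel). Qed.

Let closed_raise r : closedL (raise e f r).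
Proof. by have := closed_R (lift ord0 r); rewrite /wR pick_indexS. Qed.
Let closed_partial r : closedL (partial M e f r).
Proof. by have := closed_L (lift ord0 r); rewrite /wL pick_indexS. Qed.
Let closed_X : closedL (wX M E F H e f).
Proof. by have := closed_R ord0; rewrite /wR pick_index0. Qed.
Let closed_Y : closedL (wY M E F H e f).
Proof. by have := closed_L ord0; rewrite /wL pick_index0. Qed.
Let closed_wh : closedL (wh M E F e f).
Proof.
have [_ _ <-] := wXY M_sym M_unit rel.
apply: closedD; first exact: closedM.
by apply: closedN; exact: closedM.
Qed.

Let closed_lin2 x y a b : closedL x -> closedL y -> closedL (lin2 x y a b).
Proof. by move=> cx cy; apply: closedD; apply: closedM. Qed.
Let closed_lin3 x y z a b c :
  closedL x -> closedL y -> closedL z -> closedL (lin3 x y z a b c).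
Proof. by move=> cx cy cz; do 2?[apply: closedD]; apply: closedM. Qed.

Lemma lower_partial r : lower e f r = \sum_s scal (4 * 'i * M r s) * partial M e f s.
Proof.
rewrite /partial; under eq_bigr do rewrite mulr_sumr.
rewrite exchange_big (bigD1 r)//= [X in _ + X]big1 ?addr0 => [|s /negPf sr];
  under eq_bigr do rewrite mulrA -scalM.
  rewrite -mulr_suml -scal_sum (_ : \sum_i _ = 1) ?scal1 ?mul1r//.
  transitivity (\sum_s M r s * invmx M s r).
    by apply: eq_bigr => s _; field: i2.
  by have /matrixP/(_ r r) := mulmxV M_unit; rewrite !mxE eqxx.
rewrite -mulr_suml -scal_sum (_ : \sum_i _ = 0) ?scal0 ?mul0r//.
transitivity (\sum_t M r t * invmx M t s).
  by apply: eq_bigr => t _; field: i2.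
by have /matrixP/(_ r s) := mulmxV M_unit; rewrite !mxE eq_sym sr.
Qed.

Let closed_lower r : closedL (lower e f r).
Proof. by rewrite lower_partial; apply: closed_sum => s; apply: closedM. Qed.

Let closed_e r : closedL (e r).
Proof.
have -> : e r = lin2 (raise e f r) (lower e f r) 2^-1 2^-1.
  rewrite [RHS]/lin2 /raise /lower !lin2Z lin2D [LHS](lin2_1 (e r) (f r)).
  by congr lin2; field.
exact: closed_lin2.
Qed.

Let closed_f r : closedL (f r).
Proof.
have -> : f r = lin2 (raise e f r) (lower e f r) ('i / 2) (- 'i / 2).
  rewrite [RHS]/lin2 /raise /lower !lin2Z lin2D [LHS](lin2_2 (e r) (f r)).
  by congr lin2; field: i2.
exact: closed_lin2.
Qed.

Let closed_quad u v : (forall r, closedL (u r)) -> (forall r, closedL (v r)) ->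
  closedL (quad (inv4 Q M) u v).
Proof.
move=> cu cv; apply: closed_sum => r; apply: closed_sum => s.
apply: (closedM _ (cv s)); apply: (closedM _ (cu r)); exact: closed_scal.
Qed.

Let closed_nu x : x = nuEa M E e \/ x = nuFa M F f \/ x = nuHa M H e f -> closedL x.
Proof.
have lin33 a b c : lin3 (wX M E F H e f) (wY M E F H e f) (wh M E F e f) a b c =
    lin3 (nuEa M E e) (nuFa M F f) (nuHa M H e f)
     (a / 2 + b / 2 - c * 'i) (a / 2 + b / 2 + c * 'i) (- a * 'i / 2 + b * 'i / 2).
  rewrite [LHS]/lin3 /wX /wY /wh (rotation_lin3 _ _ (nuHa M H e f)) /cayleyX /cayleyY.
  by rewrite !lin3Z !lin3D; congr lin3; ring.
case=> [|[|]] ->.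
- rewrite (_ : nuEa M E e = lin3 (wX M E F H e f) (wY M E F H e f) (wh M E F e f)
    2^-1 2^-1 ('i / 2)); first exact: closed_lin3.
  by rewrite lin33 [LHS](lin3_1 _ (nuFa M F f) (nuHa M H e f)); congr lin3; field: i2.
- rewrite (_ : nuFa M F f = lin3 (wX M E F H e f) (wY M E F H e f) (wh M E F e f)
    2^-1 2^-1 (- 'i / 2)); first exact: closed_lin3.
  by rewrite lin33 [LHS](lin3_2 (nuEa M E e) _ (nuHa M H e f)); congr lin3; field: i2.
- rewrite (_ : nuHa M H e f = lin3 (wX M E F H e f) (wY M E F H e f) (wh M E F e f)
    'i (- 'i) 0); first exact: closed_lin3.
  by rewrite lin33 [LHS](lin3_3 (nuEa M E e) (nuFa M F f)); congr lin3; field: i2.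
Qed.

Lemma normal_all x : normal x.
Proof.
suff cl u : closedL (pr u).
  by have [u <-] := pr_surj x; rewrite -[pr u]mulr1; apply: cl; exact: normal1.
have cE : closedL E.
  have -> : E = nuEa M E e + quadE (inv4 Q M) e by rewrite /nuEa /dE mul1r subrK.
  by apply: closedD; [apply: closed_nu; left|exact: closed_quad].
have cF : closedL F.
  have -> : F = nuFa M F f + quadF (inv4 Q M) f by rewrite /nuFa /dF mul1r subrK.
  apply: closedD; first by apply: closed_nu; right; left.
  by rewrite quadFE; apply: closedN; exact: closed_quad.
have cH : closedL H.
  have -> : H = nuHa M H e f + quadH (inv4 Q M) e f by rewrite /nuHa /dH mul1r subrK.
  apply: closedD; first by apply: closed_nu; right; right.
  by apply: closedD; exact: closed_quad.
have cZ r s : closedL (pr (zU r s)) by rewrite pr_Z; exact: closed_scal.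
have cc c : closedL (pr (scal c)) by rewrite pr_scal; exact: closed_scal.
have cD u1 u2 : closedL (pr u1) -> closedL (pr u2) -> closedL (pr (u1 + u2)).
  by move=> cu cv; rewrite rmorphD; exact: closedD.
have cM u1 u2 : closedL (pr u1) -> closedL (pr u2) -> closedL (pr (u1 * u2)).
  by move=> cu cv; rewrite rmorphM; exact: closedM.
exact: (genU (P := fun u => closedL (pr u)) cE cF cH closed_e closed_f cZ cc cD cM).
Qed.

End JacobiQuotient.

(** * Compatibility of the constructions with homomorphisms *)

Section Transport.
Variables (C : numClosedFieldType) (N : nat) (M : 'M[C]_N).
Variables (A B : pzAlgType C) (psi : {rmorphism A -> B}).
Hypothesis psi_scal : forall c, psi (scal c) = scal c.
Variables (E F H : A) (e f : 'I_N -> A) (E' F' H' : B) (e' f' : 'I_N -> B).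
Hypothesis psiE : psi E = E'.
Hypothesis psiF : psi F = F'.
Hypothesis psiH : psi H = H'.
Hypothesis psie : forall r, psi (e r) = e' r.
Hypothesis psif : forall r, psi (f r) = f' r.

Lemma morph_lin3 x y z a b c :
  psi (lin3 x y z a b c) = lin3 (psi x) (psi y) (psi z) a b c.
Proof. by rewrite /lin3 !rmorphD !rmorphM !psi_scal. Qed.
Lemma morph_lin2 x y a b : psi (lin2 x y a b) = lin2 (psi x) (psi y) a b.
Proof. by rewrite /lin2 !rmorphD !rmorphM !psi_scal. Qed.
Lemma morph_quad (y : 'I_N -> 'I_N -> A) (y' : 'I_N -> 'I_N -> B) u v u' v' :
  (forall r s, psi (y r s) = y' r s) -> (forall r, psi (u r) = u' r) ->
  (forall r, psi (v r) = v' r) -> psi (quad y u v) = quad y' u' v'.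
Proof.
move=> yy uu vv; rewrite rmorph_sum; apply: eq_bigr => r _ /=.
rewrite rmorph_sum; apply: eq_bigr => s _ /=.
by rewrite !rmorphM yy uu vv.
Qed.

Let inv4E r s : psi (inv4 A M r s) = inv4 B M r s. Proof. exact: psi_scal. Qed.

Lemma morph_nu : [/\ psi (nuEa M E e) = nuEa M E' e', psi (nuFa M F f) = nuFa M F' f' &
  psi (nuHa M H e f) = nuHa M H' e' f'].
Proof.
rewrite /nuEa /nuFa /nuHa /dE /dF /dH !rmorphB !mul1r psiE psiF psiH !quadFE rmorphN.
rewrite /quadE /quadH rmorphD !(morph_quad inv4E psie psie) !(morph_quad inv4E psif psif).
by rewrite !(morph_quad inv4E psie psif) !(morph_quad inv4E psif psie).
Qed.

Let morph_raise r : psi (raise e f r) = raise e' f' r.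
Proof. by rewrite /raise morph_lin2 psie psif. Qed.
Let morph_partial r : psi (partial M e f r) = partial M e' f' r.
Proof.
rewrite /partial rmorph_sum; apply: eq_bigr => s _ /=.
by rewrite rmorphM psi_scal /lower morph_lin2 psie psif.
Qed.

Lemma morph_rotation (x y : A) : psi (rotation x y) = rotation (psi x) (psi y).
Proof. by rewrite /rotation rmorphM psi_scal rmorphB. Qed.

Let morph_pick (x0 : A) (x : 'I_N -> A) (y0 : B) (y : 'I_N -> B) i :
  psi x0 = y0 -> (forall r, psi (x r) = y r) -> psi (pick_index x0 x i) = pick_index y0 y i.
Proof.
move=> xy0 xy; case: (unliftP ord0 i) => [r ->|->]; first by rewrite !pick_indexS.
by rewrite !pick_index0.
Qed.

Lemma morph_wR i : psi (wR M E F H e f i) = wR M E' F' H' e' f' i.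
Proof.
have [nE nF nH] := morph_nu; apply: morph_pick => //.
by rewrite /wX /cayleyX morph_lin3 nE nF nH.
Qed.
Lemma morph_wL i : psi (wL M E F H e f i) = wL M E' F' H' e' f' i.
Proof.
have [nE nF nH] := morph_nu; apply: morph_pick => //.
by rewrite /wY /cayleyY morph_lin3 nE nF nH.
Qed.
Lemma morph_wt i : psi (wt M E F H e f i) = wt M E' F' H' e' f' i.
Proof.
have [nE nF nH] := morph_nu; apply: morph_pick => [|r]; last first.
  by rewrite rmorphM morph_raise morph_partial.
rewrite /casimir rmorphD rmorphD [psi (_ *+ 2)]rmorphMn [psi (_ *+ 4)]rmorphMn.
by rewrite rmorphXn rmorphM nE nF nH.
Qed.

End Transport.

(** * Words and monomials acting on delta functions *)

Section WordAction.
Variables (C : numClosedFieldType) (N : nat) (k : C).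
Local Notation n := N.+1.
Local Notation K := {mpoly C[n]}.
Local Notation key := {ffun 'I_n -> int}.
Local Notation B := (endo C n key).
Local Notation delta := (@delta C N).
Local Notation Rop := (@Rop C N).
Local Notation Lop := (Lop k).

Definition moves (x : B) (v : key) := forall q, exists2 g : K,
  g != 0 & x (delta q) = fun q' => g * delta (q + v) q'.

Lemma moves1 : moves 1 0.
Proof.
move=> q; exists 1; first exact: oner_neq0.
by apply/funext => q'; rewrite mul1r addr0.
Qed.

Lemma movesM x y v w : moves x v -> moves y w -> moves (x * y) (v + w).
Proof.
move=> mx my q; have [g g0 yq] := my q; have [g' g'0 xq] := mx (q + w).
exists (g * g'); first by rewrite mulf_neq0.
by rewrite endoME yq endoZ xq; apply/funext => q'; rewrite mulrA -addrA (addrC w).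
Qed.

Lemma movesX x v m : moves x v -> moves (x ^+ m) (v *+ m).
Proof.
move=> mx; elim: m => [|m IHm]; first by rewrite expr0 mulr0n; exact: moves1.
by rewrite exprS mulrS; exact: movesM.
Qed.

Lemma moves_Rop i : moves (Rop i) (unit_key i).
Proof.
move=> q; exists 1; first exact: oner_neq0.
by rewrite Rop_delta; apply/funext => q'; rewrite mul1r.
Qed.

Lemma moves_Lop i : moves (Lop i) (- unit_key i).
Proof. by move=> q; exists (lowK k i q); [exact: lowK_neq0|rewrite Lop_delta]. Qed.

Lemma moves_word v : moves (word Rop Lop v) v.
Proof.
have {2}-> : v = \sum_i unit_key i *~ v i.
  apply/ffunP => j; rewrite sum_ffunE (bigD1 j)//= big1 => [|i /negPf ij].
    by rewrite ffunMzE ffunE eqxx addr0 intz.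
  by rewrite ffunMzE ffunE eq_sym ij mul0rz.
rewrite /word; apply: (big_ind2 moves) => [||i _]; first exact: moves1.
  by move=> x v1 y v2; exact: movesM.
case: (v i) => m /=; first by rewrite -pmulrn; apply: movesX; exact: moves_Rop.
by rewrite NegzE mulrNz -mulNrz -pmulrn; apply: movesX; exact: moves_Lop.
Qed.

Definition eigen (x : B) (q : key) (a : K) := x (delta q) = fun q' => a * delta q q'.

Lemma eigen1 q : eigen 1 q 1. Proof. by apply/funext => q'; rewrite mul1r. Qed.
Lemma eigenM x y q a b : eigen x q a -> eigen y q b -> eigen (x * y) q (a * b).
Proof.
move=> xa yb; rewrite /eigen endoME yb endoZ xa.
by apply/funext => q'; rewrite mulrCA mulrA.
Qed.
Lemma eigenX x q a m : eigen x q a -> eigen (x ^+ m) q (a ^+ m).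
Proof.
move=> xa; elim: m => [|m IHm]; first by rewrite !expr0; exact: eigen1.
by rewrite !exprS; exact: eigenM.
Qed.
Lemma eigenD x y q a b : eigen x q a -> eigen y q b -> eigen (x + y) q (a + b).
Proof.
by move=> xa yb; apply/funext => q'; rewrite endoDE xa yb mulrDl.
Qed.
Lemma eigen_scal c q : eigen (scal c) q c%:MP. Proof. by []. Qed.
Lemma eigen_sum (I : Type) (s : seq I) (P : pred I) (x : I -> B) q (a : I -> K) :
  (forall i, eigen (x i) q (a i)) -> eigen (\sum_(i <- s | P i) x i) q (\sum_(i <- s | P i) a i).
Proof.
move=> xa; apply: (big_ind2 (fun x a => eigen x q a)) => //.
  by apply/funext => q'; rewrite mul0r.
by move=> x1 a1 x2 a2; exact: eigenD.
Qed.
Lemma eigen_diag (a : key -> K) q : eigen (diag a) q (a q).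
Proof. exact: diag_delta. Qed.

Lemma eigen_tmon (m : 'X_{1..n}) q :
  eigen (tmon (fun i => diag (@tauK C N i)) m) q (subst (@tauK C N ^~ q) 'X_[m]).
Proof.
rewrite /subst mmapX /tmon /mmap1.
apply: (big_ind2 (fun x a => eigen x q a)) => [||i _]; first exact: eigen1.
  by move=> x1 a1 x2 a2; exact: eigenM.
by apply: eigenX; exact: eigen_diag.
Qed.

End WordAction.

Section FaithfulAction.
Variables (C : numClosedFieldType) (N : nat) (k : C).
Local Notation n := N.+1.
Local Notation K := {mpoly C[n]}.
Local Notation key := {ffun 'I_n -> int}.
Local Notation B := (endo C n key).
Local Notation delta := (@delta C N).
Local Notation Rop := (@Rop C N).
Local Notation Lop := (Lop k).
Local Notation tauK := (@tauK C N).
Variables (Q : pzAlgType C) (R L t : 'I_n -> Q) (h : Q).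
Hypothesis wrel : weyl_relations R L t h (@weyl_wt C N) (@weyl_eps C N).
Hypothesis normal_Q : forall x, normal R L t h k x.
Variable psi : {rmorphism Q -> B}.
Hypothesis psi_scal : forall c, psi (scal c) = scal c.
Hypothesis psi_R : forall i, psi (R i) = Rop i.
Hypothesis psi_L : forall i, psi (L i) = Lop i.
Hypothesis psi_t : forall i, psi (t i) = diag (tauK i).
Hypothesis psi_h : psi h = diag (fun q => (k + weight (@weyl_wt C N) q)%:MP).

Local Notation wght := (weight (@weyl_wt C N)).

Definition tau_subst (q : key) : K -> K := subst (tauK ^~ q).
HB.instance Definition _ q := GRing.RMorphism.copy (tau_subst q) (subst (tauK ^~ q)).

(** The substitution translates the variables by the entries of q, except for X_0, which it fixes;
    the translation by -q undoes it. *)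
Lemma tau_subst_inj q : injective (tau_subst q).
Proof.
apply: (can_inj (g := tau_subst (- q))) => f; rewrite /tau_subst subst_comp -[RHS]subst_id.
apply: eq_subst => i; rewrite /tauK; case: (unliftP ord0 i) => [r ->|->].
  rewrite !pick_indexS /eulerK rmorphD /= substX substC pick_indexS ffunE /eulerK.
  by rewrite -addrA -mpolyCD -intrD addNr mpolyC0 addr0.
by rewrite !pick_index0 substX pick_index0.
Qed.

Let psi_word v : psi (word R L v) = word Rop Lop v.
Proof.
rewrite /word rmorph_prod; apply: eq_bigr => i _ /=.
by case: (v i) => m /=; rewrite rmorphXn ?psi_R ?psi_L.
Qed.

Let psi_tmon m : psi (tmon t m) = tmon (fun i => diag (tauK i)) m.
Proof. by rewrite /tmon rmorph_prod; apply: eq_bigr => i _ /=; rewrite rmorphXn psi_t. Qed.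

Local Notation terms := (seq (C * ('X_{1..n} * key))).

Definition coef_at (s : terms) (v : key) : K := \sum_(y <- s | y.2.2 == v) y.1 *: 'X_[y.2.1].

(** Distinct words send delta_0 to nonzero multiples of distinct delta functions, on which the t_i
    are diagonal. The value at q thus isolates the terms with the word q, and their polynomial in
    the t_i is read off after a translation. *)
Let term_sum_action (s : terms) : exists2 g : key -> K, (forall q, g q != 0) &
  psi (term_sum R L t s) (delta 0) = fun q => tau_subst q (coef_at s q) * g q.
Proof.
have /choice[g gP] v : exists g : K, g != 0 /\
    word Rop Lop v (delta 0) = fun q' => g * delta v q'.
  by have [g g0 vE] := moves_word k v 0; exists g; rewrite vE add0r.
exists g => [q|]; first by case: (gP q).
apply/funext => q; rewrite rmorph_sum endo_sumE /coef_at rmorph_sum mulr_suml big_mkcond.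
rewrite [RHS]big_mkcond; apply: eq_bigr => -[c [m v]] _ /=.
rewrite !rmorphM psi_scal psi_tmon psi_word endoME endo_scalE endoME.
have [_ ->] := gP v; rewrite endoZ eigen_tmon.
rewrite -mul_mpolyC rmorphM /= [tau_subst q _]substC; case: eqP => [->|/eqP vq].
  by rewrite /delta eqxx mulr1 !mulrA mulrAC.
by rewrite /delta eq_sym (negPf vq) !mulr0.
Qed.

(** Stated at every key of weight 0, because [central_action] compares delta_0 with another such
    key. *)
Let psi_ideal a (q : key) : wght q = 0 -> psi (a * (h - scal k)) (delta q) = fun=> 0.
Proof.
move=> q0; rewrite rmorphM rmorphB psi_scal psi_h endoME.
have -> : (diag (fun q => (k + wght q)%:MP) - scal k : B) (delta q) = fun=> 0.
  apply/funext => q'; rewrite endoDE endoNE endo_scalE diag_delta q0 addr0.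
  by rewrite subrr.
have := endoZ (psi a) 0 (fun=> 0); rewrite (_ : (fun q => _) = fun=> 0) => [->|].
  by apply/funext => q'; rewrite mul0r.
by apply/funext => q'; rewrite mul0r.
Qed.

Let wght0 : wght 0 = 0.
Proof. by rewrite /weight big1// => i _; rewrite ffunE mulr0z. Qed.

Let block0 (s : terms) v : coef_at s v = 0 ->
  \sum_(y <- s | y.2.2 == v) scal y.1 * (tmon t y.2.1 * word R L y.2.2) = 0.
Proof.
move=> cv.
transitivity (\sum_(y <- s | y.2.2 == v) scal y.1 * tmon t y.2.1 * word R L v).
  by apply: eq_bigr => y /eqP <-; rewrite mulrA.
rewrite -mulr_suml -big_filter monomial_relation ?mul0r//.
by rewrite big_filter; exact: cv.
Qed.

Lemma normal_faithful x : psi x (delta 0) = (fun=> 0) -> exists a, x = a * (h - scal k).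
Proof.
have [a [s ->]] := normal_sum wrel (normal_Q x).
have [g g0 sE] := term_sum_action s.
rewrite rmorphD => act; exists a; suff -> : term_sum R L t s = 0 by rewrite addr0.
have coef0 v : coef_at s v = 0.
  have := congr1 (fun F => F v) act; rewrite endoDE psi_ideal// sE add0r => /eqP.
  rewrite mulf_eq0 (negPf (g0 v)) orbF => /eqP tau0.
  by apply: (@tau_subst_inj v); rewrite tau0 rmorph0.
by rewrite /term_sum (sum_by_key s (fun y => y.2.2)) big1// => v _; exact: block0.
Qed.

(* Commuting with h and the t_r leaves only the word 1 in the normal form of x,
   and commuting with L_r^2 R_0 then makes its coefficient invariant under the
   shift by 2 of the r-th variable. *)
Lemma central_action x :
  psi x (psi h (delta 0)) = psi h (psi x (delta 0)) ->
  (forall r : 'I_N, psi x (psi (t (lift ord0 r)) (delta 0)) =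
                    psi (t (lift ord0 r)) (psi x (delta 0))) ->
  (forall r : 'I_N,
     let S := psi (L (lift ord0 r) * L (lift ord0 r) * R ord0) in
     psi x (S (delta 0)) = S (psi x (delta 0))) ->
  exists p, psi x (delta 0) = fun q => polyK N p * delta 0 q.
Proof.
move=> xh xt xS.
have [a [s xE]] := normal_sum wrel (normal_Q x).
have [g g0 sE] := term_sum_action s.
have xact : psi x (delta 0) = fun q => tau_subst q (coef_at s q) * g q.
  by rewrite xE rmorphD -sE; apply/funext => q; rewrite endoDE psi_ideal// add0r.
have coef0 v : v != 0 -> coef_at s v = 0.
  move=> v0; apply: (@tau_subst_inj v); rewrite rmorph0.
  apply/eqP; apply: contraT => cv; case/eqP: v0.
  have nz : tau_subst v (coef_at s v) * g v != 0 by rewrite mulf_neq0.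
  have cancel_nz (b c : K) : b * (tau_subst v (coef_at s v) * g v) =
      c * (tau_subst v (coef_at s v) * g v) -> b = c.
    by move=> /(mulIf nz).
  (* Commuting with t_r equates its eigenvalues X_r at the key 0 and X_r + v_r at the key v. *)
  have vr r : v (lift ord0 r) = 0.
    have := congr1 (fun F => F v) (xt r); rewrite psi_t eigen_diag endoZ xact /=.
    rewrite addr0 => /cancel_nz; rewrite /tauK !pick_indexS /eulerK.
    move/addrI/eqP; rewrite mpolyC_eq eq_sym ffunE intr_eq0 => /eqP//.
  (* Once the v_r vanish, the weight of v is 2 v_0, and commuting with h makes it zero. *)
  have := congr1 (fun F => F v) xh; rewrite psi_h eigen_diag endoZ xact /=.
  rewrite addr0 wght0 => /cancel_nz/eqP; rewrite mpolyC_eq => /eqP/addrI.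
  rewrite /weight big_ord_recl big1 => [|r _]; last by rewrite vr mulr0z.
  rewrite /weyl_wt pick_index0 addr0 -mulrzr => /esym/eqP.
  rewrite mulf_eq0 pnatr_eq0 intr_eq0 => /eqP v00.
  apply/ffunP => i; rewrite ffunE; case: (unliftP ord0 i) => [r ->|->]; first exact: vr.
  exact: v00.
pose f := coef_at s 0.
(* The terms with nontrivial words add up to zero in Q itself, not just on delta_0, so the same
   polynomial f governs x at every key of weight 0. *)
have xact0 q : wght q = 0 -> psi x (delta q) = fun q' => tau_subst q f * delta q q'.
  move=> q0; rewrite xE rmorphD.
  have -> : term_sum R L t s = \sum_(y <- s | y.2.2 == 0) scal y.1 * tmon t y.2.1.
    rewrite /term_sum (bigID (fun y => y.2.2 == 0)) /= [X in _ + X](_ : _ = 0) ?addr0.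
      apply: eq_bigr => y /eqP ->; rewrite (_ : word R L 0 = 1) ?mulr1//.
      by rewrite /word big1// => i _; rewrite ffunE.
    rewrite -big_filter (sum_by_key _ (fun y => y.2.2)) big1_seq// => v /andP[_].
    rewrite mem_undup => /mapP[y]; rewrite mem_filter => /andP[y0 _] vE.
    rewrite big_filter_cond (eq_bigl (fun y => y.2.2 == v)) => [|z].
      by apply/block0/coef0; rewrite vE.
    by apply: andb_idl => /eqP ->; rewrite vE.
  have eig (y : C * ('X_{1..n} * key)) :
      eigen (scal y.1 * tmon (fun i => diag (tauK i)) y.2.1) q
        (y.1%:MP * tau_subst q 'X_[y.2.1]).
    by apply: eigenM; [exact: eigen_scal|exact: eigen_tmon].
  have sumE := eigen_sum s (fun y => y.2.2 == 0) eig.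
  apply/funext => q'; rewrite endoDE psi_ideal// add0r.
  have -> : psi (\sum_(y <- s | y.2.2 == 0) scal y.1 * tmon t y.2.1) =
      \sum_(y <- s | y.2.2 == 0) scal y.1 * tmon (fun i => diag (tauK i)) y.2.1.
    by rewrite rmorph_sum; apply: eq_bigr => y _ /=; rewrite rmorphM psi_scal psi_tmon.
  rewrite sumE; congr (_ * _); rewrite /f /coef_at rmorph_sum; apply: eq_bigr => y _ /=.
  by rewrite -mul_mpolyC rmorphM /= [tau_subst q _%:MP]substC.
have tau0 : tau_subst 0 f = f.
  rewrite -[RHS]subst_id; apply: eq_subst => i; rewrite /tauK.
  case: (unliftP ord0 i) => [r ->|->]; rewrite ?pick_index0 ?pick_indexS//.
  by rewrite /eulerK ffunE mpolyC0 addr0.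
have inv r : subst (shift2 C (lift ord0 r)) f = f.
  (* The two lowering letters of weight -1 balance the raising letter of weight 2. So v has weight
     0, and x acts on delta_v by f translated along v. *)
  pose v : key := - unit_key (lift ord0 r) + - unit_key (lift ord0 r) + unit_key ord0.
  have mS : moves (Lop (lift ord0 r) * Lop (lift ord0 r) * Rop ord0) v.
    by apply: movesM; [apply: movesM; exact: moves_Lop|exact: moves_Rop].
  have [c c0 SE] := mS 0.
  have vE i : v i = (i == ord0)%:R - 2 *+ (i == lift ord0 r).
    by rewrite !ffunE -opprD -mulr2n -mulrnA mulnC mulrnA addrC.
  have v0 : wght v = 0.
    rewrite /weight big_ord_recl (bigD1 r)//= big1 => [|i /negPf ir].
      rewrite !vE /weyl_wt pick_index0 pick_indexS !eqxx /= subr0 sub0r addr0.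
      by rewrite mulr1z mulrNz subrr.
    by rewrite vE (inj_eq lift_inj) ir subr0 mulr0z.
  have := xS r; rewrite /= !rmorphM !psi_L psi_R SE add0r endoZ xact0// xact0//.
  rewrite endoZ SE tau0 add0r => /(congr1 (fun F => F v)).
  rewrite /delta eqxx !mulr1 mulrC => /(mulIf c0) tauv; rewrite -[RHS]tauv.
  apply: eq_subst => i; rewrite /tauK /shift2.
  case: (unliftP ord0 i) => [j ->|->]; rewrite ?pick_index0 ?pick_indexS ?subr0//.
  rewrite /eulerK vE sub0r mulrNz mpolyCN; congr (_ - _).
  by case: eqP; rewrite ?mpolyC0// -mpolyC_nat.
have [p fp] := shift2_invariant inv; exists p; rewrite xact0 //.
by apply/funext => q; rewrite tau0 fp.
Qed.

End FaithfulAction.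

(** * Existence of the Casimir element *)

Section WeightProjection.
Variables (C : fieldType) (A B : pzAlgType C) (psi : {rmorphism A -> B}).
Variable h : A.

Definition weight_sum (u : A) := exists2 s : seq (C * A), u = \sum_(y <- s) y.2 &
  forall y, y \in s -> br h y.2 = scal y.1 * y.2.

Lemma weight_sum1 c x : br h x = scal c * x -> weight_sum x.
Proof.
move=> hx; exists [:: (c, x)]; first by rewrite big_seq1.
by move=> y; rewrite inE => /eqP ->.
Qed.

Lemma weight_sumD x y : weight_sum x -> weight_sum y -> weight_sum (x + y).
Proof.
move=> [s -> sP] [u -> uP]; exists (s ++ u); first by rewrite big_cat.
by move=> z; rewrite mem_cat => /orP[/sP|/uP].
Qed.

Lemma weight_sumM x y : weight_sum x -> weight_sum y -> weight_sum (x * y).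
Proof.
move=> [s -> sP] [u -> uP].
exists [seq (a.1 + b.1, a.2 * b.2) | a <- s, b <- u].
  rewrite big_allpairs_dep mulr_suml; apply: eq_bigr => a _.
  by rewrite mulr_sumr; apply: eq_bigr.
move=> z /allpairsP[[a b] /= [/sP ha /uP hb ->]] /=.
by rewrite brMr ha hb scalD mulrDl mulrA (mulrA a.2) -(scalC b.1) !mulrA.
Qed.

Let remove c x := x - scal c^-1 * br h x.
Let removes (s : seq C) x := foldr remove x s.

Let removesS c s x : removes (c :: s) x = remove c (removes s x). Proof. by []. Qed.

Let removeD c x y : remove c (x + y) = remove c x + remove c y.
Proof. by rewrite /remove brDr mulrDr opprD addrACA. Qed.

Let removesD s x y : removes s (x + y) = removes s x + removes s y.
Proof. by elim: s => [//|c s IHs]; rewrite !removesS IHs removeD. Qed.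

Let removes0 s : removes s 0 = 0.
Proof.
elim: s => [//|c s IHs]; rewrite removesS IHs /remove.
by rewrite brx0 mulr0 subr0.
Qed.

Let removes_weight s w x : br h x = scal w * x ->
  removes s x = scal (\prod_(c <- s) (1 - c^-1 * w)) * x.
Proof.
move=> hx; elim: s => [|c s IHs]; first by rewrite big_nil scal1 mul1r.
rewrite removesS IHs /remove brscalr hx big_cons.
rewrite [scal (_ * \prod_(_ <- _) _)]scalM scalB scalM scal1.
by rewrite -!mulrA mulrBl mul1r -!mulrA (mulrA (scal w)) -(scalC _ (scal w)) -!mulrA.
Qed.

(* Applying 1 - c^-1 ad h for every nonzero weight c of u kills the components of
   nonzero weight and, as psi h commutes with psi u, leaves psi u unchanged. *)
Lemma weight_projection u : weight_sum u -> br (psi h) (psi u) = 0 ->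
  exists u0, br h u0 = 0 /\ psi u0 = psi u.
Proof.
move=> [s uE sP] psiu; pose ws := [seq c <- map fst s | c != 0].
exists (removes ws u); split.
  rewrite uE (big_morph _ (removesD ws) (removes0 ws)) br_sumr big1_seq// => y /andP[_ ys].
  rewrite (removes_weight _ (sP y ys)) brscalr (sP y ys) mulrA -scalM.
  have [->|y0] := eqVneq y.1 0; first by rewrite mulr0 scal0 mul0r.
  rewrite (big_rem y.1) /=; last by rewrite mem_filter y0 map_f.
  by rewrite mulVf// subrr !mul0r scal0 mul0r.
elim: ws => [//|c ws IHws]; rewrite removesS.
by rewrite /remove rmorphB rmorphM br_morph IHws psiu mulr0 subr0.
Qed.

End WeightProjection.

Lemma det_mx22 (S : comPzRingType) (A : 'M[S]_2) :
  \det A = A 0 0 * A 1 1 - A 0 1 * A 1 0.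
Proof.
rewrite (expand_det_row _ 0) !big_ord_recl big_ord0 /cofactor !det_mx11 !mxE /=.
rewrite addr0 expr0 mul1r expr1 mulN1r mulrN.
by congr (A _ _ * A _ _ - A _ _ * A _ _); apply/val_inj.
Qed.

Lemma det_block11 (S : comPzRingType) (a b c d : 'M[S]_1) :
  \det (block_mx a b c d) = a 0 0 * d 0 0 - b 0 0 * c 0 0.
Proof.
rewrite (@det_mx22 S (block_mx a b c d)) -[a 0 0](block_mxEul a b c d).
rewrite -[d 0 0](block_mxEdr a b c d) -[b 0 0](block_mxEur a b c d).
rewrite -[c 0 0](block_mxEdl a b c d).
by congr (_ * _ - _ * _); congr (fun_of_matrix _ _ _); apply/val_inj.
Qed.

Section InverseMinor.
Variables (S : comPzRingType) (n : nat) (M W : 'M[S]_n).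
Hypothesis MW : M *m W = 1%:M.

(* det M times a 2x2 minor of the inverse of M is, up to sign, the complementary
   minor of M; here it appears as the determinant of a bordered matrix. *)
Lemma det_bordered (r u s t : 'I_n) :
  \det (block_mx M (row_mx (delta_mx s (0 : 'I_1)) (delta_mx t (0 : 'I_1)))
         (col_mx (delta_mx (0 : 'I_1) r) (delta_mx (0 : 'I_1) u)) 0) =
  \det M * (W r s * W u t - W r t * W u s).
Proof.
set B := row_mx _ _; set D := col_mx _ _.
(* The second factor contains the Schur complement - D W B, whose entries are up to sign the four
   entries of W selected by the unit vectors in D and B. *)
have -> : block_mx M B D 0 = block_mx M 0 D 1%:M *m block_mx 1%:M (W *m B) 0 (- (D *m W *m B)).
  rewrite mulmx_block !mulmx1 !mulmx0 !mul1mx !mul0mx ?mul1mx !addr0 mulmxA MW mul1mx.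
  by rewrite mulmxA subrr.
rewrite det_mulmx det_lblock det_ublock !det1 mulr1 mul1r; congr (_ * _).
rewrite /B /D mul_col_mx mul_mx_row !mul_col_mx.
rewrite -!rowE -!colE -block_mxEh opp_block_mx.
rewrite det_block11 !mxE.
by rewrite !mulrNN.
Qed.

End InverseMinor.

Section CasimirExists.
Variables (R : realType) (N : nat).
Local Notation C := R[i].
Local Notation U := (Ug R N).
Local Notation V := (Uloc R N).
Local Notation io := (@Defs.iota R N).
Local Notation inV := (@Uloc_in R N).
Local Notation dV := (detVZ R N).
Local Notation w := (invZ R N).

Fact inV_zmod : zmod_morphism inV. Proof. exact: loc_in_zmod. Qed.
Fact inV_monoid : monoid_morphism inV. Proof. exact: loc_in_monoid. Qed.
HB.instance Definition _ := GRing.isZmodMorphism.Build U V inV inV_zmod.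
HB.instance Definition _ := GRing.isMonoidMorphism.Build U V inV inV_monoid.

Lemma inV_scal c : inV (scal c) = scal c. Proof. exact: loc_in_scal. Qed.

Local Notation dd := (inV (\det (Zmx R N))).

Lemma dd_dV : dd * dV = 1. Proof. exact: loc_mulVr. Qed.
Lemma dV_dd : dV * dd = 1. Proof. exact: loc_mulV. Qed.
Lemma dd_center : center V dd.
Proof. by apply: loc_central; exact: det_Zmx_center. Qed.
Lemma dV_center : center V dV.
Proof.
move=> x; rewrite -[LHS]mul1r -dV_dd -mulrA (mulrA dd) -dd_center -(mulrA x) dd_dV.
by rewrite mulr1.
Qed.

Lemma adjZloc r s : (\adj (Zloc R N)) r s = inV ((\adj (Zmx R N)) r s).
Proof. by rewrite /Zloc -(map_mx_adj inV) mxE. Qed.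

Lemma w_center r s : center V (w r s).
Proof.
rewrite mxE; apply: centerM; first exact: dV_center.
by rewrite adjZloc; apply: loc_central; exact: adj_Zmx_center.
Qed.

Lemma w_sym r s : w r s = w s r.
Proof. by rewrite [LHS]mxE [RHS]mxE !adjZloc adj_Zmx_sym. Qed.

Definition locy r s : V := scal 4^-1 * w r s.

Local Notation E := (inV (io (jE C N))).
Local Notation F := (inV (io (jF C N))).
Local Notation H := (inV (io (jH C N))).
Local Notation e := (fun r => inV (io (je C r)) : V).
Local Notation f := (fun r => inV (io (jf C r)) : V).

Lemma form_quad (u v : 'I_N -> V) :
  scal 4^-1 * ((\col_r u r)^T *m w *m (\col_r v r)) 0 0 = quad locy u v.
Proof.
rewrite mxE /quad exchange_big mulr_sumr; apply: eq_bigr => s _.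
rewrite [(_ *m w) 0 s]mxE [(\col_r v r) s 0]mxE mulr_suml mulr_sumr.
apply: eq_bigr => r _; rewrite [_^T 0 r]mxE [(\col_r u r) r 0]mxE.
by rewrite w_center /locy !mulrA.
Qed.

Let c1 : center V 1. Proof. by move=> x; rewrite mulr1 mul1r. Qed.

Let form_fe : scal 4^-1 * ((floc R N)^T *m w *m eloc R N) 0 0 = quad locy f e.
Proof. exact: (form_quad f e). Qed.
Let form_ef : scal 4^-1 * ((eloc R N)^T *m w *m floc R N) 0 0 = quad locy e f.
Proof. exact: (form_quad e f). Qed.
Let form_ee : scal 4^-1 * ((eloc R N)^T *m w *m eloc R N) 0 0 = quad locy e e.
Proof. exact: (form_quad e e). Qed.
Let form_ff : scal 4^-1 * ((floc R N)^T *m w *m floc R N) 0 0 = quad locy f f.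
Proof. exact: (form_quad f f). Qed.

Lemma nuH_dH : nuH R N = dH H e f locy 1.
Proof.
rewrite /nuH [X in _ - X]mulrDr /dH mul1r /quadH.
exact: (congr1 (fun x => H - x) (congr2 +%R form_fe form_ef)).
Qed.
Lemma nuE_dE : nuE R N = dE E e locy 1.
Proof. by rewrite /nuE /dE mul1r; exact: (congr1 (fun x => E - x) form_ee). Qed.
Lemma nuF_dF : nuF R N = dF F f locy 1.
Proof.
by rewrite /nuF /dF mul1r quadFE opprK; exact: (congr1 (fun x => F + x) form_ff).
Qed.

Lemma nu_casimir : nu_Casimir_sl2 R N = cleared_casimir E F H e f locy 1.
Proof. by rewrite /nu_Casimir_sl2 nuH_dH nuE_dE nuF_dF /cleared_casimir mul1r. Qed.

End CasimirExists.

(** * Clearing denominators in the Casimir element *)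

Definition cleared (A B : pzRingType) (psi : {rmorphism A -> B}) (D : A) (x : B) :=
  exists u, psi D * x = psi u.

Section ClearDenominator.
Variables (C : numFieldType) (A B : pzAlgType C) (psi : {rmorphism A -> B}) (D : A).
Hypothesis psi_scal : forall c, psi (scal c) = scal c.
Hypothesis DC : center B (psi D).

Local Notation cleared := (cleared psi D).

Lemma cleared_im u : cleared (psi u).
Proof. by exists (D * u); rewrite rmorphM. Qed.
Lemma clearedD x y : cleared x -> cleared y -> cleared (x + y).
Proof. by move=> [u xu] [v yv]; exists (u + v); rewrite mulrDr xu yv rmorphD. Qed.
Lemma clearedN x : cleared x -> cleared (- x).
Proof. by move=> [u xu]; exists (- u); rewrite mulrN xu rmorphN. Qed.
Lemma clearedB x y : cleared x -> cleared y -> cleared (x - y).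
Proof. by move=> cx cy; apply: clearedD => //; exact: clearedN. Qed.
Lemma clearedMr x u : cleared x -> cleared (x * psi u).
Proof. by move=> [v xv]; exists (v * u); rewrite mulrA xv rmorphM. Qed.
Lemma clearedMl x u : cleared x -> cleared (psi u * x).
Proof. by move=> [v xv]; exists (u * v); rewrite mulrA -DC -mulrA xv rmorphM. Qed.
Lemma cleared_scal x c : cleared x -> cleared (scal c * x).
Proof. by rewrite -psi_scal; exact: clearedMl. Qed.
Lemma clearedMn x m : cleared x -> cleared (x *+ m).
Proof. by rewrite -mulr_natl -scal_nat; exact: cleared_scal. Qed.
Lemma cleared_sum (I : finType) (F : I -> B) : (forall i, cleared (F i)) -> cleared (\sum_i F i).
Proof.
move=> cF; apply: (big_ind cleared) => //; last exact: clearedD.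
by rewrite -(rmorph0 psi); exact: cleared_im.
Qed.

Variables (N : nat) (E F H : A) (e f : 'I_N -> A) (z y : 'I_N -> 'I_N -> B).
Hypothesis rel : jacobi_relations (psi E) (psi F) (psi H) (psi \o e) (psi \o f) z.
Hypothesis yC : forall r s, center B (y r s).
Hypothesis ysym : forall r s, y r s = y s r.
Hypothesis yz : forall r t, (\sum_s y r s * z s t) *+ 4 = if r == t then 1 else 0.
Hypothesis y_cleared : forall r s, cleared (y r s).
Hypothesis minor_cleared : forall r s t u, cleared (y r s * y t u - y r t * y s u).

Let pe := psi \o e.
Let pf := psi \o f.

Lemma quad_cleared u v : cleared (quad y (psi \o u) (psi \o v)).
Proof.
apply: cleared_sum => r; apply: cleared_sum => s.
by apply: clearedMr; exact: clearedMr.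
Qed.

Let yz4 r t : \sum_s y r s * z s t = scal (4^-1 * (r == t)%:R).
Proof.
have := yz r t; rewrite -[LHS]mulr_natl -(scal_nat B 4) => /(congr1 ( *%R (scal 4^-1))).
rewrite mulrA -scalM mulVf ?pnatr_eq0// scal1 mul1r => ->.
by rewrite scalM; case: eqP; rewrite ?scal1 ?scal0.
Qed.

Let skew : exists c, quad y pe pf - quad y pf pe = scal c.
Proof.
have [_ _ ef] := jrel_heis rel.
exists (\sum_(r < N) - (4^-1 *+ 2)).
rewrite /quad [X in _ - X]exchange_big -sumrB scal_sum; apply: eq_bigr => r _.
rewrite -sumrB; transitivity (- ((\sum_s y r s * z s r) *+ 2)).
  rewrite -sumrMnl -sumrN; apply: eq_bigr => s _.
  rewrite (ysym s r) -!mulrA -mulrBr -[_ - _]/(br (pe r) (pf s)) ef (jrel_zC rel r s).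
  by rewrite mulrN mulrnAr.
by rewrite yz4 eqxx mulr1 scalN scalMn.
Qed.

(* Two factors y occur, but reordering the e's and f's leaves a 2x2 minor of y, and
   in the correction terms one factor y is cancelled by z. *)
Lemma quartic_cleared : cleared (quad y pf pe * quad y pf pe - quad y pf pf * quad y pe pe).
Proof.
have [_ _ ef] := jrel_heis rel.
(* The indices are named so that [a] and [b] contain the same four letters f_r, f_t, e_s, e_u; only
   e_s and f_t stand in the other order in [a]. *)
pose a r s t u := y r s * pf r * pe s * (y t u * pf t * pe u).
pose b r s t u := y r t * pf r * pf t * (y s u * pe s * pe u).
have -> : quad y pf pe * quad y pf pe = \sum_r \sum_s \sum_t \sum_u a r s t u.
  rewrite /quad mulr_suml; apply: eq_bigr => r _; rewrite mulr_suml; apply: eq_bigr => s _.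
  by rewrite mulr_sumr; apply: eq_bigr => t _; rewrite mulr_sumr.
have -> : quad y pf pf * quad y pe pe = \sum_r \sum_s \sum_t \sum_u b r s t u.
  rewrite /quad mulr_suml; apply: eq_bigr => r _; rewrite mulr_suml [RHS]exchange_big.
  apply: eq_bigr => t _.
  by rewrite mulr_sumr; apply: eq_bigr => s _; rewrite mulr_sumr.
have mv c (x v : B) : center B c -> x * (c * v) = c * (x * v).
  by move=> cC; rewrite mulrA cC mulrA.
have abE r s t u : a r s t u - b r s t u =
    (y r s * y t u - y r t * y s u) * psi (f r * f t * e s * e u)
    - (y r s * z s t) * (y t u * pf r * pe u) *+ 2.
  have -> : a r s t u = y r s * y t u * (pf r * (pe s * pf t) * pe u).
    by rewrite /a -!mulrA !(mv (y t u)).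
  have -> : b r s t u = y r t * y s u * (pf r * pf t * pe s * pe u).
    by rewrite /b -!mulrA !(mv (y s u)).
  have -> : pe s * pf t = pf t * pe s - z s t *+ 2.
    by rewrite -[- _](ef s t) /br addrC subrK.
  have -> : pf r * (pf t * pe s - z s t *+ 2) * pe u =
      psi (f r * f t * e s * e u) - z s t * (pf r * pe u) *+ 2.
    rewrite mulrBr mulrBl !rmorphM !mulrA; congr (_ - _).
    by rewrite mulrnAr mulrnAl (jrel_z rel).
  rewrite mulrBr mulrBl !rmorphM addrAC; congr (_ - _ - _).
  by rewrite mulrnAr -!mulrA (mv _ (z s t) _ (yC t u)).
have -> : \sum_r \sum_s \sum_t \sum_u a r s t u - \sum_r \sum_s \sum_t \sum_u b r s t u =
    \sum_r \sum_s \sum_t \sum_u (a r s t u - b r s t u).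
  rewrite -sumrB; apply: eq_bigr => r _; rewrite -sumrB; apply: eq_bigr => s _.
  by rewrite -sumrB; apply: eq_bigr => t _; rewrite -sumrB.
have -> : \sum_r \sum_s \sum_t \sum_u (a r s t u - b r s t u) =
    \sum_r \sum_s \sum_t \sum_u
      (y r s * y t u - y r t * y s u) * psi (f r * f t * e s * e u) -
    \sum_r \sum_t (\sum_s y r s * z s t) * (\sum_u y t u * pf r * pe u) *+ 2.
  rewrite -sumrB; apply: eq_bigr => r _.
  under [X in _ = _ - X]eq_bigr => t _ do rewrite mulr_suml -sumrMnl.
  rewrite [X in _ = _ - X]exchange_big -sumrB; apply: eq_bigr => s _ /=.
  rewrite -sumrB; apply: eq_bigr => t _; rewrite mulr_sumr -sumrMnl -sumrB.
  by apply: eq_bigr => u _; exact: abE.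
apply: clearedB.
  do 4!(apply: cleared_sum => ?); exact: clearedMr.
apply: cleared_sum => r; apply: cleared_sum => t; apply: clearedMn.
rewrite yz4; apply: cleared_scal; apply: cleared_sum => u.
by apply: clearedMr; exact: clearedMr.
Qed.

(** Only the terms with two factors y could need the square of the denominator. Since [quadH] is
    twice [quad y pf pe] up to a scalar, they combine to four times the expression in
    [quartic_cleared], plus terms with at most one y. *)
Lemma casimir_cleared :
  cleared (cleared_casimir (psi E) (psi F) (psi H) pe pf y 1).
Proof.
have [c skewE] := skew.
have qH : quadH y pe pf = quad y pf pe *+ 2 + scal c.
  rewrite /quadH -skewE mulr2n -addrA; congr (_ + _).
  by rewrite addrC subrK.
have cH : cleared (quadH y pe pf) by apply: clearedD; exact: quad_cleared.
have cE : cleared (quadE y pe) by exact: quad_cleared.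
have cF : cleared (quadF y pf) by rewrite quadFE; apply: clearedN; exact: quad_cleared.
have c0 : cleared (quad y pf pe) by exact: quad_cleared.
have cs a : cleared (scal a) by rewrite -psi_scal; exact: cleared_im.
have c4 : cleared (quadH y pe pf ^+ 2 + quadF y pf * quadE y pe *+ 4).
  have -> : quadH y pe pf ^+ 2 + quadF y pf * quadE y pe *+ 4 =
      (quad y pf pe * quad y pf pe - quad y pf pf * quad y pe pe) *+ 4
      + (scal c * quad y pf pe) *+ 4 + scal (c * c).
    have sq (q s : B) : s * q = q * s ->
        (q *+ 2 + s) ^+ 2 = (q * q) *+ 4 + (s * q) *+ 4 + s * s.
      have sqD (x : B) : (x + s) ^+ 2 = x * x + (x * s + s * x) + s * s.
        by rewrite expr2 mulrDl !mulrDr !addrA.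
      by move=> sC; rewrite sqD mulrnAl mulrnAr -mulrnA mulrnAl mulrnAr -sC -mulrnDr.
    rewrite qH quadFE /quadE mulNr mulNrn sq ?scalC// -scalM mulrnBl.
    by rewrite addrAC; congr (_ + _); rewrite addrAC.
  apply: clearedD => //; apply: clearedD; apply: clearedMn; first exact: quartic_cleared.
  exact: cleared_scal.
rewrite /cleared_casimir /dE /dF /dH !mul1r.
have -> : (psi H - quadH y pe pf) ^+ 2 =
    psi (H ^+ 2) - psi H * quadH y pe pf - quadH y pe pf * psi H + quadH y pe pf ^+ 2.
  rewrite !expr2 mulrBl !mulrBr rmorphM opprB -!addrA; congr (_ + (_ + _)).
  by rewrite addrC.
have -> : (psi F - quadF y pf) * (psi E - quadE y pe) =
    psi (F * E) - psi F * quadE y pe - quadF y pf * psi E + quadF y pf * quadE y pe.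
  rewrite mulrBl !mulrBr rmorphM opprB -!addrA; congr (_ + (_ + _)).
  by rewrite addrC.
rewrite [X in _ + X]mulrnDl (addrAC _ (quadH _ _ _ ^+ 2)) addrACA.
have cl u x : cleared x -> cleared (psi u * x) by exact: clearedMl.
have cr u x : cleared x -> cleared (x * psi u) by exact: clearedMr.
have cim u : cleared (psi u) by exact: cleared_im.
apply: clearedD; last exact: c4.
apply: clearedD; last apply: clearedMn.
  apply: clearedD; last by apply: clearedMn; exact: clearedB.
  by apply: clearedB; [apply: clearedB; [exact: cim|exact: cl]|exact: cr].
by apply: clearedB; [apply: clearedB; [exact: cim|exact: cl]|exact: cr].
Qed.

End ClearDenominator.

(** The bordered matrix of [det_bordered] has its entries in A, so its determinant is the preimage.
    The identity itself is taken over the center of B, where determinants are multiplicative. *)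
Lemma inverse_minor_image (K : comPzRingType) (A B : pzAlgType K) (psi : {rmorphism A -> B}) n
    (Z : 'M[A]_n) (W : 'M[B]_n) :
  (forall r s, center B (psi (Z r s))) -> (forall r s, center B (W r s)) ->
  W *m map_mx psi Z = 1%:M -> forall r u s t,
  exists x, psi (\det Z) * (W r s * W u t - W r t * W u s) = psi x.
Proof.
move=> ZC WC WZ r u s t.
pose Zc : 'M[zcenter B]_n := \matrix_(i, j) zcenter_in (ZC i j).
pose Wc : 'M[zcenter B]_n := \matrix_(i, j) zcenter_in (WC i j).
have ZcE : map_mx psi Z = map_mx val Zc.
  by apply/matrixP => i j; rewrite [LHS]mxE [RHS]mxE [X in val X]mxE.
have WcE : W = map_mx val Wc.
  by apply/matrixP => i j; rewrite [RHS]mxE [X in val X]mxE.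
have ZW : Zc *m Wc = 1%:M.
  have : map_mx val (Wc *m Zc) = map_mx val (1%:M : 'M[zcenter B]_n).
    by rewrite map_mxM -ZcE -WcE WZ map_scalar_mx rmorph1.
  move=> /matrixP WcZc; apply: mulmx1C; apply/matrixP => i j; apply/val_inj.
  by have := WcZc i j; rewrite [LHS]mxE [RHS]mxE.
exists (\det (block_mx Z (row_mx (delta_mx s (0 : 'I_1)) (delta_mx t (0 : 'I_1)))
         (col_mx (delta_mx (0 : 'I_1) r) (delta_mx (0 : 'I_1) u)) 0)).
have := congr1 val (det_bordered ZW r u s t).
rewrite rmorphM rmorphB !rmorphM -!det_map_mx !map_block_mx !map_row_mx !map_col_mx.
rewrite !map_delta_mx !map_mx0 ZcE => ->; congr (_ * _).
by rewrite WcE !mxE.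
Qed.

(** E, F, H are combinations of the eigenvectors [cayleyX], [cayleyY], h of weights 2, -2, 0, and
    e_r, f_r are combinations of e_r - 'i f_r and e_r + 'i f_r of weights 1 and -1. *)
Lemma jacobi_weight_sum (C : numClosedFieldType) (A : pzAlgType C) N E F H (e f : 'I_N -> A) z :
  jacobi_relations E F H e f z ->
  [/\ weight_sum (rotation E F) E, weight_sum (rotation E F) F, weight_sum (rotation E F) H,
    (forall r, weight_sum (rotation E F) (e r)) & (forall r, weight_sum (rotation E F) (f r))].
Proof.
move=> rel; set h := rotation E F.
have [/sl2_adjoint/br_rotation[hX hY hh] _ _ _ _ _ _] := rel.
have two0 : 2 != 0 :> C by rewrite pnatr_eq0.
have i2 : 'i * 'i = -1 :> C by rewrite -expr2 sqrCi.
have Ws c x y : br h x = scal y * x -> weight_sum h (scal c * x).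
  by move=> hx; apply: (@weight_sum1 _ _ _ y); rewrite brscalr hx !mulrA scalC.
have W3 a b c : weight_sum h (scal a * cayleyX E F H + scal b * cayleyY E F H + scal c * h).
  apply: weight_sumD; [apply: weight_sumD|].
  - exact: Ws hX.
  - by apply: (@Ws _ _ (- 2)); rewrite hY scalN mulNr.
  - by apply: (@Ws _ _ 0); rewrite hh scal0 mul0r.
have L3 a b c u v w : scal a * cayleyX E F H + scal b * cayleyY E F H + scal c * h =
    lin3 E F H u v w -> weight_sum h (lin3 E F H u v w) by move=> <-.
have br2 r a b : br h (lin2 (e r) (f r) a b) = lin2 (e r) (f r) (- 'i * - b) (- 'i * a).
  have [_ [Ee Ef] [Fe Ff] [He Hf] _ _ _] := rel.
  rewrite /h (rotation_lin3 E F H) (br_lin3_2 _ _ _ _ _ (Ee r) _ _ (Ff r)) ?Ef ?Fe ?He ?Hf ?mul1r//.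
  by congr lin2; ring.
have W2 r a b : weight_sum h (lin2 (e r) (f r) a b).
  have -> : lin2 (e r) (f r) a b =
      lin2 (e r) (f r) ((a + 'i * b) / 2) (- 'i * ((a + 'i * b) / 2)) +
      lin2 (e r) (f r) ((a - 'i * b) / 2) ('i * ((a - 'i * b) / 2)).
    by rewrite lin2D; congr lin2; field: i2.
  apply: weight_sumD.
    apply: (@weight_sum1 _ _ _ 1); rewrite br2 lin2Z.
    by congr lin2; ring: i2.
  apply: (@weight_sum1 _ _ _ (- 1)); rewrite br2 lin2Z.
  by congr lin2; ring: i2.
split.
- rewrite (lin3_1 E F H); apply: (L3 2^-1 2^-1 ('i / 2)).
  by rewrite /cayleyX /cayleyY /h (rotation_lin3 E F H) !lin3Z !lin3D; congr lin3; field: i2.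
- rewrite (lin3_2 E F H); apply: (L3 2^-1 2^-1 (- 'i / 2)).
  by rewrite /cayleyX /cayleyY /h (rotation_lin3 E F H) !lin3Z !lin3D; congr lin3; field: i2.
- rewrite (lin3_3 E F H); apply: (L3 'i (- 'i) 0).
  by rewrite /cayleyX /cayleyY /h (rotation_lin3 E F H) !lin3Z !lin3D; congr lin3; field: i2.
- by move=> r; rewrite (lin2_1 (e r) (f r)).
- by move=> r; rewrite (lin2_2 (e r) (f r)).
Qed.

Section CasimirInImage.
Variables (C : numClosedFieldType) (A B : pzAlgType C) (psi : {rmorphism A -> B}).
Hypothesis psi_scal : forall c, psi (scal c) = scal c.
Variables (N : nat) (Z : 'M[A]_N) (W : 'M[B]_N) (dV : B).
Variables (E F H : A) (e f : 'I_N -> A).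
Hypothesis Z_center : forall r s, center B (psi (Z r s)).
Hypothesis W_center : forall r s, center B (W r s).
Hypothesis D_center : center B (psi (\det Z)).
Hypothesis W_sym : forall r s, W r s = W s r.
Hypothesis WZ : W *m map_mx psi Z = 1%:M.
Hypothesis DdV : psi (\det Z) * dV = 1.
Hypothesis WE : forall r s, W r s = dV * psi ((\adj Z) r s).
Hypothesis rel :
  jacobi_relations (psi E) (psi F) (psi H) (psi \o e) (psi \o f) (fun r s => psi (Z r s)).

Definition quarter r s : B := scal 4^-1 * W r s.
Local Notation y := quarter.
Local Notation D := (\det Z).

Let y_center r s : center B (y r s).
Proof. by apply: centerM; [exact: center_scal|exact: W_center]. Qed.
Let y_sym r s : y r s = y s r. Proof. by rewrite /quarter W_sym. Qed.

Let y_mul r t : (\sum_s y r s * psi (Z s t)) *+ 4 = if r == t then 1 else 0.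
Proof.
have /matrixP/(_ r t) := WZ; rewrite [LHS]mxE [RHS]mxE => WZrt.
rewrite /quarter; under eq_bigr do rewrite -mulrA.
rewrite -mulr_sumr; under eq_bigr => s _ do rewrite -[psi _](mxE map_mx_key (fun i j => psi (Z i j))).
rewrite [\sum_i _]WZrt -mulr_natl -scal_nat mulrA -scalM mulfV ?pnatr_eq0// scal1 mul1r.
by case: eqP.
Qed.

Let y_cleared r s : cleared psi D (y r s).
Proof.
exists (scal 4^-1 * (\adj Z) r s).
by rewrite rmorphM psi_scal /quarter WE mulrA -scalC -mulrA (mulrA (psi D)) DdV mul1r.
Qed.

Let minor_cleared r s t u : cleared psi D (y r s * y t u - y r t * y s u).
Proof.
have [x xE] := inverse_minor_image Z_center W_center WZ r u s t.
exists (scal (4^-1 * 4^-1) * x); rewrite rmorphM psi_scal -xE (W_sym u t) (W_sym u s).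
have cc c (a b : B) : (scal c * a) * (scal c * b) = scal (c * c) * (a * b).
  by rewrite scalM -!mulrA; congr (_ * _); rewrite !mulrA scalC.
by rewrite !cc -mulrBr mulrA -scalC -mulrA.
Qed.

(** Clearing denominators gives a preimage that commutes with the rotation after applying psi, which
    determines it only up to the kernel of psi. The projection to weight 0 changes it within that
    kernel. *)
Lemma casimir_in_image c : (forall u, weight_sum (rotation E F) u) ->
  exists u, br (rotation E F) u = 0 /\
    psi u = psi D * (cleared_casimir (psi E) (psi F) (psi H) (psi \o e) (psi \o f) y 1 - scal c).
Proof.
move=> wsum; have [x xE] := casimir_cleared psi_scal D_center rel y_center y_sym y_mul
  y_cleared minor_cleared.
have c1 : center B 1 by move=> b; rewrite mulr1 mul1r.
pose v := x - D * scal c.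
have vE : psi v = psi D * (cleared_casimir (psi E) (psi F) (psi H) (psi \o e) (psi \o f) y 1
    - scal c) by rewrite mulrBr xE rmorphB rmorphM psi_scal.
have : br (psi (rotation E F)) (psi v) = 0.
  rewrite vE brZr// brBr [br _ (scal c)]br_centerr; last exact: center_scal.
  rewrite subr0.
  rewrite rmorphM psi_scal rmorphB brscall brBl.
  rewrite (br_casimir_F rel y_center c1 y_sym y_mul).
  by rewrite (br_casimir_E rel y_center c1 y_sym y_mul) subr0 !mulr0.
move=> /(weight_projection (wsum v))[u [hu uE]].
by exists u; rewrite uE vE.
Qed.

End CasimirInImage.

Section CasimirInCommutant.
Variables (R : realType) (N : nat).
Local Notation C := R[i].
Local Notation U := (Ug R N).
Local Notation V := (Uloc R N).
Local Notation io := (@Defs.iota R N).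
Local Notation inV := (@Uloc_in R N).
Local Notation E := (io (jE C N)).
Local Notation F := (io (jF C N)).
Local Notation H := (io (jH C N)).
Local Notation h := (rotation E F).

Lemma iota_Htilde : io (Htilde R N) = h.
Proof.
rewrite /Defs.iota /Htilde uea_inZ /rotation; congr (_ * _).
by rewrite uea_inD uea_inN.
Qed.

Lemma iota_Ztilde r s : io (Ztilde R r s) = scal ('i / 2) * io (jZ C r s).
Proof. exact: uea_inZ. Qed.

Lemma commutant_kUg (u : U) : br h u = 0 -> u \in commutant (@kUg R N).
Proof.
move=> hu; apply/commutantP => _ [y yk <-]; apply/brP.
have {yk} := coord_span (X := in_tuple _) yk; move=> ->.
rewrite /Defs.iota uea_in_sum br_suml big1// => i _.
rewrite uea_inZ brscall.
set x := (X in uea_in X); have : x \in Htilde R N :: [seq Ztilde R p.1 p.2 | p : 'I_N * 'I_N].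
  exact: mem_nth.
rewrite inE => /orP[/eqP ->|/mapP[p _ ->]].
  by rewrite [uea_in _]iota_Htilde hu mulr0.
rewrite [uea_in _]iota_Ztilde brscall.
by rewrite (br_centerl _ (jrel_z (Ug_relations R N) _ _)) !mulr0.
Qed.

Lemma Ug_generated : jacobi_generated E F H (fun r => io (je C r)) (fun r => io (jf C r))
  (fun r s => io (jZ C r s)).
Proof. by move=> P; exact: uea_jacobi_ind. Qed.

Lemma Ug_weight_sum (u : U) : weight_sum h u.
Proof.
have [wE wF wH we wf] := jacobi_weight_sum (Ug_relations R N).
have c0 x : center U x -> weight_sum h x.
  by move=> xC; apply: (@weight_sum1 _ _ _ 0); rewrite (br_centerr _ xC) scal0 mul0r.
have wZ r s : weight_sum h (io (jZ C r s)).
  by apply: c0; exact: (jrel_z (Ug_relations R N) r s).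
have wc c : weight_sum h (scal c : U) by apply: c0; exact: center_scal.
exact: (Ug_generated (P := weight_sum h) wE wF wH we wf wZ wc (@weight_sumD C U h)
  (@weight_sumM C U h)).
Qed.

Local Notation Z := (Zmx R N).
Local Notation e := (fun r => io (je C r) : U).
Local Notation f := (fun r => io (jf C r) : U).

Lemma casimir_exists : exists Omega : Ugk R N, is_Casimir (val Omega).
Proof.
have ZC r s : center V (inV (Z r s)) by apply: loc_central; exact: Zmx_central.
have WE r s : invZ R N r s = detVZ R N * inV ((\adj Z) r s).
  by rewrite [LHS]mxE adjZloc.
have rel : jacobi_relations (inV E) (inV F) (inV H) (inV \o e) (inV \o f)
    (fun r s => inV (Z r s)).
  apply: (jacobi_relations_morph (phi := inV)) (Ug_relations R N) => // r s.
  by rewrite [Z r s]mxE.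
have [u [hu uE]] := @casimir_in_image C U V inV (@inV_scal R N) N Z (invZ R N) (detVZ R N)
  E F H e f ZC (@w_center R N) (@dd_center R N) (@w_sym R N) (mulVZ R N) (@dd_dV R N) WE rel
  ((N * (N + 4))%:R / 4) Ug_weight_sum.
exists (exist _ u (commutant_kUg hu)).
rewrite /is_Casimir nu_casimir; exact: uE.
Qed.

End CasimirInCommutant.

(** * The annihilator and the center *)

Section RotationWeights.
Variables (C : numClosedFieldType) (A : pzAlgType C) (N : nat) (M : 'M[C]_N).
Variables (E F H : A) (e f : 'I_N -> A) (z : 'I_N -> 'I_N -> A).
Hypothesis rel : jacobi_relations E F H e f z.
Local Notation h := (rotation E F).

Lemma br_rotation_lin2 r a b :
  br h (lin2 (e r) (f r) a b) = lin2 (e r) (f r) ('i * b) (- 'i * a).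
Proof.
have [_ [Ee Ef] [Fe Ff] [He Hf] _ _ _] := rel.
rewrite (rotation_lin3 E F H) (br_lin3_2 _ _ _ _ _ (Ee r) _ _ (Ff r)) ?Ef ?Fe ?He ?Hf ?mul1r//.
by congr lin2; ring.
Qed.

Let weights :
  [/\ forall r, br h (raise e f r) = raise e f r,
      forall r, br h (partial M e f r) = - partial M e f r &
      br h (wX M E F H e f) = scal 2 * wX M E F H e f].
Proof.
have i2 : 'i * 'i = -1 :> C by rewrite -expr2 sqrCi.
split=> [r|r|].
- by rewrite /raise br_rotation_lin2; congr lin2; ring: i2.
- rewrite /partial br_sumr -sumrN; apply: eq_bigr => s _.
  rewrite brscalr -mulrN /lower br_rotation_lin2; congr (_ * _).
  by rewrite -[X in _ = - X]mul1r -mulNr -scal1 -scalN lin2Z; congr lin2; ring: i2.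
have yC := @inv4_center _ A _ M.
have c1 : center A 1 by move=> x; rewrite mulr1 mul1r.
have [E1 E2 E3] := br_E_cleared rel yC c1; have [F1 F2 F3] := br_F_cleared rel yC c1.
have [H1 H2 H3] := br_H_cleared rel yC c1.
have act : adjoint_action E F H (nuEa M E e) (nuFa M F f) (nuHa M H e f) by split.
by have [] := br_rotation act.
Qed.

(** These weight computations take place before the z become scalars: they use only how sl2 acts on
    the e_r, f_r and on nu(sl2). They provide, already in U(g), the elements against which a central
    class is tested. *)
Lemma rotation_commutes :
  (forall r, br h (raise e f r * partial M e f r) = 0) /\
  (forall r, br h (partial M e f r * partial M e f r * wX M E F H e f) = 0).
Proof.
have [hp hd hX] := weights; split=> r; first by rewrite brMr hp hd mulrN subrr.
rewrite brMr (brMr _ (partial M e f r) (partial M e f r)) hX hd scal_nat mulr_natl.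
by rewrite mulrN mulNr -opprD -mulr2n mulNr mulrnAl mulrnAr addNr.
Qed.

End RotationWeights.

Section JacobiAction.
Variables (C : numClosedFieldType) (N : nat) (M : 'M[C]_N) (k : C).
Hypothesis M_sym : M^T = M.
Hypothesis M_unit : M \in unitmx.
Local Notation K := {mpoly C[N.+1]}.
Local Notation key := {ffun 'I_N.+1 -> int}.
Local Notation B := (endo C N.+1 key).
Local Notation delta0 := (delta C (0 : key)).
Variables (U : pzAlgType C) (E F H : U) (e f : 'I_N -> U) (z : 'I_N -> 'I_N -> U).
Hypothesis rel : jacobi_relations E F H e f z.
Hypothesis gen : jacobi_generated E F H e f z.
Variable phi : {rmorphism U -> B}.
Hypothesis phiC : forall c, phi (scal c) = scal c.
Hypothesis phiE : phi E = latE k M.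
Hypothesis phiF : phi F = latF k M.
Hypothesis phiH : phi H = latH k M.
Hypothesis phie : forall r, phi (e r) = late k M r.
Hypothesis phif : forall r, phi (f r) = latf k M r.
Hypothesis phiZ : forall r s, phi (z r s) = scal (M r s).
Local Notation h := (rotation E F).

Definition central_values : set U :=
  [set z p.1 p.2 - scal (M p.1 p.2) | p in setT].

Definition jacobi_ideal : set U := left_ideal_gen ([set h - scal k] `|` central_values).

(** Both claims are transferred to the quotient Q by the central values, through which phi factors
    and where every element has a normal form. *)
Lemma jacobi_action :
  (forall u, phi u delta0 = (fun=> 0) -> jacobi_ideal u) /\
  (forall u, br h u = 0 -> (forall v, br h v = 0 -> phi (br u v) delta0 = (fun=> 0)) ->
    exists p, eigen (phi u) 0 (polyK N p)).
Proof.
have ZC := jrel_z rel.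
have SC x : central_values x -> center U x.
  case=> p _ <-; apply: centerD => // y; rewrite mulNr mulrN; congr (- _).
  exact: center_scal.
have [Q [pr [prC prS pr0 prU]]] := central_quotient SC.
have [psi psiE] : exists psi : {rmorphism Q -> B}, forall a, psi (pr a) = phi a.
  by apply: prU => _ [p _ <-]; rewrite rmorphB phiZ phiC subrr.
have prZ r s : pr (z r s) = scal_mx Q M r s.
  apply/eqP; rewrite -subr_eq0 /scal_mx -prC -rmorphB; apply/eqP/pr0.
  by apply: sub_left_ideal_gen; exists (r, s).
have psiC c : psi (scal c) = scal c by rewrite -prC psiE phiC.
have pE := etrans (psiE E) phiE; have pF := etrans (psiE F) phiF.
have pH := etrans (psiE H) phiH.
have pe r := etrans (psiE (e r)) (phie r); have pf r := etrans (psiE (f r)) (phif r).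
pose eQ (r : 'I_N) : Q := pr (e r); pose fQ (r : 'I_N) : Q := pr (f r).
pose RQ := wR M (pr E) (pr F) (pr H) eQ fQ; pose LQ := wL M (pr E) (pr F) (pr H) eQ fQ.
pose tQ := wt M (pr E) (pr F) (pr H) eQ fQ; pose hQ := rotation (pr E) (pr F).
have pR i : psi (RQ i) = Rop C i.
  exact: etrans (morph_wR M psiC pE pF pH pe pf i) (lattice_R k M i).
have pL i : psi (LQ i) = Lop k i.
  exact: etrans (morph_wL M psiC pE pF pH pe pf i) (lattice_L k M_unit i).
have pt i : psi (tQ i) = diag (tauK C i).
  exact: etrans (morph_wt M psiC pE pF pH pe pf i) (lattice_t k M_sym M_unit i).
have ph : psi hQ = diag (fun q => (k + weight (@weyl_wt C N) q)%:MP).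
  by rewrite morph_rotation// pE pF; exact: lattice_h.
have wrel : weyl_relations RQ LQ tQ hQ (@weyl_wt C N) (@weyl_eps C N).
  exact: (jacobi_weyl M_sym M_unit (quotient_relations rel prZ)).
have nrm x : normal RQ LQ tQ hQ k x := normal_all M_sym M_unit rel gen k prC prS prZ x.
have faith := @normal_faithful C N k Q RQ LQ tQ hQ wrel nrm psi psiC pR pL pt ph.
have central := @central_action C N k Q RQ LQ tQ hQ wrel nrm psi psiC pR pL pt ph.
clear wrel nrm pR pL pt ph.
have phih : phi h = psi hQ by rewrite -psiE morph_rotation.
split=> [u|u hu comm].
  rewrite -psiE => /faith[a aE].
  (* For a lift a' of a, the difference u - a' (h - k) dies in Q and so lies in the left ideal of
     the central values. *)
  have [a' a'E] := prS a; have [g0 gD gM] := left_ideal_genP ([set h - scal k] `|` central_values).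
  have : pr (u - a' * (h - scal k)) = 0.
    by rewrite rmorphB rmorphM rmorphB prC morph_rotation// a'E aE subrr.
  move=> /pr0 uS; rewrite -[u](subrK (a' * (h - scal k))); apply: gD.
    by apply: uS; split; [exact: left_ideal_genP|move=> x Sx; apply: sub_left_ideal_gen; right].
  by apply: gM; apply: sub_left_ideal_gen; left.
have [ht hS] := rotation_commutes M rel.
have commE v : br h v = 0 -> phi u (phi v delta0) = phi v (phi u delta0).
  move=> /comm; rewrite /br rmorphB !rmorphM => /(congr1 (fun F : key -> K => F)) uv.
  apply/funext => q; apply/eqP; rewrite -subr_eq0.
  by have := congr1 (fun F => F q) uv; rewrite endoDE endoNE !endoME => ->.
have pt r : phi (raise e f r * partial M e f r) = psi (tQ (lift ord0 r)).
  have <- : pr (wt M E F H e f (lift ord0 r)) = tQ (lift ord0 r).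
    exact: (morph_wt M prC erefl erefl erefl (fun=> erefl) (fun=> erefl)).
  by rewrite psiE /wt pick_indexS.
have pS r : phi (partial M e f r * partial M e f r * wX M E F H e f) =
    psi (LQ (lift ord0 r) * LQ (lift ord0 r) * RQ ord0).
  have <- : pr (wL M E F H e f (lift ord0 r)) = LQ (lift ord0 r).
    exact: (morph_wL M prC erefl erefl erefl (fun=> erefl) (fun=> erefl)).
  have <- : pr (wR M E F H e f ord0) = RQ ord0.
    exact: (morph_wR M prC erefl erefl erefl (fun=> erefl) (fun=> erefl)).
  by rewrite -!rmorphM psiE /wL /wR pick_indexS pick_index0.
have [| | |p] := central (pr u).
- by rewrite psiE -phih; apply: commE; exact: brxx.
- by move=> r; rewrite psiE -pt; exact: commE.
- by move=> r /=; rewrite psiE -pS; exact: commE.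
by rewrite psiE => pEq; exists p.
Qed.

End JacobiAction.

(** * The action of the two Casimir elements *)

Lemma scal_matrix_image (C : comPzRingType) (A B : pzAlgType C) (phi : {rmorphism A -> B}) n
    (Z : 'M[A]_n) (M : 'M[C]_n) : (forall r s, phi (Z r s) = scal (M r s)) ->
  phi (\det Z) = scal (\det M) /\ (forall r s, phi ((\adj Z) r s) = scal ((\adj M) r s)).
Proof.
move=> phiZ.
have sc_zmod : zmod_morphism (scal : C -> B) by move=> a b; rewrite scalB.
have sc_mon : monoid_morphism (scal : C -> B) by split; [exact: scal1|exact: scalM].
pose sc : {rmorphism C -> B} := HB.pack (scal : C -> B)
  (GRing.isZmodMorphism.Build _ _ _ sc_zmod) (GRing.isMonoidMorphism.Build _ _ _ sc_mon).
have ZM : map_mx phi Z = map_mx sc M by apply/matrixP => r s; rewrite !mxE phiZ.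
split; first by rewrite -det_map_mx ZM det_map_mx.
move=> r s; have /matrixP/(_ r s) : map_mx phi (\adj Z) = map_mx sc (\adj M).
  by rewrite !map_mx_adj ZM.
by rewrite [LHS]mxE [RHS]mxE.
Qed.

Lemma loc_lift (K : comPzRingType) (A B : pzAlgType K) (d : A) (phi : {rmorphism A -> B}) (v : B) :
  (forall c, phi (scal c) = scal c) -> v * phi d = 1 -> phi d * v = 1 ->
  exists chi : {rmorphism loc d -> B}, [/\ forall x, chi (loc_in d x) = phi x,
    chi (loc_inv d) = v & forall c, chi (scal c) = scal c].
Proof.
move=> phiC vd dv; pose g (x : option A) := if x is Some y then phi y else v.
have [s t|chi [chiG chiC]] := @pres_lift K (option A) (@loc_rel K A d) B g.
  by case=> [x y|x y|c||] /=; rewrite ?rmorphD ?rmorphM ?phiC ?vd ?dv ?scal1.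
by exists chi; split=> // [x|]; rewrite [LHS]chiG.
Qed.

(** Used twice: for [casimirU], cleared by c = det M, and with c = 1 for nu(Omega_sl2) in the
    localization. *)
Lemma morph_cleared_casimir (C : numClosedFieldType) N (M : 'M[C]_N) (A B : pzAlgType C)
    (phi : {rmorphism A -> B}) (E F H : A) (e f : 'I_N -> A) (E' F' H' : B) (e' f' : 'I_N -> B)
    (y : 'I_N -> 'I_N -> A) (d : A) c :
  phi E = E' -> phi F = F' -> phi H = H' ->
  (forall r, phi (e r) = e' r) -> (forall r, phi (f r) = f' r) ->
  (forall r s, phi (y r s) = scal c * inv4 B M r s) -> phi d = scal c ->
  phi (cleared_casimir E F H e f y d) =
  scal (c ^+ 2) * casimir (nuEa M E' e') (nuFa M F' f') (nuHa M H' e' f').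
Proof.
move=> pE pF pH pe pf py pd.
have quadc u v : quad (fun r s => scal c * inv4 B M r s) u v = scal c * quad (inv4 B M) u v.
  rewrite mulr_sumr; apply: eq_bigr => r _; rewrite mulr_sumr; apply: eq_bigr => s _.
  by rewrite !mulrA.
have dEc : phi (dE E e y d) = scal c * nuEa M E' e'.
  by rewrite /dE rmorphB rmorphM pd pE (morph_quad py pe pe) quadc mulrBr mul1r.
have dFc : phi (dF F f y d) = scal c * nuFa M F' f'.
  rewrite /nuFa /dF !quadFE rmorphB rmorphN rmorphM pd pF (morph_quad py pf pf) quadc.
  by rewrite mulrBr mul1r mulrN.
have dHc : phi (dH H e f y d) = scal c * nuHa M H' e' f'.
  rewrite /dH rmorphB rmorphD rmorphM pd pH (morph_quad py pf pe) (morph_quad py pe pf) !quadc.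
  by rewrite -mulrDr -mulrBr /nuHa /dH mul1r.
have cc (x z : B) : (scal c * x) * (scal c * z) = scal (c ^+ 2) * (x * z).
  by rewrite expr2 scalM -!mulrA; congr (_ * _); rewrite !mulrA scalC.
rewrite /cleared_casimir rmorphD rmorphD [phi (_ *+ 2)]rmorphMn [phi (_ *+ 4)]rmorphMn.
rewrite rmorphXn !rmorphM pd dEc dFc dHc [X in X + _ + _]expr2 !cc (mulrA (scal c) (scal c)) -scalM -expr2.
by rewrite /casimir (mulrDr _ (_ + _) (_ *+ 4)) (mulrDr _ (_ ^+ 2) (_ *+ 2)) expr2 !mulrnAr.
Qed.

Lemma polyK_comp (C : numClosedFieldType) N (p q : {poly C}) :
  polyK N (p \Po q) = (map_poly (@mpolyC N.+1 C) p).[polyK N q].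
Proof.
rewrite /polyK map_comp_poly horner_comp; congr (_.[_]).
Qed.

Lemma eigen_alg_eval (C : numClosedFieldType) N (A : pzAlgType C)
    (phi : {rmorphism A -> endo C N.+1 {ffun 'I_N.+1 -> int}}) x s p :
  (forall c, phi (scal c) = scal c) ->
  eigen (phi x) 0 (polyK N s) -> eigen (phi (alg_eval x p)) 0 (polyK N (p \Po s)).
Proof.
move=> phiC xs; rewrite polyK_comp.
have -> : (map_poly (@mpolyC N.+1 C) p).[polyK N s] =
    \sum_(i < size p) (p`_i)%:MP * polyK N s ^+ i.
  rewrite horner_coef size_map_inj_poly ?mpolyC0//; last by move=> a b /eqP; rewrite mpolyC_eq => /eqP.
  by apply: eq_bigr => i _; rewrite coef_map.
rewrite rmorph_sum; apply: eigen_sum => i /=; rewrite rmorphM rmorphXn phiC.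
by apply: eigenM; [exact: eigen_scal|exact: eigenX].
Qed.

Lemma eigen_polyK_inj (C : numClosedFieldType) N
    (x : endo C N.+1 {ffun 'I_N.+1 -> int}) p q :
  eigen x 0 (polyK N p) -> eigen x 0 (polyK N q) -> p = q.
Proof.
move=> xp xq; apply: (@polyK_inj _ N).
have := congr1 (fun F => F 0) (etrans (esym xp) xq).
by rewrite /= /delta eqxx !mulr1.
Qed.

Lemma polyK_affine (C : numClosedFieldType) N (a b : C) :
  polyK N (a *: ('X - b%:P)) = a%:MP * ('X_ord0 - b%:MP).
Proof.
by rewrite /polyK map_polyZ hornerZ rmorphB /= map_polyX map_polyC hornerD hornerN hornerX hornerC.
Qed.

Lemma eigen_affine (C : numClosedFieldType) N (a b : C) :
  eigen (scal a * (diag (fun=> 'X_ord0) - scal b)) 0 (polyK N (a *: ('X - b%:P))).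
Proof.
rewrite polyK_affine; apply: eigenM; first exact: eigen_scal.
apply: eigenD; first exact: eigen_diag.
by rewrite -scalN -mpolyCN; exact: eigen_scal.
Qed.

Section CasimirAction.
Variables (R : realType) (N : nat) (k : R[i]) (L : 'M[R[i]]_N).
Hypothesis L_sym : L^T = L.
Hypothesis L_unit : L \in unitmx.
Local Notation C := R[i].
Local Notation U := (Ug R N).
Local Notation V := (Uloc R N).
Local Notation io := (@Defs.iota R N).
Local Notation inV := (@Uloc_in R N).
Local Notation B := (endo C N.+1 {ffun 'I_N.+1 -> int}).
Local Notation delta0 := (delta C (0 : {ffun 'I_N.+1 -> int})).
Local Notation h := (rotation (io (jE C N)) (io (jF C N))).

(* Modulo I_kL, the element Ztilde = (i/2) Z becomes - pi L. *)
Definition index_mx : 'M[C]_N := ('i * 2 * pi%:C%C) *: L.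
Local Notation M := index_mx.

Lemma index_mx_sym : M^T = M. Proof. by rewrite linearZ /= L_sym. Qed.

Let pi_neq0 : 'i * 2 * pi%:C%C != 0 :> C.
Proof.
rewrite !mulf_neq0 ?neq0Ci ?pnatr_eq0//.
by rewrite -(rmorph0 (real_complex R)) (inj_eq (@complexI R)) gt_eqF// pi_gt0.
Qed.

Lemma index_mx_unit : M \in unitmx.
Proof. by rewrite unitmxZ ?unitfE. Qed.

Lemma Ztilde_index r s : io (Ztilde R r s) + scal (pi%:C%C * L r s) =
  scal ('i / 2) * (io (jZ C r s) - scal (M r s)).
Proof.
rewrite iota_Ztilde mulrBr -scalM -scalN; congr (_ + scal _).
rewrite mxE; have ii : 'i * 'i = -1 :> C by rewrite -expr2 sqrCi.
by field: ii.
Qed.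

Lemma I_kL_Z r s : I_kL k L (io (jZ C r s) - scal (M r s)).
Proof.
have i2 : 'i / 2 != 0 :> C by rewrite mulf_neq0 ?neq0Ci ?invr_eq0 ?pnatr_eq0.
have -> : io (jZ C r s) - scal (M r s) =
    scal ('i / 2)^-1 * (io (Ztilde R r s) + scal (pi%:C%C * L r s)).
  by rewrite Ztilde_index mulrA -scalM mulVf// scal1 mul1r.
have [_ _ gM] := left_ideal_genP ([set io (Htilde R N) - scal k] `|`
  [set io (Ztilde R p.1 p.2) + scal (pi%:C%C * L p.1 p.2) | p in setT]).
by apply: gM; apply: sub_left_ideal_gen; right; exists (r, s).
Qed.

Lemma I_kL_h : I_kL k L (h - scal k).
Proof. by apply: sub_left_ideal_gen; left; rewrite -iota_Htilde. Qed.

Lemma sub_jacobi_ideal u :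
  jacobi_ideal M k (io (jE C N)) (io (jF C N)) (fun r s => io (jZ C r s)) u -> I_kL k L u.
Proof.
apply; split; first exact: (left_ideal_genP _).
by move=> x [->|[p _ <-]]; [exact: I_kL_h|exact: I_kL_Z].
Qed.

Section Action.
Variable phi : {rmorphism U -> B}.
Hypothesis phi_scal : forall c, phi (scal c) = scal c.
Hypothesis phi_E : phi (io (jE C N)) = latE k M.
Hypothesis phi_F : phi (io (jF C N)) = latF k M.
Hypothesis phi_H : phi (io (jH C N)) = latH k M.
Hypothesis phi_e : forall r, phi (io (je C r)) = late k M r.
Hypothesis phi_f : forall r, phi (io (jf C r)) = latf k M r.
Hypothesis phi_Z : forall r s, phi (io (jZ C r s)) = scal (M r s).

Lemma action_I_kL u : I_kL k L u -> phi u delta0 = fun=> 0.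
Proof.
have x0 (x : B) : x (fun=> 0) = fun=> 0.
  have := endoZ x 0 (fun=> 0); rewrite (_ : (fun q => _) = fun=> 0) => [->|].
    by apply/funext => q'; rewrite mul0r.
  by apply/funext => q'; rewrite mul0r.
pose J : set U := [set w | phi w delta0 = fun=> 0].
move=> uI; have : J u; last by [].
apply: uI; split; first split=> [|x y xJ yJ|a x xJ]; rewrite /J /=.
- by rewrite rmorph0.
- by rewrite rmorphD; apply/funext => q; rewrite endoDE xJ yJ addr0.
- by rewrite rmorphM endoME xJ x0.
move=> x [->|[p _ <-]]; rewrite /J /=.
  rewrite iota_Htilde rmorphB phi_scal morph_rotation// phi_E phi_F.
  rewrite (lattice_h k index_mx_sym index_mx_unit); apply/funext => q.
  rewrite endoDE endoNE eigen_diag endo_scalE /weight big1 => [|i _]; last first.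
    by rewrite ffunE mulr0z.
  by rewrite addr0 subrr.
rewrite Ztilde_index.
by rewrite rmorphM rmorphB phi_Z !phi_scal subrr mulr0.
Qed.

Let phi_Zmx r s : phi (Zmx R N r s) = scal (M r s).
Proof. by rewrite mxE phi_Z. Qed.

Let detM_unit : \det M \is a GRing.unit. Proof. exact: index_mx_unit. Qed.

Let adjE r s : (\adj M) r s = \det M * invmx M r s.
Proof. by rewrite /invmx index_mx_unit [X in _ = _ * X]mxE mulrA divrr// mul1r. Qed.

Lemma casimirU_action : eigen (phi (casimirU R N)) 0 (polyK N (\det M ^+ 2 *: 'X)).
Proof.
have [phi_det phi_adj] := scal_matrix_image phi_Zmx.
have phi_adj4 r s : phi (adj4 R r s) = scal (\det M) * inv4 B M r s.
  by rewrite rmorphM phi_scal phi_adj -!scalM adjE mulrCA.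
have -> : phi (casimirU R N) = scal (\det M ^+ 2) * diag (fun=> 'X_ord0).
  rewrite -(lattice_casimir k index_mx_sym index_mx_unit).
  exact: (@morph_cleared_casimir C N M U B phi _ _ _ (fun r => io (je C r)) (fun r => io (jf C r))
    _ _ _ _ _ (@adj4 R N) _ _ phi_E phi_F phi_H phi_e phi_f phi_adj4 phi_det).
have := eigen_affine N (\det M ^+ 2) 0; rewrite scal0 !subr0.
exact.
Qed.

(** det Z acts by the nonzero scalar det M, so phi extends to the localization, and the equation
    characterizing a Casimir element can be evaluated there. This determines the action of every
    preimage. *)
Lemma Casimir_action (Omega : U) : is_Casimir Omega ->
  eigen (phi Omega) 0 (polyK N (\det M *: ('X - ((N * (N + 4))%:R / 4)%:P))).
Proof.
have [phi_det phi_adj] := scal_matrix_image phi_Zmx.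
have dV : scal (\det M)^-1 * phi (\det (Zmx R N)) = 1.
  by rewrite phi_det -scalM mulVr// scal1.
have Vd : phi (\det (Zmx R N)) * scal (\det M)^-1 = 1.
  by rewrite phi_det -scalM mulrV// scal1.
have [chi [chi_in chi_inv chi_scal]] := loc_lift phi_scal dV Vd.
have chi_y r s : chi (locy R r s) = scal 1 * inv4 B M r s.
  rewrite rmorphM chi_scal scal1 mul1r [invZ R N r s]mxE rmorphM [chi _]chi_inv.
  rewrite adjZloc [chi (Uloc_in _)]chi_in phi_adj -!scalM adjE; congr scal.
  by rewrite mulKr.
have nuE' : chi (nu_Casimir_sl2 R N) = diag (fun=> 'X_ord0).
  have chi_1 : chi 1 = scal 1 by rewrite rmorph1 scal1.
  have chiE := etrans (chi_in _) phi_E; have chiF := etrans (chi_in _) phi_F.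
  have chiH := etrans (chi_in _) phi_H.
  have chie r := etrans (chi_in _) (phi_e r); have chif r := etrans (chi_in _) (phi_f r).
  have := @morph_cleared_casimir C N M V B chi _ _ _ (fun r => inV (io (je C r)))
    (fun r => inV (io (jf C r))) _ _ _ _ _ (@locy R N) 1 1 chiE chiF chiH chie chif chi_y chi_1.
  rewrite (lattice_casimir k index_mx_sym index_mx_unit) expr1n scal1 mul1r => <-.
  exact: (congr1 chi (nu_casimir R N)).
move=> /(congr1 chi); rewrite rmorphM rmorphB nuE' chi_scal => OmegaE.
have -> : phi Omega = scal (\det M) * (diag (fun=> 'X_ord0) - scal ((N * (N + 4))%:R / 4)).
  by rewrite -phi_det -!chi_in; exact: OmegaE.
exact: eigen_affine.
Qed.

End Action.

End CasimirAction.

Section JacobiActionSummary.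
Variables (R : realType) (N : nat) (k : R[i]) (L : 'M[R[i]]_N).
Hypothesis L_sym : L^T = L.
Hypothesis L_unit : L \in unitmx.
Local Notation C := R[i].
Local Notation U := (Ug R N).
Local Notation io := (@Defs.iota R N).
Local Notation B := (endo C N.+1 {ffun 'I_N.+1 -> int}).
Local Notation delta0 := (delta C (0 : {ffun 'I_N.+1 -> int})).
Local Notation h := (rotation (io (jE C N)) (io (jF C N))).
Local Notation M := (index_mx L).

(** Collects what the final argument uses about the representation: the annihilator of delta_0, the
    polynomial attached to a central class, and the polynomials of the two Casimir elements. *)
Lemma Ug_action : exists phi : {rmorphism U -> B},
  [/\ forall c, phi (scal c) = scal c,
    forall u, phi u delta0 = (fun=> 0) <-> I_kL k L u,
    forall u, br h u = 0 -> (forall v, br h v = 0 -> I_kL k L (br u v)) ->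
      exists p, eigen (phi u) 0 (polyK N p),
    eigen (phi (casimirU R N)) 0 (polyK N (\det M ^+ 2 *: 'X)) &
    forall Omega, is_Casimir Omega ->
      eigen (phi Omega) 0 (polyK N (\det M *: ('X - ((N * (N + 4))%:R / 4)%:P)))].
Proof.
have Msym := index_mx_sym L_sym; have Munit := index_mx_unit L_unit.
have [phi0 [pC0 [pE0 pF0 pH0 pe0 [pf0 pZ0]]]] :=
  uea_jacobi_lift (lattice_relations k Msym Munit).
pose phi : {rmorphism U -> B} := phi0.
have pC c : phi (scal c) = scal c := pC0 c.
have pE : phi (io (jE C N)) = latE k M := pE0.
have pF : phi (io (jF C N)) = latF k M := pF0.
have pH : phi (io (jH C N)) = latH k M := pH0.
have pe r : phi (io (je C r)) = late k M r := pe0 r.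
have pf r : phi (io (jf C r)) = latf k M r := pf0 r.
have pZ r s : phi (io (jZ C r s)) = scal (M r s) := pZ0 r s.
have [faithful central] := jacobi_action Msym Munit (Ug_relations R N) (@Ug_generated R N)
  pC pE pF pH pe pf pZ.
have inI u : I_kL k L u -> phi u delta0 = fun=> 0.
  exact: (action_I_kL L_sym L_unit (phi := phi) pC pE pF pZ).
exists phi; split; [exact: pC|move=> u|move=> u uv comm| |move=> Omega].
- split; last exact: inI.
  by move=> u0; apply: sub_jacobi_ideal; exact: faithful.
- exact: (central u uv (fun v hv => inI _ (comm v hv))).
- exact: (casimirU_action L_sym L_unit (phi := phi) pC pE pF pH pe pf pZ).
- exact: (Casimir_action L_sym L_unit (phi := phi) pC pE pF pH pe pf pZ).
Qed.

End JacobiActionSummary.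

(** * The projection to D_kL and the center *)

Lemma rmorph_alg_eval (K : comNzRingType) (A B : pzAlgType K) (phi : {rmorphism A -> B}) x p :
  (forall c, phi (scal c) = scal c) -> phi (alg_eval x p) = alg_eval (phi x) p.
Proof.
move=> phiC; rewrite rmorph_sum; apply: eq_bigr => i _ /=.
by rewrite rmorphM rmorphXn phiC.
Qed.

Lemma center_alg_eval (K : comNzRingType) (A : pzAlgType K) (x : A) p :
  center A x -> center A (alg_eval x p).
Proof.
move=> xC; apply: (big_ind (center A)) => [|a b|i _]; first exact: center0.
  exact: centerD.
apply: centerM; first exact: center_scal.
elim: (nat_of_ord i) => [y|m IHm]; first by rewrite mulr1 mul1r.
by rewrite exprS; exact: centerM.
Qed.

Section Projection.
Variables (R : realType) (N : nat) (k : R[i]) (L : 'M[R[i]]_N).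
Local Notation C := R[i].
Local Notation U := (Ug R N).
Local Notation Uk := (Ugk R N).
Local Notation h := (rotation (Defs.iota (jE C N)) (Defs.iota (jF C N))).
Local Notation D := (@D_proj R N k L).

Lemma D_projP (u v : Uk) : D u = D v <-> I_kL k L (val u - val v).
Proof.
have -> : val u - val v = val (u - v) by rewrite rmorphB.
by split=> [/quot_projP/asboolP|/asboolP uv]; last exact/quot_projP.
Qed.

Lemma D_proj_surj (x : D_kL k L) : exists u, D u = x.
Proof. by exists (repr x); exact: quot_projK. Qed.

Fact D_proj_zmod : zmod_morphism D.
Proof. by move=> u v; apply: (addIr (D v)); rewrite -[LHS]quot_projD !subrK. Qed.
Fact D_proj_monoid : monoid_morphism D.
Proof. by split=> // u v; exact: quot_projM. Qed.
HB.instance Definition _ := GRing.isZmodMorphism.Build Uk (D_kL k L) D D_proj_zmod.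
HB.instance Definition _ := GRing.isMonoidMorphism.Build Uk (D_kL k L) D D_proj_monoid.

Lemma D_proj_alg_eval (u : Uk) p : D (alg_eval u p) = alg_eval (D u) p.
Proof. exact: (rmorph_alg_eval (phi := D)). Qed.

Lemma val_alg_eval (u : Uk) p : val (alg_eval u p) = alg_eval (val u) p.
Proof. exact: (rmorph_alg_eval (phi := val : {rmorphism Uk -> U})). Qed.

Lemma Ugk_commute (u : Uk) : br h (val u) = 0.
Proof.
apply/brP; rewrite -iota_Htilde; have /commutantP := valP u; apply.
exact: Ht_kUg.
Qed.

Lemma center_commutator (u : Uk) : center (D_kL k L) (D u) ->
  forall v, br h v = 0 -> I_kL k L (br (val u) v).
Proof.
move=> uC v hv; pose w : Uk := exist _ v (commutant_kUg hv).
have /D_projP : D (u * w) = D (w * u) by rewrite !rmorphM uC.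
by rewrite !rmorphM.
Qed.

Lemma D_proj_center (u : Uk) : center U (val u) -> center (D_kL k L) (D u).
Proof.
move=> uC x; have [v <-] := D_proj_surj x; rewrite -!rmorphM; congr D.
by apply/val_inj; rewrite !rmorphM uC.
Qed.

Lemma center_in_Ugk (u : U) : center U u -> exists2 v : Uk, val v = u & center U (val v).
Proof.
move=> uC; have uk : u \in commutant (@kUg R N) by apply/commutantP => x _; exact: uC.
by exists (exist _ u uk).
Qed.

End Projection.

Theorem theorem4p1 (R : realType) (N : nat) (k : R[i]) (L : 'M[R[i]]_N)
    (N_gt0 : (0 < N)%N) (L_sym : L^T = L) (L_unit : L \in unitmx) :
  center (D_kL k L) =
    [set D_proj k L z | z in [set z : Ugk R N | center (Ug R N) (val z)]] /\
  (exists Omega : Ugk R N, is_Casimir (val Omega)) /\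
  forall Omega : Ugk R N, is_Casimir (val Omega) ->
    center (D_kL k L) = range (alg_eval (D_proj k L Omega)) /\
    injective (alg_eval (D_proj k L Omega)).
Proof.
have [phi [phiC phi0 centralP cas_act Cas_act]] := Ug_action k L_sym L_unit.
set d := \det (index_mx L) in cas_act Cas_act.
have d0 : d != 0 by rewrite -unitfE; exact: (index_mx_unit L_unit).
pose acts u p := eigen (phi u) 0 (polyK N p).
(* The annihilator of delta_0 is [I_kL], so the polynomial by which an element acts determines its
   class. *)
have actsI u v p : acts u p -> acts v p -> I_kL k L (u - v).
  move=> up vp; apply/phi0; rewrite rmorphB; apply/funext => q.
  by rewrite endoDE endoNE up vp subrr.
have acts_inj u v p q : acts u p -> acts v q -> I_kL k L (u - v) -> p = q.
  move=> up vq /phi0; rewrite rmorphB => uv; apply: (eigen_polyK_inj up).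
  rewrite /eigen -vq; apply/funext => r; apply/eqP; rewrite -subr_eq0.
  by have := congr1 (fun F => F r) uv; rewrite endoDE endoNE => ->.
(* Since [casimirU] acts by d^2 X_0 with d nonzero, evaluating p at [casimirU] / d^2 gives a central
   element of U(g) that acts by p. *)
have lift_central p : exists2 z : Ugk R N, acts (val z) p & center (Ug R N) (val z).
  pose u : Ug R N := alg_eval (casimirU R N) (p \Po ((d ^+ 2)^-1 *: 'X)).
  have [z zu zC] := center_in_Ugk (center_alg_eval _ (@casimirU_center R N) : center _ u).
  exists z => //; rewrite zu.
  have := eigen_alg_eval (p \Po ((d ^+ 2)^-1 *: 'X)) phiC cas_act.
  by rewrite -comp_polyA comp_polyZ comp_polyX scalerA mulVf ?expf_neq0// scale1r comp_polyXr.
have acts_center (u : Ugk R N) p : acts (val u) p -> exists2 z : Ugk R N,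
    center (Ug R N) (val z) & D_proj k L z = D_proj k L u.
  by move=> up; have [z zp zC] := lift_central p; exists z => //; apply/D_projP; exact: actsI zp up.
have center_acts x : center (D_kL k L) x -> exists u p, D_proj k L u = x /\ acts (val u) p.
  have [u <-] := D_proj_surj x => uC.
  have [p up] := centralP (val u) (Ugk_commute u) (center_commutator uC).
  by exists u, p.
split; [|split; first exact: casimir_exists].
  apply/seteqP; split=> x /= => [/center_acts[u [p [<- /acts_center[z zC zu]]]]|[z zC <-]].
    by exists z.
  exact: D_proj_center.
move=> Omega /Cas_act; set s := _ *: _ => Omega_s.
have eval_acts q : acts (val (alg_eval Omega q)) (q \Po s).
  by rewrite val_alg_eval; exact: eigen_alg_eval.
(* The compositional inverse of the affine polynomial s by which Omega acts. Composing with t turns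
   any p into a polynomial whose value at Omega acts by p, and it cancels s in the proof of
   injectivity. *)
pose t := d^-1 *: 'X + ((N * (N + 4))%:R / 4)%:P : {poly R[i]}.
have ts : t \Po s = 'X.
  by rewrite comp_polyD comp_polyZ comp_polyX comp_polyC scalerA mulVf// scale1r subrK.
have st : s \Po t = 'X.
  by rewrite comp_polyZ comp_polyB comp_polyX comp_polyC addrK scalerA mulfV// scale1r.
split.
  apply/seteqP; split=> x /= => [/center_acts[u [p [<- up]]]|[q _ <-]].
    exists (p \Po t) => //; rewrite -D_proj_alg_eval; apply/D_projP.
    by apply: actsI up; have := eval_acts (p \Po t); rewrite -comp_polyA ts comp_polyXr.
  rewrite -D_proj_alg_eval; have [z zC <-] := acts_center _ _ (eval_acts q).
  exact: D_proj_center.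
move=> p q; rewrite -!D_proj_alg_eval => /D_projP/(acts_inj _ _ _ _ (eval_acts p) (eval_acts q)).
move=> /(congr1 (fun r => r \Po t)).
by rewrite -!comp_polyA st !comp_polyXr.
Qed.
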